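(* Let $\sigma$ be a function on $\mathfrak X\times\Omega\times[0,\tau]$ such that $T_\sigma:L^2(\mathfrak X)\to L^2(\mathfrak X)$ is a nuclear operator, and let $\sigma^*$ be the symbol of the adjoint $T_\sigma^*$. Then $T_\sigma:L^2(\mathfrak X)\to L^2(\mathfrak X)$ is normal if and only if for all $(b,\omega,s)\in\mathfrak X\times\Omega\times[0,\tau]$ $$\sum_{x\in\mathfrak X}q^{(\frac12-is)h_\omega(x)}\,\sigma(x,\omega,s)\,\bigl(\mathcal H^{-1}\sigma'(x,\cdot,\cdot)\bigr)(b)=\sum_{x\in\mathfrak X}q^{(\frac12-is)h_\omega(x)}\,\sigma^*(x,\omega,s)\,\bigl(\mathcal H^{-1}\sigma''(x,\cdot,\cdot)\bigr)(b),$$ where $\sigma'(x,\omega,s)=q^{(\frac12+is)h_\omega(x)}\,\overline{\sigma(x,\omega,s)}$ and $\sigma''(x,\omega,s)=q^{(\frac12+is)h_\omega(x)}\,\overline{\sigma^*(x,\omega,s)}$.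
   Context: Let $q\ge 2$ be an integer and let $\mathfrak X$ be (the vertex set of) the homogeneous tree of degree $q+1$: the connected graph without loops (cycles) in which every vertex has exactly $q+1$ neighbours. $d(x,y)$ is the number of edges between $x$ and $y$; a reference vertex $o$ is fixed and $|x|=d(o,x)$. $\mathfrak X$ carries the counting measure and $L^2(\mathfrak X)$ is taken with respect to it. $\Omega$ is the set of infinite geodesic rays $\omega=(\omega_0,\omega_1,\dots)$ with $\omega_0=o$. The height function is $h_\omega(x)=\lim_{m\to\infty}(m-d(x,\omega_m))=2|c(x,\omega)|-|x|$, where $c(x,\omega)$ is the last vertex on the geodesic path $[o,x]$ that lies on $\omega$. $\nu$ is the probability measure on $\Omega$ (with the $\sigma$-algebra generated by the sets $E(x)=\{\omega:\omega\text{ passes through }x\}$) with $\nu(E(x))=\frac{q}{(q+1)q^{|x|}}$ for $x\neq o$. Put $\tau=\pi/\log q$ and $d\mu(s)=c_P|c(s)|^{-2}ds$ on $[0,\tau]$, with $c_P=\frac{q\log q}{4\pi(q+1)}$ and $c(z)=\frac{q^{1/2}}{q+1}\,\frac{q^{1/2+iz}-q^{-1/2-iz}}{q^{iz}-q^{-iz}}$. The Fourier-Helgason transform of a finitely supported $f:\mathfrak X\to\mathbb C$ is $\mathcal Hf(\omega,s)=\sum_{y\in\mathfrak X}f(y)q^{(\frac12+is)h_\omega(y)}$, $\omega\in\Omega$, $s\in[0,\tau]$, and for a function $F$ on $\Omega\times[0,\tau]$, $(\mathcal H^{-1}F)(b)=\int_\Omega\int_0^\tau q^{(\frac12-is)h_\omega(b)}F(\omega,s)\,d\nu(\omega)\,d\mu(s)$,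 $b\in\mathfrak X$. For a function $\sigma$ (the symbol) and finitely supported $f$, the pseudo-differential operator $T_\sigma$ is defined formally by $T_\sigma f(x)=\int_\Omega\int_0^\tau q^{(\frac12-is)h_\omega(x)}\sigma(x,\omega,s)\mathcal Hf(\omega,s)\,d\nu(\omega)\,d\mu(s)$, $x\in\mathfrak X$. $T_\sigma^*$ is the Hilbert space adjoint, and its symbol $\sigma^*$ is the function with $T_\sigma^*=T_{\sigma^*}$. Normal means $T_\sigma T_\sigma^*=T_\sigma^*T_\sigma$. A bounded linear operator $T:X\to Y$ of complex Banach spaces is nuclear if there are sequences $\{x_n'\}$ in the dual $X'$ and $\{y_n\}$ in $Y$ with $\sum_n\|x_n'\|_{X'}\|y_n\|_Y<\infty$ and $Tx=\sum_n x_n'(x)y_n$ for all $x\in X$.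
   Formalization: The identity is stated for every b and almost every (ω,s), not for all (b,ω,s): a symbol is determined only up to null sets in (ω,s), and changing σ at a single point (x,ω,s) leaves T_σ unchanged but breaks the pointwise identity for a normal T_σ. Both sums are read as unordered sums. *)

(* Defs.v *)
From HB Require Import structures.
From mathcomp Require Import all_boot all_order all_algebra finmap.
From mathcomp Require Import complex.
From mathcomp Require Import all_classical all_reals all_analysis.
From mathcomp Require Import ring lra.
From mathcomp.analysis.showcase Require summability.
Import Order.TTheory GRing.Theory Num.Theory.
Import numFieldNormedType.Exports.
Import ComplexField.Normc.

Set Implicit Arguments.
Unset Strict Implicit.
Unset Printing Implicit Defensive.

Local Open Scope classical_set_scope.
Local Open Scope ring_scope.
Local Open Scope complex_scope.

(* The length bound on cycles is there because ucycle adj [:: x; y] holds as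
   soon as x and y are adjacent. *)
Record homogeneous_tree (q : nat) := HomogeneousTree {
  vertex :> choiceType ;
  adj : rel vertex ;
  two_le_q : (2 <= q)%N ;
  adj_sym : symmetric adj ;
  adj_irr : irreflexive adj ;
  adj_degree : forall x, exists2 s : seq vertex,
    uniq s & size s = q.+1 /\ forall y, (y \in s) = adj x y ;
  adj_connected : forall x y, exists2 p : seq vertex,
    path adj x p & last x p = y ;
  adj_acyclic : forall c : seq vertex, (2 < size c)%N -> ~ ucycle adj c }.

Section tree_distance.
Context (q : nat) (X : homogeneous_tree q).
Implicit Types (x y z : X) (p : seq X).

Definition walk_of_size x y (n : nat) : bool :=
  `[< exists p, [/\ path (@adj q X) x p, last x p = y & size p = n] >].

Lemma walk_of_size_ex x y : exists n, walk_of_size x y n.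
Proof.
have [p xp py] := adj_connected x y.
by exists (size p); apply/asboolP; exists p.
Qed.

Definition dist x y : nat := ex_minn (walk_of_size_ex x y).

Lemma dist_le x p : path (@adj q X) x p -> (dist x (last x p) <= size p)%N.
Proof.
move=> xp; rewrite /dist; case: ex_minnP => m _; apply.
by apply/asboolP; exists p.
Qed.

Lemma dist_walk x y :
  exists p, [/\ path (@adj q X) x p, last x p = y & size p = dist x y].
Proof. by rewrite /dist; case: ex_minnP => m /asboolP. Qed.

Lemma dist_triangle x y z : (dist x z <= dist x y + dist y z)%N.
Proof.
have [p [xp py <-]] := dist_walk x y.
have [p' [yp' p'z <-]] := dist_walk y z.
rewrite -size_cat -p'z -py -last_cat; apply: dist_le.
by rewrite cat_path xp py.
Qed.

Lemma dist_adj x y : adj x y -> (dist x y <= 1)%N.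
Proof. by move=> xy; rewrite (@dist_le x [:: y])//= xy. Qed.

Lemma distxx x : dist x x = 0%N.
Proof. by apply/eqP; rewrite -leqn0 (@dist_le x [::]). Qed.

Let avoid x y z := exists p,
  [/\ path (@adj q X) y p, last y p = z & x \notin y :: p].

Let avoid_sym x y z : avoid x y z -> avoid x z y.
Proof.
move=> [p [yp <- xp]]; exists (rev (belast y p)); split.
- rewrite rev_path; rewrite (@eq_path _ _ (@adj q X))//.
  by move=> a b /=; rewrite adj_sym.
- by case: (p) => //= a s; rewrite rev_cons last_rcons.
- apply: contra xp; rewrite inE => /predU1P[->|]; first exact: mem_last.
  by rewrite mem_rev => /mem_belast.
Qed.

Let avoid_trans x y z t : avoid x y z -> avoid x z t -> avoid x y t.
Proof.
move=> [p [yp pz xp]] [p' [zp' p't xp']]; exists (p ++ p'); split.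
- by rewrite cat_path yp pz.
- by rewrite last_cat pz.
- rewrite -cat_cons mem_cat negb_or xp /=.
  by move: xp'; rewrite inE negb_or => /andP[].
Qed.

Let avoid_adj x y z : adj x y -> adj x z -> avoid x y z -> y = z.
Proof.
move=> xy xz [p [yp pz xp]]; move: pz xp.
case/shortenP : yp => p' yp' up' sub pz xp; apply: contrapT => yz.
apply: (@adj_acyclic q X (x :: y :: p')).
  by case: p' pz {yp' up' sub} => //= ->.
apply/andP; split; last first.
  rewrite cons_uniq up' andbT; apply: contra xp.
  by rewrite !inE => /orP[->//|/sub ->]; rewrite orbT.
by rewrite /= rcons_path yp' xy pz /= adj_sym.
Qed.

Let avoid_dist o x y : y <> x -> (dist o y <= dist o x)%N -> avoid x o y.
Proof.
move=> yx yn; have [p [op py sp]] := dist_walk o y.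
exists p; split => //; apply/negP; rewrite inE => /predU1P[xo|].
  move: yn; rewrite -sp xo distxx leqn0 size_eq0 => /eqP p0.
  by apply: yx; rewrite -py p0.
move=> xp; case: (splitPr xp) py op sp => p1 p2 py op sp.
have : (dist o x <= (size p1).+1)%N.
  have -> : x = last o (rcons p1 x) by rewrite last_rcons.
  rewrite -(size_rcons p1 x); apply: dist_le.
  by move: op; rewrite -cat_rcons cat_path => /andP[].
move=> /(leq_trans yn); rewrite -sp size_cat /= addnS ltnS -[leqRHS]addn0.
rewrite leq_add2l leqn0 size_eq0 => /eqP p20.
by apply: yx; rewrite -py p20 last_cat.
Qed.

Lemma dist_extend o x : exists y, adj x y /\ dist o y = (dist o x).+1.
Proof.
apply: contrapT => H.
have le y : adj x y -> (dist o y <= dist o x)%N.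
  move=> xy; rewrite leqNgt; apply/negP => lt; apply: H; exists y; split => //.
  apply/eqP; rewrite eqn_leq lt andbT -addn1.
  by rewrite (leq_trans (dist_triangle o x y))// leq_add2l dist_adj.
have ne y : adj x y -> y <> x by move=> + yx; rewrite yx adj_irr.
have [s us [ss sE]] := adj_degree x.
case: s us ss sE => [|y [|z s]]; [by []| |].
  by move=> _ /= [q0] _; have := leq_trans (two_le_q X) (eq_leq (esym q0)).
move=> /= /andP[+ _] _ sE; rewrite inE negb_or => /andP[/eqP yz _].
have xy : adj x y by rewrite -sE mem_head.
have xz : adj x z by rewrite -sE !inE eqxx orbT.
apply: yz; apply: (avoid_adj xy xz); apply: (@avoid_trans _ _ o).
  by apply: avoid_sym; apply: avoid_dist; [exact: ne|exact: le].
by apply: avoid_dist; [exact: ne|exact: le].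
Qed.

End tree_distance.

Record ray (q : nat) (X : homogeneous_tree q) (o : X) := Ray {
  ray_vertex :> nat -> X ;
  ray_start : ray_vertex 0 = o ;
  ray_geodesic : forall m n, dist (ray_vertex m) (ray_vertex (m + n)%N) = n }.

Section boundary.
Context (q : nat) (X : homogeneous_tree q) (o : X).

Lemma ray_ex : exists _ : ray o, True.
Proof.
have [f fP] := choice (dist_extend o).
pose w n := iter n f o.
have wo n : dist o (w n) = n.
  by elim: n => [|n IHn]; [exact: distxx|rewrite /= (fP _).2 IHn].
have wle m n : (dist (w m) (w (m + n)%N) <= n)%N.
  elim: n => [|n IHn]; first by rewrite addn0 distxx.
  rewrite (leq_trans (dist_triangle _ (w (m + n)%N) _))//.
  by rewrite addnS -[leqRHS]addn1 leq_add// dist_adj//; exact: (fP _).1.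
unshelve eexists => //; apply: (@Ray q X o w) => // m n; apply/eqP.
by rewrite eqn_leq wle/= -(leq_add2l m) -[X in (X <= _)%N]wo -{2}(wo m)
  dist_triangle.
Qed.

HB.instance Definition _ := gen_eqMixin (ray o).
HB.instance Definition _ := gen_choiceMixin (ray o).
HB.instance Definition _ := isPointed.Build (ray o) (sval (cid ray_ex)).

End boundary.

HB.instance Definition _ (R : rcfType) := NormedModule.copy R[i] (R[i])^o.

Section l2.
Context (R : realType) (I : choiceType).
Implicit Types f g : I -> R[i].

Definition sqsum f : \bar R := \esum_(x in [set: I]) (normc (f x) ^+ 2)%:E.

Definition l2_pred : {pred I -> R[i]} := [pred f | `[< (sqsum f < +oo)%E >]].

Lemma sqsum_ge0 f : (0 <= sqsum f)%E.
Proof. by apply: esum_ge0 => x _; rewrite lee_fin sqr_ge0. Qed.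

Let esumZ (a : R) (u : I -> R) : 0 <= a -> (forall x, 0 <= u x) ->
  (\esum_(x in [set: I]) (a * u x)%:E
    <= a%:E * \esum_(x in [set: I]) (u x)%:E)%E.
Proof.
move=> a0 u0; apply: ge_ereal_sup => _ [A [finA _] <-].
under eq_fsbigr do rewrite EFinM.
rewrite -ge0_mule_fsumr; last by move=> x; rewrite lee_fin.
by rewrite lee_wpmul2l ?lee_fin//; apply: esum_ge; exists A.
Qed.

Let sqsumD f g (s t : R) : 0 < s -> 0 < t -> s^-1 + t^-1 = 1 ->
  (sqsum (fun x => f x + g x)%R
    <= s%:E * sqsum f + t%:E * sqsum g)%E.
Proof.
move=> s0 t0 st; pose u x : R := normc (f x) ^+ 2; pose v x : R := normc (g x) ^+ 2.
have u0 x : 0 <= u x by exact: sqr_ge0.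
have v0 x : 0 <= v x by exact: sqr_ge0.
apply: (@le_trans _ _
  (\esum_(x in [set: I]) ((s * u x)%:E + (t * v x)%:E))%E).
  apply: le_esum => x _; rewrite -EFinD lee_fin.
  have := le_normcD (f x) (g x).
  have n0 (z : R[i]) : 0 <= normc z by case: z => a b; exact: sqrtr_ge0.
  move=> h; apply: (@le_trans _ _ ((normc (f x) + normc (g x)) ^+ 2)).
    by rewrite ler_pXn2r// nnegrE ?addr_ge0.
  rewrite /u /v; move: (normc (f x)) (normc (g x)) => a b.
  have e : s * t = s + t.
    by rewrite -[LHS]mulr1 -st; field; rewrite !gt_eqF.
  have s1 : 0 < s - 1.
    by rewrite -(pmulr_lgt0 _ t0) mulrBl mul1r e addrK.
  rewrite -subr_ge0 -(pmulr_rge0 _ s1).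
  have -> : (s - 1) * (s * a ^+ 2 + t * b ^+ 2 - (a + b) ^+ 2)
      = ((s - 1) * a - b) ^+ 2 + (s * t - (s + t)) * b ^+ 2 by ring.
  by rewrite e subrr mul0r addr0 sqr_ge0.
rewrite esumD; [|by move=> *; rewrite lee_fin mulr_ge0// ltW..].
by rewrite leeD// esumZ// ltW.
Qed.

Let sqsumZ (a : R[i]) f :
  (sqsum (fun x => a * f x)%R <= (normc a ^+ 2)%:E * sqsum f)%E.
Proof.
rewrite /sqsum; under eq_esum do rewrite normcM exprMn.
by apply: esumZ => *; exact: sqr_ge0.
Qed.

Fact l2_submod_closed : submod_closed l2_pred.
Proof.
split.
  apply/asboolP; rewrite /sqsum esum1 ?ltry// => x _.
  by rewrite -[0 : I -> R[i]]/(fun=> 0) normc0 expr0n.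
move=> a f g /asboolP ff /asboolP gf; apply/asboolP.
have st : 2^-1 + 2^-1 = 1 :> R by field.
apply: le_lt_trans (sqsumD (fun x => a * f x) g _ _ st) _ => //.
rewrite lte_add_pinfty// lte_mul_pinfty ?lee_fin//.
by apply: le_lt_trans (sqsumZ a f) _; rewrite lte_mul_pinfty ?lee_fin ?sqr_ge0.
Qed.

HB.instance Definition _ :=
  GRing.isSubmodClosed.Build R[i] (I -> R[i]) l2_pred l2_submod_closed.

Record l2 := L2 { l2_fun :> I -> R[i] ; l2P : l2_fun \in l2_pred }.

HB.instance Definition _ := [isSub for l2_fun].
HB.instance Definition _ := [Choice of l2 by <:].
HB.instance Definition _ := [SubChoice_isSubLmodule of l2 by <:].

Definition l2_norm (f : l2) : R := Num.sqrt (fine (sqsum f)).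

Let sqsumE (f : l2) : sqsum f = (l2_norm f ^+ 2)%:E.
Proof.
have /asboolP ff := l2P f.
rewrite /l2_norm sqr_sqrtr ?fine_ge0 ?sqsum_ge0// fineK//.
by rewrite ge0_fin_numE// sqsum_ge0.
Qed.

Let le_l2_norm (f : l2) (a : R) :
  0 <= a -> (sqsum f <= (a ^+ 2)%:E)%E -> l2_norm f <= a.
Proof.
move=> a0; rewrite sqsumE lee_fin ler_pXn2r// nnegrE//.
exact: sqrtr_ge0.
Qed.

Let l2_norm_eq0 (f : l2) : l2_norm f = 0 -> f = 0.
Proof.
move=> f0; apply/val_inj/funext => x /=; apply: eq0_normc; apply/eqP.
rewrite -sqrf_eq0 eq_le sqr_ge0 andbT -lee_fin.
have -> : 0%:E = sqsum f by rewrite sqsumE f0 expr0n.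
by apply: esum_ge; exists [set x]; [split => //; exact: finite_set1|rewrite fsbig_set1].
Qed.

Let l2_normD (f g : l2) : l2_norm (f + g) <= l2_norm f + l2_norm g.
Proof.
have n0 h : 0 <= l2_norm h by exact: sqrtr_ge0.
have [/l2_norm_eq0 ->|f0] := eqVneq (l2_norm f) 0; first by rewrite add0r lerDr.
have [/l2_norm_eq0 ->|g0] := eqVneq (l2_norm g) 0; first by rewrite addr0 lerDl.
apply: le_l2_norm; first by rewrite addr_ge0.
have fp : 0 < l2_norm f by rewrite lt_neqAle eq_sym f0 n0.
have gp : 0 < l2_norm g by rewrite lt_neqAle eq_sym g0 n0.
have fg0 : l2_norm f + l2_norm g != 0 by rewrite gt_eqF ?addr_gt0.
apply: le_trans (@sqsumD f g ((l2_norm f + l2_norm g) / l2_norm f)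
  ((l2_norm f + l2_norm g) / l2_norm g) _ _ _) _.
- by rewrite divr_gt0 ?addr_gt0.
- by rewrite divr_gt0 ?addr_gt0.
- by field; rewrite fg0 f0 g0.
- rewrite !sqsumE -!EFinM -EFinD lee_fin le_eqVlt; apply/orP; left; apply/eqP.
  by field; rewrite f0 g0.
Qed.

Let l2_normZ (a : R[i]) (f : l2) : l2_norm (a *: f) = normc a * l2_norm f.
Proof.
have n0 h : 0 <= l2_norm h by exact: sqrtr_ge0.
have c0 (z : R[i]) : 0 <= normc z by case: z => *; exact: sqrtr_ge0.
have le b h : l2_norm (b *: h) <= normc b * l2_norm h.
  apply: le_l2_norm; first by rewrite mulr_ge0.
  by apply: le_trans (sqsumZ b h) _; rewrite sqsumE -EFinM exprMn.
apply/eqP; rewrite eq_le le /=; have [->|a0] := eqVneq a 0.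
  by rewrite normc0 mul0r.
have an0 : 0 < normc a.
  by rewrite lt_neqAle c0 andbT eq_sym; apply: contra a0 => /eqP/eq0_normc ->.
rewrite mulrC -ler_pdivlMr// mulrC -normcV.
by apply: le_trans (le a^-1 (a *: f)); rewrite scalerA mulVf// scale1r.
Qed.

Let normD (f g : l2) :
  (l2_norm (f + g))%:C <= (l2_norm f)%:C + (l2_norm g)%:C :> R[i].
Proof. by rewrite -rmorphD lecR; exact: l2_normD. Qed.

Let normZ (a : R[i]) (f : l2) :
  (l2_norm (a *: f))%:C = `|a| * (l2_norm f)%:C :> R[i].
Proof. by rewrite l2_normZ rmorphM. Qed.

Let norm0_eq0 (f : l2) : (l2_norm f)%:C = 0 :> R[i] -> f = 0.
Proof. by move=> [] /l2_norm_eq0. Qed.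

HB.instance Definition _ :=
  Lmodule_isNormed.Build R[i] l2 normD normZ norm0_eq0.

End l2.

(* Unordered (hence absolute) summability of a family of complex numbers. *)
Definition has_sum (R : realType) (I : choiceType) (u : I -> R[i]) (v : R[i]) :=
  summability.partial_sum u A @[A --> summability.totally] --> v.

Definition l2_inner (R : realType) (I : choiceType) (f g : l2 R I) : R[i] :=
  lim (summability.partial_sum (fun x => f x * (g x)^*) A
    @[A --> summability.totally]).

Definition is_adjoint (R : realType) (I : choiceType)
    (T Tstar : {linear l2 R I -> l2 R I}) :=
  forall f g, l2_inner (T f) g = l2_inner f (Tstar g).

Definition dual_norm (R : realType) (V : normedModType R[i])
    (phi : {linear V -> R[i]}) : R :=
  sup [set normc (phi v) | v in [set v | `|v| <= 1]].

Definition nuclear (R : realType) (V W : normedModType R[i])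
    (T : {linear V -> W}) :=
  continuous T /\
  exists (phi : nat -> {linear V -> R[i]}) (w : nat -> W),
    [/\ forall n, continuous (phi n),
      (\sum_(0 <= n <oo) (dual_norm (phi n) * complex.Re `|w n|)%:E < +oo)%E &
      forall v, [series phi n v *: w n]_n @ \oo --> T v].

Section fourier_helgason.
Context (R : realType) (q : nat) (X : homogeneous_tree q) (o : X).

Definition passing (x : X) : set (ray o) := [set w | exists n, w n = x].

Definition boundary := g_sigma_algebraType (range passing).

Definition is_boundary_measure (nu : set boundary -> \bar R) :=
  forall x, x != o ->
    nu (passing x) = (q%:R / (q.+1%:R * q%:R ^+ dist o x))%:E.

Definition height (w : boundary) (x : X) : R :=
  lim ((m%:R - (dist x (w m))%:R : R) @[m --> \oo]).

Definition qpow (z : R[i]) : R[i] :=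
  let r := q%:R `^ complex.Re z in
  let t := complex.Im z * ln q%:R in
  (r * cos t) +i* (r * sin t).

Definition tau : R := pi / ln q%:R.

Definition c_P : R := q%:R * ln q%:R / (4 * pi * q.+1%:R).

Definition cfun (z : R[i]) : R[i] :=
  (Num.sqrt q%:R / q.+1%:R)%:C *
  ((qpow (2^-1 + 'i%C * z) - qpow (- 2^-1 - 'i%C * z)) /
   (qpow ('i%C * z) - qpow (- 'i%C * z))).

(* cfun has poles at 0 and tau, where |c(s)|^-2 is 0; with division by zero
   equal to zero, this definition gives the same value there. *)
Definition plancherel_density (s : R) : R := c_P * (normc (cfun s%:C)) ^- 2.

Variable nu : probability boundary R.

Definition phase_space : set (boundary * R) :=
  [set: boundary] `*` `[0, tau].

Definition base_measure := (nu \x @lebesgue_measure R)%E.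

HB.instance Definition _ := Measure.on base_measure.

(* Integrability and integral of a complex function over boundary x [0, tau]
   against dnu(w) dmu(s), where dmu(s) = plancherel_density s ds. *)
Definition dnumu_integrable (F : boundary -> R -> R[i]) :=
  base_measure.-integrable phase_space
    (fun ws => (plancherel_density ws.2 * complex.Re (F ws.1 ws.2))%:E) /\
  base_measure.-integrable phase_space
    (fun ws => (plancherel_density ws.2 * complex.Im (F ws.1 ws.2))%:E).

Definition dnumu_integral (F : boundary -> R -> R[i]) : R[i] :=
  (\int[base_measure]_(ws in phase_space)
     (plancherel_density ws.2 * complex.Re (F ws.1 ws.2))) +i*
  (\int[base_measure]_(ws in phase_space)
     (plancherel_density ws.2 * complex.Im (F ws.1 ws.2))).

Definition fourier (f : X -> R[i]) (w : boundary) (s : R) : R[i] :=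
  \sum_(y \in [set: X]) f y * qpow ((2^-1 +i* s) * (height w y)%:C).

Definition inverse_fourier (F : boundary -> R -> R[i]) (b : X) : R[i] :=
  dnumu_integral (fun w s => qpow ((2^-1 -i* s) * (height w b)%:C) * F w s).

Definition symbol := X -> boundary -> R -> R[i].

Definition pdo_integrand (sigma : symbol) (f : X -> R[i]) (x : X)
    (w : boundary) (s : R) : R[i] :=
  qpow ((2^-1 -i* s) * (height w x)%:C) * sigma x w s * fourier f w s.

(* T is the bounded operator on L^2(X) that agrees with T_sigma on finitely
   supported functions. T determines sigma x only up to a null set of
   boundary x [0, tau], so pointwise identities between symbols are meant almost
   everywhere in (w, s). *)
Definition is_pdo (sigma : symbol) (T : {linear l2 R X -> l2 R X}) :=
  continuous T /\
  forall f : l2 R X, finite_set [set y | f y != 0] -> forall x,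
    dnumu_integrable (pdo_integrand sigma f x) /\
    T f x = dnumu_integral (pdo_integrand sigma f x).

Definition twisted_conj (sigma : symbol) : symbol := fun x w s =>
  qpow ((2^-1 +i* s) * (height w x)%:C) * (sigma x w s)^*.

End fourier_helgason.

(* Main.v *)
(* On the delta functions, T_sigma has matrix entries
     K(x, y) = int a_x(z) conj(e_y(z)) dz,   a_x = |c|^-2 e_x sigma(x, .),
   where e_y denotes the plane waves q^((1/2 - is) h(y)), and
   H^-1 sigma'(x, .)(b) = conj K(x, b). So the sums of the statement, multiplied
   by the Plancherel density, are G_b = sum_x a_x conj K(x, b), and the
   coefficient of G_b along e_y is formally <T delta_y, T delta_b>. Normality is
   the equality of these Gram matrices for T and T^*.
   Convergence and uniqueness both come from one estimate: if F is integrable and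
   its coefficients along the e_y are square summable with sum M^2, then
     2 int |Re F| <= t M^2 + 1/t   for all t > 0.
   For a sign function g, int F g is controlled by the coefficients of F when g is
   a finite combination of plane waves, by orthogonality of the plane waves, and
   the general case follows because the plane waves generate the sigma-algebra up
   to bounded pointwise limits. Applied to the rows of K, with M the row norm and
   1/t = |K(x, b)|, the estimate makes G_b absolutely convergent almost everywhere
   because nuclear operators are Hilbert-Schmidt; with M = 0 it shows that a
   function all of whose coefficients vanish is zero almost everywhere. *)
Require Import Defs.
From mathcomp Require Import all_boot all_order all_algebra finmap.
From mathcomp Require Import complex.
From mathcomp Require Import all_classical all_reals all_analysis.
From mathcomp Require Import measurable_realfun ring lra zify.
From mathcomp.analysis.showcase Require summability.
Import Order.TTheory GRing.Theory Num.Theory.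
Import numFieldNormedType.Exports.
Import ComplexField.Normc.

Set Implicit Arguments.
Unset Strict Implicit.
Unset Printing Implicit Defensive.

Local Open Scope classical_set_scope.
Local Open Scope complex_scope.
Local Open Scope ring_scope.

#[local] Existing Instance summability.totally_filter.

(** * The tree and its boundary *)

Section tree.
Context (q : nat) (X : homogeneous_tree q).
Implicit Types x y z o : X.

(** The obstacle is that [is_pdo] makes a_x integrable against each plane wave but does not place it
    in L^2, so the Plancherel theorem cannot be applied to a_x itself. Hence an L^1 estimate by
    pairing with bounded functions. Cauchy-Schwarz enters with the parameter t because the two terms
    can then be summed over x separately and pass to dominated limits. Every wave has squared norm
    [density_mass]; this constant cancels against functions of modulus one, which leaves exactly
    1/t. The span of the waves is not closed under products, so the monotone class argument is run
    on the multipliers of its closure under bounded limits. Summing over neighbours gives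
    multiplication by the cosine of the angle, hence by every bounded measurable function of s.
    Comparing the wave at a vertex with that at its parent, and dividing by functions of s, then
    isolates the indicator of E(x). Orthogonality rests on the explicit spherical function: against
    the density it integrates, at distance k, to a multiple of q S(k+1) - S(k-1), and a recursion
    for S shows that this is zero. *)

Lemma dist_eq0 x y : (dist x y == 0)%N = (x == y).
Proof.
apply/eqP/eqP => [xy0|->]; last exact: distxx.
have [p [_ py]] := dist_walk x y.
by rewrite xy0 => /size0nil p0; rewrite -py p0.
Qed.

Lemma rev_walk x p : path (@adj q X) x p ->
  path (@adj q X) (last x p) (rev (belast x p)) /\
  last (last x p) (rev (belast x p)) = x.
Proof.
move=> xp; split.
  rewrite rev_path (@eq_path _ _ (@adj q X))// => a b /=.
  by rewrite adj_sym.
by case: p {xp} => //= a s; rewrite rev_cons last_rcons.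
Qed.

Lemma dist_sym x y : dist x y = dist y x.
Proof.
have le (a b : X) : (dist a b <= dist b a)%N.
  have [p [bp pa <-]] := dist_walk b a.
  have [ap' p'b] := rev_walk bp.
  by have := dist_le ap'; rewrite p'b pa size_rev size_belast.
by apply/eqP; rewrite eqn_leq !le.
Qed.

Lemma dist_adj_le o x y : adj x y -> (dist o y <= (dist o x).+1)%N.
Proof.
move=> xy; rewrite -addn1 (leq_trans (dist_triangle o x y))// leq_add2l.
exact: dist_adj.
Qed.

(** A vertex on a geodesic from [o] to [y], other than [y], is strictly closer to [o] than [y]
    is. *)
Lemma geodesic_avoids o x y : y != x -> (dist o y <= dist o x)%N ->
  exists p, [/\ path (@adj q X) o p, last o p = y & x \notin o :: p].
Proof.
move=> yx yn; have [p [po py sp]] := dist_walk o y.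
exists p; split => //; apply/negP; rewrite inE => /predU1P[xo|xp].
  move: yn; rewrite -xo distxx leqn0 dist_eq0 eq_sym => /eqP yx'.
  by rewrite -yx' eqxx in yx.
case: (splitPr xp) py po sp => p1 p2 py po sp.
have xp1 : (dist o x <= (size p1).+1)%N.
  rewrite -(size_rcons p1 x) -[X in dist o X](last_rcons o p1 x).
  by apply: dist_le; move: po; rewrite -cat_rcons cat_path => /andP[].
have := leq_trans yn xp1; rewrite -sp size_cat /= addnS ltnS -[leqRHS]addn0.
rewrite leq_add2l leqn0 size_eq0 => /eqP p20.
by move: yx; rewrite -py p20 last_cat eqxx.
Qed.

(* Two geodesics from [o] to distinct such neighbours would close up, through
   [x], to a cycle. *)
Lemma closer_neighbor_unique o x y z : adj x y -> adj x z ->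
  (dist o y <= dist o x)%N -> (dist o z <= dist o x)%N -> y = z.
Proof.
move=> xy xz yo zo.
have adj_neq t : adj x t -> t != x.
  by apply: contraTneq => ->; rewrite adj_irr.
have [p [po py xp]] := geodesic_avoids (adj_neq _ xy) yo.
have [r [ro rz xr]] := geodesic_avoids (adj_neq _ xz) zo.
pose s := rev (belast o p) ++ r.
have [yp lo] := rev_walk po; rewrite py in yp lo.
have ys : path (@adj q X) y s by rewrite cat_path lo ro andbT.
have sz : last y s = z by rewrite last_cat lo.
have xs : x \notin y :: s.
  rewrite -cat_cons mem_cat negb_or; apply/andP; split.
    apply: contra xp; rewrite inE => /predU1P[->|]; first by rewrite -py mem_last.
    by rewrite mem_rev => /mem_belast.
  by apply: contra xr => xr; rewrite inE xr orbT.
apply: contrapT => yz; move: sz xs; case/shortenP : ys => s' ys' us' sub sz xs.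
apply: (@adj_acyclic q X (x :: y :: s')).
  by case: s' sz {ys' us' sub} => //= e; case: yz.
apply/andP; split; last first.
  rewrite cons_uniq us' andbT; apply: contra xs.
  by rewrite !inE => /orP[->//|/sub ->]; rewrite orbT.
by rewrite /= rcons_path ys' xy sz /= adj_sym.
Qed.

Lemma parent_ex o x : x != o -> exists y, adj x y /\ dist o x = (dist o y).+1.
Proof.
move=> xo; have [p [po px sp]] := dist_walk o x.
case/lastP: p po px sp => [_ /= ox|p a].
  by rewrite ox eqxx in xo.
rewrite rcons_path last_rcons size_rcons => /andP[po pa] <- sp.
exists (last o p); split; first by rewrite adj_sym.
apply/eqP; rewrite eqn_leq dist_adj_le//= -sp ltnS.
exact: dist_le.
Qed.

(** This is bipartiteness. A neighbour [y] of [x] at the same distance from [o] would, by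
    [closer_neighbor_unique], coincide with the neighbour of [x] that is one step closer. *)
Lemma dist_adj_neq o x y : adj x y -> dist o x != dist o y.
Proof.
move=> xy; apply/negP => /eqP e; have [xo|xo] := eqVneq x o.
  move: e; rewrite xo distxx => /esym/eqP; rewrite dist_eq0 => /eqP oy.
  by move: xy; rewrite xo oy adj_irr.
have [z [xz zo]] := parent_ex xo.
have yz : y = z by apply: (@closer_neighbor_unique o x); rewrite ?zo ?e// -e zo.
by move: zo; rewrite -yz e => /eqP; rewrite -[X in X == _]addn0 -addn1 eqn_add2l.
Qed.

Lemma dist_adj_cases o x y : adj x y ->
  dist o y = (dist o x).+1 \/ dist o x = (dist o y).+1.
Proof.
move=> xy; have := dist_adj_neq o xy.
have := dist_adj_le o xy.
have : (dist o x <= (dist o y).+1)%N by apply: dist_adj_le; rewrite adj_sym.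
lia.
Qed.

Lemma countable_vertices : countable [set: X].
Proof.
have [hX|noX] := pselect (exists o : X, True); last first.
  rewrite (_ : [set: X] = set0)//.
  by rewrite -subset0 => x _; apply: noX; exists x.

case: hX => o _; have cS n : countable [set x | dist o x = n].
  elim: n => [|n IHn].
    apply: (@sub_countable _ _ _ [set o]); last exact: countable1.
    by apply: subset_card_le => x /= /eqP; rewrite dist_eq0 => /eqP.
  pose nb x := [set y | adj x y].
  apply: (@sub_countable _ _ _ (\bigcup_(x in [set x | dist o x = n]) nb x)).
    apply: subset_card_le => y /= yn.
    have yo : y != o by rewrite eq_sym -dist_eq0 yn.
    have [x [yx e]] := parent_ex yo.
    exists x => /=; first by move: yn; rewrite e => -[].
    by rewrite /nb /= adj_sym.
  apply: bigcup_countable => // x _; apply: finite_set_countable.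
  have [s _ [_ sE]] := adj_degree x.
  rewrite (_ : nb x = [set` s]); first exact: finite_seq.
  by apply/seteqP; split => y /=; rewrite /nb /= sE.
rewrite (_ : [set: X] = \bigcup_n [set x | dist o x = n]).
  exact: bigcup_countable.
by apply/seteqP; split => // x _; exists (dist o x).
Qed.

End tree.

(** * Rays and the height function *)

Section rays.
Context (R : realType) (q : nat) (X : homogeneous_tree q) (o : X).
Implicit Types (x y p : X) (w : ray o).

Lemma dist1_adj x y : dist x y = 1%N -> adj x y.
Proof.
have [p [xp <- <-]] := dist_walk x y; case: p xp => [|a [|b p]]//=.
by rewrite andbT.
Qed.

Lemma dist_ray w n : dist o (w n) = n.
Proof. by rewrite -[in dist _](ray_start w) -[n in w n]add0n ray_geodesic. Qed.

Lemma ray_adj w n : adj (w n) (w n.+1).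
Proof. by apply: dist1_adj; rewrite -addn1 ray_geodesic. Qed.

Lemma ray_passingP w x : passing x w <-> w (dist o x) = x.
Proof. by split=> [[n <-]|e]; [rewrite dist_ray|exists (dist o x)]. Qed.

(** A ray that turned back towards [x] would have [w n] and [w n.+2] as two neighbours of [w n.+1]
    closer to [x]; these coincide, against geodesicity. *)
Lemma ray_moves_away x w n : dist x (w n.+1) = (dist x (w n)).+1 ->
  dist x (w n.+2) = (dist x (w n.+1)).+1.
Proof.
move=> inc; have [//|dec] := dist_adj_cases x (ray_adj w n.+1).
have e : w n = w n.+2.
  apply: (@closer_neighbor_unique _ _ x (w n.+1)).
  - by rewrite adj_sym ray_adj.
  - exact: ray_adj.
  - by rewrite inc.
  - by rewrite dec.
by have := ray_geodesic w n 2; rewrite addn2 -e distxx.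
Qed.

Lemma ray_moves_away_from x w n k : dist x (w n.+1) = (dist x (w n)).+1 ->
  dist x (w (n + k)%N) = (dist x (w n) + k)%N.
Proof.
move=> inc; suff [//] : dist x (w (n + k)%N) = (dist x (w n) + k)%N /\
    dist x (w (n + k).+1) = (dist x (w (n + k)%N)).+1.
elim: k => [|k [IH1 IH2]]; first by rewrite !addn0.
by rewrite !addnS IH2 IH1; split => //; rewrite -IH1 -IH2 ray_moves_away.
Qed.

(** Until the first step that moves away from [x], each step reduces the distance by one. This can
    last for at most [dist o x] steps, which is the use made of it in [ray_far]. *)
Lemma ray_approaches x w n : (exists2 j, (j < n)%N &
    dist x (w j.+1) = (dist x (w j)).+1) \/
  (dist x (w n) + n)%N = dist o x.
Proof.
elim: n => [|n [[j jn inc]|IH]].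
- by right; rewrite ray_start addn0 dist_sym.
- by left; exists j => //; rewrite ltnS ltnW.
- have [inc|dec] := dist_adj_cases x (ray_adj w n); first by left; exists n.
  by right; rewrite -IH dec addnS addSn.
Qed.

Lemma ray_far x w m k : (dist o x <= m)%N ->
  dist x (w (m + k)%N) = (dist x (w m) + k)%N.
Proof.
move=> xm; have [[j]|] := ray_approaches x w m.+1; last first.
  by move=> e; exfalso; move: xm; rewrite -e; lia.
rewrite ltnS => jm inc; have [d dE] : exists d, m = (j + d)%N.
  by exists (m - j)%N; rewrite subnKC.
by rewrite dE -addnA !ray_moves_away_from// addnA.
Qed.

Lemma heightE w x m : (dist o x <= m)%N ->
  height R w x = m%:R - (dist x (w m))%:R.
Proof.
move=> xm; apply/cvg_lim => //; apply: cvg_near_cst.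
exists m => // n /= mn; rewrite -(subnKC mn) ray_far// !natrD.
by rewrite opprD addrACA subrr addr0.
Qed.

Lemma height_o w : height R w o = 0.
Proof. by rewrite (@heightE _ _ 0) ?distxx// ray_start distxx subrr. Qed.

Lemma height_passing w x y : passing x w -> (dist o y <= dist o x)%N ->
  height R w y = (dist o x)%:R - (dist y x)%:R.
Proof. by move=> /ray_passingP wx yx; rewrite (heightE _ yx) wx. Qed.

Lemma height_passing_self w x : passing x w -> height R w x = (dist o x)%:R.
Proof. by move=> /height_passing ->//; rewrite distxx subr0. Qed.

Lemma dist_adj_height w x p : adj x p -> height R w x = height R w p + 1 \/
  height R w x = height R w p - 1.
Proof.
move=> xp; pose m := maxn (dist o x) (dist o p).
rewrite !(@heightE _ _ m) ?leq_maxl ?leq_maxr//.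
rewrite ![dist _ (w m)]dist_sym.
by have [->|->] := dist_adj_cases (w m) xp; rewrite -natr1; [left|right]; ring.
Qed.

(** The ray starts on the side of [p] of the edge. Where it changes to the side of [x] it must cross
    this very edge, since no other edge joins the two sides. *)
Lemma approaching_edge_passes w x p m : adj x p -> dist o x = (dist o p).+1 ->
  dist p (w m) = (dist x (w m)).+1 -> passing x w.
Proof.
move=> xp xo; elim: m => [|m IHm].
  rewrite !ray_start ![dist _ o]dist_sym xo => e; exfalso; lia.
move=> inc; have [inc'|dec] := dist_adj_cases (w m) xp.
  by apply: IHm; rewrite ![dist _ (w m)]dist_sym.
rewrite ![dist (w m) _]dist_sym in dec.
have xmS := dist_adj_cases x (ray_adj w m).
have pmS := dist_adj_cases p (ray_adj w m).
have [p0|p0] := posnP (dist p (w m)).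
  exists m.+1; apply/eqP; rewrite -dist_eq0 dist_sym; lia.
have wp : w m != p by rewrite eq_sym -dist_eq0 -lt0n.
have [v [wv vp]] := parent_ex wp.
(* The neighbour [v] of [w m] towards [p] and the next vertex [w m.+1] are both closer to [x] than
   [w m], so they agree; but one is closer to [p] than [w m] and the other is farther. *)
have vE : v = w m.+1.
  apply: (@closer_neighbor_unique _ _ x (w m)) => //.
  - exact: ray_adj.
  - by have := dist_adj_cases v xp; rewrite ![dist v _]dist_sym; lia.
  - lia.
move: vp; rewrite vE; lia.
Qed.

Lemma height_child w x p : adj x p -> dist o x = (dist o p).+1 ->
  height R w x = height R w p + (if `[< passing x w >] then 1 else - 1).
Proof.
move=> xp xo; have px : (dist o p <= dist o x)%N by rewrite xo.
have [xw|xw] := asboolP.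
  have [->//|] := dist_adj_height w xp.
  rewrite (height_passing_self xw) (height_passing xw px).
  have : 0 <= (dist p x)%:R :> R := ler0n _ _.
  lra.
rewrite !(@heightE _ _ (dist o x))//.
have [|] := dist_adj_cases (w (dist o x)) xp; rewrite ![dist (w _) _]dist_sym.
  by move=> /(approaching_edge_passes xp xo).
by move=> ->; rewrite -natr1; ring.
Qed.

(** The ray serves to describe the geodesic from [o] to [x]. As [y] is no farther from [o] than [x]
    and differs from it, the ray is already moving away from [y] when it steps from [p] to [x]. *)
Lemma dist_parent w x y p : passing x w -> adj x p -> dist o x = (dist o p).+1 ->
  (dist o y <= dist o x)%N -> x != y -> dist x y = (dist p y).+1.
Proof.
move=> /ray_passingP xw xp xo yx xy; rewrite xo in xw.
have pE : w (dist o p) = p.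
  apply: (@closer_neighbor_unique _ _ o x) => //; last by rewrite xo.
    by rewrite -xw adj_sym; exact: ray_adj.
  by rewrite dist_ray xo.
rewrite ![dist _ y]dist_sym -xw -pE dist_ray.
have [[j jp inc]|] := ray_approaches y w (dist o p).+1; last first.
  by move: yx xy; rewrite -dist_eq0 xw xo (dist_sym y); lia.
rewrite ltnS in jp; have := ray_moves_away_from (dist o p - j)%N inc.
have := ray_moves_away_from (dist o p - j).+1 inc.
by rewrite addnS subnKC// => -> ->; rewrite addnS.
Qed.

(* Among the neighbours of [y] exactly one is closer than [y] to the end of
   [w]. *)
Lemma sum_neighbors_height (V : zmodType) w y (s : seq X) (g : R -> V) :
  uniq s -> size s = q.+1 -> (forall z, (z \in s) = adj y z) ->
  \sum_(z <- s) g (height R w z) =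
  g (height R w y + 1) + g (height R w y - 1) *+ q.
Proof.
move=> us ss sE; pose m := (dist o y).+1.
have mh z : (z == y) || adj y z -> (dist o z <= m)%N.
  by move=> /orP[/eqP ->|/(dist_adj_le o)//]; exact: leqW.
have ym : y != w m.
  by apply/eqP => e; have := dist_ray w m; rewrite -e; rewrite /m; lia.
have [v [yv vm]] := parent_ex ym.
have vs : v \in s by rewrite sE.
have hv : height R w v = height R w y + 1.
  rewrite !(@heightE _ _ m) ?mh ?eqxx ?yv ?orbT//.
  by rewrite ![dist _ (w m)]dist_sym vm -natr1; ring.
rewrite (bigD1_seq v)//= hv; congr (_ + _).
rewrite -big_filter (eq_big_seq (fun=> g (height R w y - 1))) => [|z].
  rewrite big_const_seq count_predT iter_addr_0 size_filter.
  by have := count_predC (pred1 v) s; rewrite ss count_uniq_mem// vs => -[e]; congr (_ *+ _).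
rewrite mem_filter sE => /andP[zv yz]; congr g.
rewrite !(@heightE _ _ m) ?mh ?eqxx ?yz ?orbT//.
have [zm|zm] := dist_adj_cases (w m) yz.
  by rewrite ![dist _ (w m)]dist_sym zm -natr1; ring.
case/eqP: zv; apply: (@closer_neighbor_unique _ _ (w m) y) => //; lia.
Qed.

Lemma ray_prefix w w' n k : w n = w' n -> (k <= n)%N -> w k = w' k.
Proof.
elim: n => [|n IHn]; first by rewrite leqn0 => e /eqP ->.
move=> e; rewrite leq_eqVlt => /predU1P[->//|]; rewrite ltnS; apply: IHn.
apply: (@closer_neighbor_unique _ _ o (w n.+1)).
- by rewrite adj_sym ray_adj.
- by rewrite e adj_sym ray_adj.
- by rewrite !dist_ray.
- by rewrite !dist_ray.
Qed.

(** Rays through [y] agree up to [y], so a single ray through both vertices forces every ray through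
    [y] to pass through [x]. Together with the empty set, the sets E(x) thus form a pi-system. *)
Lemma passingI x y : (dist o x <= dist o y)%N ->
  @passing _ _ o x `&` passing y = passing y \/
  @passing _ _ o x `&` passing y = set0.
Proof.
move=> xy; have [[w [/ray_passingP wx /ray_passingP wy]]|no] :=
    pselect (exists w : ray o, passing x w /\ passing y w); [left|right].
  apply/seteqP; split => [w' []//|w' /[dup] yw' /ray_passingP w'y]; split => //.
  apply/ray_passingP; rewrite -[RHS]wx; apply: (@ray_prefix _ _ (dist o y)) => //.
  by rewrite w'y wy.
by rewrite -subset0 => w xyw; apply: no; exists w.
Qed.

End rays.

(** * Complex numbers and unordered sums *)

Section complex_parts.
Context (R : realType).
Implicit Types (a b : R[i]) (r : R).

Lemma cReD a b : complex.Re (a + b) = complex.Re a + complex.Re b.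
Proof. by case: a; case: b. Qed.

Lemma cImD a b : complex.Im (a + b) = complex.Im a + complex.Im b.
Proof. by case: a; case: b. Qed.

Lemma cReN a : complex.Re (- a) = - complex.Re a.
Proof. by case: a. Qed.

Lemma cImN a : complex.Im (- a) = - complex.Im a.
Proof. by case: a. Qed.

Lemma cReM a b : complex.Re (a * b) =
  complex.Re a * complex.Re b - complex.Im a * complex.Im b.
Proof. by case: a; case: b. Qed.

Lemma cImM a b : complex.Im (a * b) =
  complex.Re a * complex.Im b + complex.Im a * complex.Re b.
Proof. by case: a; case: b. Qed.

Lemma cRe_conj a : complex.Re a^* = complex.Re a.
Proof. by case: a. Qed.

Lemma cIm_conj a : complex.Im a^* = - complex.Im a.
Proof. by case: a. Qed.

Lemma cRe_sum I (s : seq I) (F : I -> R[i]) :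
  complex.Re (\sum_(i <- s) F i) = \sum_(i <- s) complex.Re (F i).
Proof. exact: (big_morph _ cReD (erefl _)). Qed.

Lemma cIm_sum I (s : seq I) (F : I -> R[i]) :
  complex.Im (\sum_(i <- s) F i) = \sum_(i <- s) complex.Im (F i).
Proof. exact: (big_morph _ cImD (erefl _)). Qed.

Lemma conj_sum I (s : seq I) (F : I -> R[i]) :
  (\sum_(i <- s) F i)^* = \sum_(i <- s) (F i)^*.
Proof. exact: rmorph_sum. Qed.

Lemma conjM a b : (a * b)^* = a^* * b^*.
Proof. exact: rmorphM. Qed.

Lemma conjD a b : (a + b)^* = a^* + b^*.
Proof. exact: rmorphD. Qed.

Lemma complex_ext a b : complex.Re a = complex.Re b ->
  complex.Im a = complex.Im b -> a = b.
Proof. by case: a b => ? ? [? ?] /= -> ->. Qed.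

Lemma normc_ge0 a : 0 <= normc a.
Proof. by case: a => *; exact: sqrtr_ge0. Qed.

Lemma normcsqE a : normc a ^+ 2 = complex.Re a ^+ 2 + complex.Im a ^+ 2.
Proof. by case: a => x y /=; rewrite sqr_sqrtr ?addr_ge0 ?sqr_ge0. Qed.

Lemma normc_conj a : normc a^* = normc a.
Proof. by case: a => x y /=; rewrite sqrrN. Qed.

Lemma mulc_conj a : a * a^* = (normc a ^+ 2)%:C.
Proof. by rewrite normcsqE; case: a => x y; apply: complex_ext => /=; ring. Qed.

Lemma normcR r : normc r%:C = `|r|.
Proof. by rewrite /= expr0n addr0 sqrtr_sqr. Qed.

Lemma le_Re_normc a : `|complex.Re a| <= normc a.
Proof.
rewrite -ler_sqr ?nnegrE ?normc_ge0// real_normK ?num_real// normcsqE.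
by rewrite lerDl sqr_ge0.
Qed.

Lemma le_Im_normc a : `|complex.Im a| <= normc a.
Proof.
rewrite -ler_sqr ?nnegrE ?normc_ge0// real_normK ?num_real// normcsqE.
by rewrite lerDr sqr_ge0.
Qed.

Lemma normc_le_ReIm a : normc a <= `|complex.Re a| + `|complex.Im a|.
Proof.
rewrite -ler_sqr ?nnegrE ?normc_ge0 ?addr_ge0// normcsqE sqrrD.
by rewrite !real_normK ?num_real// addrAC lerDl mulrn_wge0// mulr_ge0.
Qed.

Lemma le_normcM_young a b : normc (a * b) *+ 2 <= normc a ^+ 2 + normc b ^+ 2.
Proof.
have := sqr_ge0 (normc a - normc b).
by rewrite normcM sqrrB addrAC subr_ge0.
Qed.

Lemma cvg_complexP T (F : set_system T) {FF : Filter F} (u : T -> R[i]) (l : R[i]) :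
  u x @[x --> F] --> l <->
  complex.Re (u x) @[x --> F] --> complex.Re l /\
  complex.Im (u x) @[x --> F] --> complex.Im l.
Proof.
split=> [ul|[ur ui]].
  have near_l (e : R) : 0 < e -> \forall x \near F, normc (l - u x) < e.
    move=> e0; have eC : 0 < e%:C :> R[i] by rewrite ltcR.
    by move/cvgrPdist_lt : ul => /(_ _ eC); apply: filterS => x; rewrite ltcR.
  split; apply/cvgrPdist_lt => e /near_l; apply: filterS => x; apply: le_lt_trans.
    by rewrite -cReN -cReD le_Re_normc.
  by rewrite -cImN -cImD le_Im_normc.
apply/cvgrPdist_lt => /= -[e e'] /=; rewrite ltcE /= => /andP[/eqP -> e0].
have e2 : 0 < e / 2 by rewrite divr_gt0.
move/cvgrPdist_lt : ur => /(_ _ e2) ur; move/cvgrPdist_lt : ui => /(_ _ e2) ui.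
apply: (filterS2 _ _ ur ui) => x; rewrite -cReN -cReD -cImN -cImD => hr hi.
rewrite (_ : e +i* 0 = e%:C)// ltcR; apply: le_lt_trans (normc_le_ReIm _) _.
by rewrite (splitr e) ltrD.
Qed.

End complex_parts.

Lemma big_uniq_sub (R : numDomainType) (I : eqType) (s t : seq I) (f : I -> R) :
  uniq s -> uniq t -> {subset s <= t} -> (forall x, 0 <= f x) ->
  \sum_(x <- s) f x <= \sum_(x <- t) f x.
Proof.
move=> us ut st f0; rewrite [leRHS](bigID (mem s))/= -[leLHS]addr0.
apply: lerD; last exact: sumr_ge0.
rewrite -[X in _ <= X]big_filter (perm_big [seq x <- t | x \in s])//.
apply: uniq_perm; rewrite ?filter_uniq// => x.
by rewrite mem_filter; case: (boolP (x \in s)) => //= /st ->.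
Qed.

Section unordered_sums.
Context (R : realType) (I : choiceType).
Implicit Types (u : I -> R[i]) (v : R[i]) (r : I -> R) (C : R) (s : seq I).

Lemma partial_sumE (V : zmodType) (f : I -> V) (A : {fset I}) :
  summability.partial_sum f A = \sum_(x <- A) f x.
Proof. by rewrite big_seq_fsetE. Qed.

Lemma near_totally (A : {fset I}) :
  \forall B \near @summability.totally I, {subset A <= B}.
Proof. by exists A => //= B /fsubsetP AB x /AB. Qed.

Lemma cvg_totally_ge0 r C : (forall x, 0 <= r x) ->
  (forall s, uniq s -> \sum_(x <- s) r x <= C) ->
  cvg (summability.partial_sum r A @[A --> summability.totally]).
Proof.
move=> r0 rC; pose S := [set summability.partial_sum r A | A in [set: {fset I}]].
have supS : has_sup S.
  split; first by exists (summability.partial_sum r fset0), fset0.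
  by exists C => _ [A _ <-]; rewrite partial_sumE rC// fset_uniq.
apply/cvg_ex; exists (sup S); apply/cvgrPdist_lt => e e0.
have [_ [A _ <-] Ae] := sup_adherent e0 supS.
apply: filterS (near_totally A) => B AB.
have SB : summability.partial_sum r B <= sup S.
  by apply: ub_le_sup => //; [case: supS|exists B].
rewrite ger0_norm ?subr_ge0// ltrBlDr -ltrBlDl (lt_le_trans Ae)//.
by rewrite !partial_sumE; apply: big_uniq_sub => //; exact: fset_uniq.
Qed.

Lemma cvg_totally_real r C :
  (forall s, uniq s -> \sum_(x <- s) `|r x| <= C) ->
  cvg (summability.partial_sum r A @[A --> summability.totally]).
Proof.
move=> rC.
have -> : summability.partial_sum r = (fun A =>
    summability.partial_sum (fun x => Num.max (r x) 0) A -
    summability.partial_sum (fun x => Num.max (- r x) 0) A).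
  apply/funext => A; rewrite !partial_sumE -sumrB; apply: eq_bigr => x _.
  by case: (ltP (r x) 0) => h; case: (ltP (- r x) 0) => h'; lra.
apply: is_cvgB; apply: (@cvg_totally_ge0 _ C) => [x|s us];
  rewrite ?le_max ?lexx ?orbT//; apply: le_trans (rC _ us); apply: ler_sum => x _;
  rewrite ge_max normr_ge0 andbT ?ler_norm//.
by rewrite -normrN ler_norm.
Qed.

Lemma has_sumP u v : has_sum u v <->
  summability.partial_sum (fun x => complex.Re (u x)) A
    @[A --> summability.totally] --> complex.Re v /\
  summability.partial_sum (fun x => complex.Im (u x)) A
    @[A --> summability.totally] --> complex.Im v.
Proof.
rewrite /has_sum cvg_complexP.
have -> : (fun A => complex.Re (summability.partial_sum u A)) =
    summability.partial_sum (fun x => complex.Re (u x)).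
  by apply/funext => A; rewrite !partial_sumE cRe_sum.
have -> // : (fun A => complex.Im (summability.partial_sum u A)) =
    summability.partial_sum (fun x => complex.Im (u x)).
by apply/funext => A; rewrite !partial_sumE cIm_sum.
Qed.

Lemma ex_has_sum u C : (forall s, uniq s -> \sum_(x <- s) normc (u x) <= C) ->
  exists v, has_sum u v.
Proof.
move=> uC; have cr := @cvg_totally_real (fun x => complex.Re (u x)) C.
have ci := @cvg_totally_real (fun x => complex.Im (u x)) C.
have /cvg_ex[/= a ra] : cvg (summability.partial_sum
    (fun x => complex.Re (u x)) A @[A --> summability.totally]).
  apply: cr => s us; apply: le_trans (uC _ us).
  by apply: ler_sum => x _; exact: le_Re_normc.
have /cvg_ex[/= b ib] : cvg (summability.partial_sum
    (fun x => complex.Im (u x)) A @[A --> summability.totally]).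
  apply: ci => s us; apply: le_trans (uC _ us).
  by apply: ler_sum => x _; exact: le_Im_normc.
by exists (a +i* b); apply/has_sumP.
Qed.

Lemma has_sum_unique u (a b : R[i]) : has_sum u a -> has_sum u b -> a = b.
Proof. exact: cvg_unique. Qed.

Lemma has_sumZ u (a c : R[i]) : has_sum u a -> has_sum (fun x => c * u x) (c * a).
Proof.
move=> ua; rewrite /has_sum.
have -> : summability.partial_sum (fun x => c * u x) =
    (fun A => c * summability.partial_sum u A).
  by apply/funext => A; rewrite !partial_sumE mulr_sumr.
exact: cvgMr.
Qed.

Lemma has_sum_conj u (a : R[i]) : has_sum u a -> has_sum (fun x => (u x)^*) a^*.
Proof.
move=> /has_sumP[ur ui]; apply/has_sumP; split.
  rewrite cRe_conj (_ : (fun x => complex.Re (u x)^*) =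
    fun x => complex.Re (u x))//; apply/funext => x; exact: cRe_conj.
rewrite cIm_conj.
have -> : summability.partial_sum (fun x => complex.Im (u x)^*) =
    (fun A => - summability.partial_sum (fun x => complex.Im (u x)) A).
  apply/funext => A; rewrite !partial_sumE -sumrN.
  by apply: eq_bigr => x _; rewrite cIm_conj.
exact: cvgN.
Qed.

Lemma has_sum_finite u s : uniq s -> (forall x, x \notin s -> u x = 0) ->
  has_sum u (\sum_(x <- s) u x).
Proof.
move=> us u0; apply: cvg_near_cst.
apply: filterS (near_totally [fset x | x in s]%fset) => A sA.
rewrite partial_sumE (bigID (mem s))/= [X in _ + X]big1 ?addr0; last first.
  by move=> x /u0.
rewrite -[LHS]big_filter; apply: perm_big; apply: uniq_perm => //.
  by rewrite filter_uniq// fset_uniq.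
move=> x; rewrite mem_filter andb_idr// => xs.
by apply: sA; rewrite !inE.
Qed.

Lemma has_sum_series (e : nat -> I) u v : bijective e -> has_sum u v ->
  \sum_(0 <= k < n) u (e k) @[n --> \oo] --> v.
Proof.
move=> [e' eK e'K] uv; pose A n : {fset I} := [fset x | x in [seq e k | k <- iota 0 n]]%fset.
have AE n : summability.partial_sum u (A n) = \sum_(0 <= k < n) u (e k).
  rewrite partial_sumE /index_iota subn0 -(big_map e predT).
  apply: perm_big; apply: uniq_perm; first exact: fset_uniq.
    by rewrite map_inj_uniq ?iota_uniq//; exact: can_inj eK.
  by move=> x; rewrite !inE.
rewrite -(_ : (fun n => summability.partial_sum u (A n)) =
    (fun n => \sum_(0 <= k < n) u (e k))); last exact/funext.
apply: (@cvg_comp _ _ _ A (summability.partial_sum u)) uv.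
(* This index exceeds [e' x] for every [x] in [B], so from there on the enumerated terms contain
   [B]. *)
move=> P [B _ BP]; exists (\sum_(x <- B) (e' x).+1)%N => // n /= nB.
apply: BP => /=; apply/fsubsetP => x xB; rewrite !inE.
apply/mapP; exists (e' x) => //; rewrite mem_iota /= add0n.
by apply: leq_trans nB; rewrite (big_fsetD1 x)//= leq_addr.
Qed.

Lemma le_sum_enum (e : nat -> I) (f : I -> R) C : bijective e ->
  (forall x, 0 <= f x) -> (forall n, \sum_(0 <= k < n) f (e k) <= C) ->
  forall s, uniq s -> \sum_(x <- s) f x <= C.
Proof.
move=> [e' eK e'K] f0 fC s us; apply: le_trans (fC (\sum_(x <- s) (e' x).+1)%N).
rewrite /index_iota subn0 -(big_map e predT).
apply: big_uniq_sub => //.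
  by rewrite map_inj_uniq ?iota_uniq//; exact: can_inj eK.
move=> x xs; apply/mapP; exists (e' x) => //; rewrite mem_iota /= add0n.
by rewrite (big_rem x)//= leq_addr.
Qed.

End unordered_sums.

(** * Operators on square summable functions *)

Section l2_facts.
Context (R : realType) (I : choiceType).
Implicit Types (f g : l2 R I) (s : seq I) (C : R).

Lemma le_sqsum (f : I -> R[i]) s : uniq s ->
  ((\sum_(x <- s) normc (f x) ^+ 2)%:E <= sqsum f)%E.
Proof.
move=> us; rewrite -sumEFin; apply: esum_ge; exists [set` s].
  by split=> //; exact: finite_seq.
by rewrite fsbig_seq.
Qed.

Lemma sqsum_le (f : I -> R[i]) C :
  (forall s, uniq s -> \sum_(x <- s) normc (f x) ^+ 2 <= C) ->
  (sqsum f <= C%:E)%E.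
Proof.
move=> fC; apply: ge_ereal_sup => _ [A [finA _] <-].
by rewrite fsbig_finite//= sumEFin lee_fin fC// fset_uniq.
Qed.

Lemma l2_sqnormE f : (l2_norm f ^+ 2)%:E = sqsum f.
Proof.
have /asboolP ff := l2P f.
rewrite /l2_norm sqr_sqrtr ?fine_ge0 ?sqsum_ge0// fineK//.
by rewrite ge0_fin_numE// sqsum_ge0.
Qed.

Lemma l2_norm_ge0 f : 0 <= l2_norm f.
Proof. exact: sqrtr_ge0. Qed.

Lemma l2_normE f : `|f| = (l2_norm f)%:C.
Proof. by []. Qed.

Lemma le_l2_sqnorm f s : uniq s ->
  \sum_(x <- s) normc (f x) ^+ 2 <= l2_norm f ^+ 2.
Proof. by move=> us; rewrite -lee_fin l2_sqnormE le_sqsum. Qed.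

Lemma l2_sqnorm_le f C :
  (forall s, uniq s -> \sum_(x <- s) normc (f x) ^+ 2 <= C) ->
  l2_norm f ^+ 2 <= C.
Proof. by move=> fC; rewrite -lee_fin l2_sqnormE sqsum_le. Qed.

Lemma l2_sqnorm_fin f s : uniq s -> (forall x, x \notin s -> f x = 0) ->
  l2_norm f ^+ 2 = \sum_(x <- s) normc (f x) ^+ 2.
Proof.
move=> us f0; apply/eqP; rewrite eq_le le_l2_sqnorm// andbT.
apply: l2_sqnorm_le => t ut; rewrite (bigID (mem s))/= [X in _ + X]big1 ?addr0.
  rewrite -big_filter; apply: big_uniq_sub => // [|x|x]; rewrite ?filter_uniq//.
    by rewrite mem_filter => /andP[].
  exact: sqr_ge0.
by move=> x /f0 ->; rewrite normc0 expr0n.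
Qed.

Lemma fin_supp_l2 (f : I -> R[i]) s : uniq s ->
  (forall x, x \notin s -> f x = 0) -> f \in @l2_pred R I.
Proof.
move=> us f0; apply/asboolP; apply: le_lt_trans (ltry (\sum_(x <- s) normc (f x) ^+ 2)).
apply: sqsum_le => t ut; rewrite (bigID (mem s))/= [X in _ + X]big1 ?addr0.
  rewrite -big_filter; apply: big_uniq_sub => // [|x|x]; rewrite ?filter_uniq//.
    by rewrite mem_filter => /andP[].
  exact: sqr_ge0.
by move=> x /f0 ->; rewrite normc0 expr0n.
Qed.

Definition delta (b : I) : l2 R I.
Proof.
by apply: (@L2 R I (fun x => (x == b)%:R)); apply: (@fin_supp_l2 _ [:: b]) => // x;
  rewrite inE => /negbTE ->.
Defined.

Lemma deltaE b x : delta b x = (x == b)%:R.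
Proof. by []. Qed.

Lemma l2Z (a : R[i]) f x : (a *: f) x = a * f x.
Proof. by []. Qed.

Lemma l2_sum J (t : seq J) (F : J -> l2 R I) x :
  (\sum_(j <- t) F j) x = \sum_(j <- t) F j x.
Proof. exact: (big_morph (fun f : l2 R I => f x) (fun _ _ => erefl) erefl). Qed.

Lemma has_sum_l2_inner f g :
  has_sum (fun x => f x * (g x)^*) (l2_inner f g).
Proof.
have [v fgv] : exists v, has_sum (fun x => f x * (g x)^*) v.
  apply: (@ex_has_sum _ _ _ (l2_norm f ^+ 2 + l2_norm g ^+ 2)) => s us.
  apply: le_trans (lerD (le_l2_sqnorm f us) (le_l2_sqnorm g us)).
  rewrite -big_split; apply: ler_sum => x _.
  have := le_normcM_young (f x) (g x)^*; rewrite normc_conj.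
  apply: le_trans; rewrite mulr2n lerDl; exact: normc_ge0.
by rewrite /l2_inner; move/cvg_lim : (fgv) => ->.
Qed.

Lemma l2_inner_conj f g : l2_inner g f = (l2_inner f g)^*.
Proof.
apply: (has_sum_unique (@has_sum_l2_inner g f)).
have := has_sum_conj (@has_sum_l2_inner f g).
rewrite (_ : (fun x => (f x * (g x)^*)^*) = fun x => g x * (f x)^*)//.
by apply/funext => x; rewrite conjM conjCK mulrC.
Qed.

Lemma l2_inner_delta f b : l2_inner f (delta b) = f b.
Proof.
apply: (has_sum_unique (@has_sum_l2_inner f (delta b))).
have -> : f b = \sum_(x <- [:: b]) f x * (delta b x)^*.
  by rewrite big_seq1 deltaE eqxx conjC1 mulr1.
apply: has_sum_finite => // x; rewrite inE deltaE => /negbTE ->.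
by rewrite conjC0 mulr0.
Qed.

Lemma l2_inner_deltal f b : l2_inner (delta b) f = (f b)^*.
Proof. by rewrite l2_inner_conj l2_inner_delta. Qed.

Lemma l2_norm_combination s (c : I -> R[i]) : uniq s ->
  l2_norm (\sum_(y <- s) c y *: delta y) ^+ 2 = \sum_(y <- s) normc (c y) ^+ 2.
Proof.
move=> us.
have fE x : (\sum_(y <- s) c y *: delta y) x = if x \in s then c x else 0.
  rewrite l2_sum; under eq_bigr do rewrite l2Z deltaE.
  case: ifPn => xs.
    rewrite (bigD1_seq x)//= eqxx mulr1 big1 ?addr0// => y yx.
    by rewrite eq_sym (negbTE yx) mulr0.
  rewrite big_seq big1// => y ys; case: eqVneq => [xy|]; last by rewrite mulr0.
  by rewrite xy ys in xs.
rewrite (@l2_sqnorm_fin _ s)// => [|x /negbTE xs]; last by rewrite fE xs.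
by apply: eq_big_seq => x xs; rewrite fE xs.
Qed.

Lemma adjoint_sym (T Tstar : {linear l2 R I -> l2 R I}) :
  is_adjoint T Tstar -> is_adjoint Tstar T.
Proof. by move=> adjT f g; rewrite l2_inner_conj -adjT -l2_inner_conj. Qed.

(** The Gram entries are the matrix entries of the two products on delta functions. To pass from
    delta functions to any [f], the value at [b] is written as an inner product with [delta b] and
    both operators are moved onto [delta b]; no approximation of [f] is involved. *)
Lemma normal_iff_gram (T Tstar : {linear l2 R I -> l2 R I}) :
  is_adjoint T Tstar ->
  (forall f, T (Tstar f) = Tstar (T f)) <->
  (forall y b, l2_inner (T (delta y)) (T (delta b)) =
               l2_inner (Tstar (delta y)) (Tstar (delta b))).
Proof.
move=> adjT; have adjTs := adjoint_sym adjT.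
split=> [nT y b|gram f]; first by rewrite adjT adjTs nT.
have TT b : T (Tstar (delta b)) = Tstar (T (delta b)).
  apply/val_inj/funext => y /=; have := gram y b.
  rewrite adjT adjTs !l2_inner_deltal => /(congr1 Num.conj).
  by rewrite !conjCK.
apply/val_inj/funext => b /=.
by rewrite -!l2_inner_delta [LHS]adjT [LHS]adjTs TT [RHS]adjTs [RHS]adjT.
Qed.

Lemma adjoint_entry (T Tstar : {linear l2 R I -> l2 R I}) x y :
  is_adjoint T Tstar -> Tstar (delta x) y = (T (delta y) x)^*.
Proof.
move=> adjT; rewrite -[LHS]l2_inner_delta (adjoint_sym adjT).
by rewrite l2_inner_deltal.
Qed.

End l2_facts.

(** * Nuclear operators are Hilbert-Schmidt *)

Section hilbert_schmidt.
Context (R : realType) (I : choiceType).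
Implicit Types (s : seq I) (C : R).

(** Cauchy-Schwarz without square roots. In the induction the cross term is bounded by the
    inequality between the arithmetic and the geometric mean of [B * c n] and [b n * C]. *)
Lemma sqr_sum_le (n : nat) (a b c : nat -> R) :
  (forall k, 0 <= a k) -> (forall k, 0 <= b k) -> (forall k, 0 <= c k) ->
  (forall k, a k ^+ 2 <= b k * c k) ->
  (\sum_(0 <= k < n) a k) ^+ 2 <=
  (\sum_(0 <= k < n) b k) * (\sum_(0 <= k < n) c k).
Proof.
move=> a0 b0 c0 abc; elim: n => [|n IHn]; first by rewrite !big_geq// mul0r expr0n.
rewrite !big_nat_recr//=; move: IHn.
have A0 : 0 <= \sum_(0 <= k < n) a k by exact: sumr_ge0.
have B0 : 0 <= \sum_(0 <= k < n) b k by exact: sumr_ge0.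
have C0 : 0 <= \sum_(0 <= k < n) c k by exact: sumr_ge0.
move: (\sum_(0 <= k < n) a k) (\sum_(0 <= k < n) b k) (\sum_(0 <= k < n) c k)
  A0 B0 C0 => A B C A0 B0 C0 IHn.
have cross : 2 * (A * a n) <= B * c n + b n * C.
  rewrite -ler_sqr ?nnegrE; last 2 first.
    by rewrite mulr_ge0// mulr_ge0.
    by rewrite addr_ge0// mulr_ge0.
  have : (A * a n) ^+ 2 <= (B * C) * (b n * c n).
    by rewrite exprMn ler_pM ?sqr_ge0.
  have := sqr_ge0 (B * c n - b n * C).
  nra.
have := abc n; nra.
Qed.

Lemma has_sup_dual_norm (phi : {linear l2 R I -> R[i]}) : continuous phi ->
  has_sup [set normc (phi u) | u in [set u : l2 R I | `|u| <= 1]].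
Proof.
move=> cphi; have [k k0 phik] := linear_lipschitz cphi.
split; first by exists (normc (phi 0)), 0 => //=; rewrite normr0.
exists (complex.Re k) => _ [u /= u1 <-].
rewrite -lecR; apply: (le_trans (phik u)).
have kE : k = (complex.Re k)%:C by rewrite RRe_real// gtr0_real.
rewrite l2_normE lecR in u1.
rewrite kE l2_normE -rmorphM lecR ler_piMr//.
by rewrite -lecR -kE ltW.
Qed.

Lemma dual_norm_ge0 (phi : {linear l2 R I -> R[i]}) : continuous phi ->
  0 <= dual_norm phi.
Proof.
move=> /has_sup_dual_norm hs; apply: le_trans (normc_ge0 (phi 0)) _.
by apply: ub_le_sup; [case: hs|exists 0 => //=; rewrite normr0].
Qed.

Lemma dual_norm_ge (phi : {linear l2 R I -> R[i]}) (v : l2 R I) :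
  continuous phi -> normc (phi v) <= dual_norm phi * l2_norm v.
Proof.
move=> cphi; have [->|v0] := eqVneq v 0.
  by rewrite linear0 normc0 mulr_ge0 ?l2_norm_ge0// dual_norm_ge0.
have nv0 : 0 < l2_norm v by rewrite -ltcR -l2_normE normr_gt0.
have : normc (phi ((l2_norm v)^-1%:C *: v)) <= dual_norm phi.
  apply: ub_le_sup; first by case: (has_sup_dual_norm cphi).
  exists ((l2_norm v)^-1%:C *: v) => //=.
  rewrite normrZ l2_normE; have -> : `|(l2_norm v)^-1%:C| = (l2_norm v)^-1%:C :> R[i].
    by rewrite ger0_norm// lecR invr_ge0 ltW.
  by rewrite -rmorphM mulVf ?gt_eqF.
rewrite linearZ normcM normcR ger0_norm ?invr_ge0 ?l2_norm_ge0//.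
by rewrite mulrC ler_pdivrMr.
Qed.

(** Testing [phi] on the combination of the [delta R y] with coefficients the conjugates of its own
    values gives [S] on one side and [dual_norm phi] times the square root of [S] on the other. *)
Lemma bessel_dual_norm (phi : {linear l2 R I -> R[i]}) s : continuous phi ->
  uniq s -> \sum_(y <- s) normc (phi (delta R y)) ^+ 2 <= dual_norm phi ^+ 2.
Proof.
move=> cphi us; set S := \sum_(y <- s) _.
pose v : l2 R I := \sum_(y <- s) (phi (delta R y))^* *: delta R y.
have vS : l2_norm v ^+ 2 = S.
  by rewrite l2_norm_combination//; apply: eq_bigr => y _; rewrite normc_conj.
have S0 : 0 <= S by apply: sumr_ge0 => y _; exact: sqr_ge0.
have phiv : phi v = S%:C.
  rewrite linear_sum rmorph_sum; apply: eq_bigr => y _.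
  by rewrite linearZ /= -mulc_conj mulrC.
have := dual_norm_ge v cphi; rewrite phiv normcR ger0_norm// => h.
have [->|Sn0] := eqVneq S 0; first exact: sqr_ge0.
have Sp : 0 < S by rewrite lt_neqAle eq_sym Sn0.
have : S ^+ 2 <= dual_norm phi ^+ 2 * S.
  rewrite -vS -exprMn ler_sqr ?nnegrE ?sqr_ge0//; last first.
    by rewrite mulr_ge0 ?dual_norm_ge0 ?l2_norm_ge0.
  by rewrite vS.
by rewrite expr2 ler_pM2r.
Qed.

Lemma nuclear_hilbert_schmidt (T : {linear l2 R I -> l2 R I}) : nuclear T ->
  exists C, forall s, uniq s -> \sum_(y <- s) l2_norm (T (delta R y)) ^+ 2 <= C.
Proof.
move=> [_ [phi [w [cphi dw Tsum]]]].
pose d k := dual_norm (phi k) * l2_norm (w k).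
have d0 k : 0 <= d k by rewrite mulr_ge0 ?l2_norm_ge0// dual_norm_ge0.
pose C := fine (\sum_(0 <= k <oo) (d k)%:E)%E.
have q0 k : 0 <= dual_norm (phi k) := dual_norm_ge0 (cphi k).
have dC n : \sum_(0 <= k < n) d k <= C.
  rewrite -lee_fin -sumEFin fineK; last first.
    by rewrite ge0_fin_numE//; apply: nneseries_ge0 => k _ _; rewrite lee_fin.
  by apply: nneseries_lim_ge => k _ _; rewrite lee_fin.
have C0 : 0 <= C by apply: le_trans (dC 0%N); rewrite big_geq.
exists (C * C) => s us.
have part n : \sum_(y <- s)
    l2_norm (\sum_(0 <= k < n) phi k (delta R y) *: w k) ^+ 2 <= C * C.
  (* The square of the k-th term is [b y k * d k]. The weight is chosen so that, by
     [bessel_dual_norm], the sum of [b y k] over [y] is at most [d k], which yields the bound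
     [C * C]. If [dual_norm (phi k)] is zero, so is the term, and [b y k] is zero by the value of
     the inverse. *)
  pose b y k := normc (phi k (delta R y)) ^+ 2 * l2_norm (w k) / dual_norm (phi k).
  apply: (@le_trans _ _ (\sum_(y <- s) C * \sum_(0 <= k < n) b y k)).
    apply: ler_sum => y _.
    have b0 k : 0 <= b y k.
      rewrite /b; apply: divr_ge0; last exact: q0. apply: mulr_ge0; [exact: sqr_ge0|exact: l2_norm_ge0].
    apply: (@le_trans _ _
        ((\sum_(0 <= k < n) normc (phi k (delta R y)) * l2_norm (w k)) ^+ 2)).
      rewrite ler_sqr ?nnegrE ?l2_norm_ge0//; last first.
        by apply: sumr_ge0 => k _; rewrite mulr_ge0 ?normc_ge0 ?l2_norm_ge0.
      rewrite -lecR -l2_normE rmorph_sum/=; apply: le_trans (ler_norm_sum _ _ _) _.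
      by apply: ler_sum => k _; rewrite normrZ l2_normE rmorphM.
    apply: le_trans (sqr_sum_le n _ b0 d0 _) _ => [k|k|].
    - by rewrite mulr_ge0 ?normc_ge0 ?l2_norm_ge0.
    - have [p0|p0] := eqVneq (dual_norm (phi k)) 0.
        have := dual_norm_ge (delta R y) (cphi k).
        rewrite p0 mul0r => le0; rewrite (_ : normc _ = 0); last first.
          by apply/eqP; rewrite eq_le le0 normc_ge0.
        by rewrite mul0r expr0n mulr_ge0.
      rewrite /b /d le_eqVlt; apply/orP; left; apply/eqP; field.
      exact: p0.
    - by rewrite mulrC ler_wpM2r ?sumr_ge0.
  rewrite -mulr_sumr ler_wpM2l// exchange_big/=; apply: le_trans (dC n).
  apply: ler_sum => k _; rewrite /b /d -!mulr_suml.
  have [->|p0] := eqVneq (dual_norm (phi k)) 0; first by rewrite invr0 mulr0 mul0r.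
  rewrite ler_pdivrMr; last by rewrite lt_neqAle eq_sym p0 q0.
  rewrite mulrAC ler_wpM2r ?l2_norm_ge0// -expr2; exact: bessel_dual_norm.
have cvgy y : l2_norm (\sum_(0 <= k < n) phi k (delta R y) *: w k) @[n --> \oo] -->
    l2_norm (T (delta R y)).
  by move: (Tsum (delta R y)) => /cvg_norm /cvg_complexP [].
have cvgs : \sum_(y <- s)
    l2_norm (\sum_(0 <= k < n) phi k (delta R y) *: w k) ^+ 2 @[n --> \oo] -->
    \sum_(y <- s) l2_norm (T (delta R y)) ^+ 2.
  elim: (s) => [|y t IHt].
    by under eq_fun do rewrite big_nil; rewrite big_nil; exact: cvg_cst.
  under eq_fun do rewrite big_cons; rewrite big_cons.
  by apply: cvgD IHt; under eq_fun do rewrite expr2; rewrite expr2; exact: cvgM.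
apply: cvgr_to_le cvgs _; exact: nearW.
Qed.

End hilbert_schmidt.

(** * Complex integrals *)

Section functional_monotone_class.
Context d (T : measurableType d) (R : realType).
Variables (G : set (set T)) (H : set (T -> R)).
Hypothesis GI : setI_closed G.
Hypothesis GE : d.-measurable = <<s G >>.
Hypothesis H1 : H (cst 1).
Hypothesis HG : forall A, G A -> H \1_A.
Hypothesis HD : forall f g, H f -> H g -> H (fun t => f t + g t).
Hypothesis HZ : forall a f, H f -> H (fun t => a * f t).
Hypothesis Hlim : forall (u : nat -> T -> R) (f : T -> R) (M : R), (forall n, H (u n)) ->
  (forall n t, `|u n t| <= M) -> (forall t, u n t @[n --> \oo] --> f t) -> H f.

Let H0 : H (fun=> 0).
Proof.
have := HZ 0 H1; congr H; apply/funext => t; exact: mul0r.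
Qed.

Let Hindic A : measurable A -> H \1_A.
Proof.
rewrite GE; suff lH : lambda_system setT [set A : set T | H \1_A].
  by move=> /(lambda_system_subset GI lH HG); exact.
split => //=.
- by rewrite indicT.
- move=> E F FE HE HF /=; rewrite (_ : \1_(E `\` F) = fun t => \1_E t + (- 1) * \1_F t).
    by apply: HD => //; exact: HZ.
  apply/funext => t; rewrite !indicE in_setD mulN1r.
  case: (boolP (t \in F)) => [/set_mem /FE /mem_set ->|_] /=; first by rewrite subrr.
  by rewrite andbT subr0.
- move=> F ndF HF /=; apply: (@Hlim (fun n => \1_(F n)) _ 1) => // [n t|t].
    by rewrite ger0_norm ?indicE// lern1 leq_b1.
  have [Ft|nFt] := pselect ((\bigcup_k F k) t).
    case: Ft => n _ Fnt.
    apply: cvg_near_cst; exists n => // m /= nm.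
    have Fmt : F m t by have /subsetPset := ndF _ _ nm; exact.
    by rewrite !indicE (mem_set Fmt) mem_set//; exists n.
  apply: cvg_near_cst; apply: nearW => m; rewrite !indicE !memNset//.
  by move=> Ft; apply: nFt; exists m.
Qed.

Let Hsum (I : Type) (s : seq I) (F : I -> T -> R) : (forall i, H (F i)) ->
  H (fun t => \sum_(i <- s) F i t).
Proof.
move=> HF; elim: s => [|i s IHs].
  by under eq_fun do rewrite big_nil; exact: H0.
by under eq_fun do rewrite big_cons; exact: HD.
Qed.

Import HBSimple.
Import HBNNSimple.

Let Hge0 (f : T -> R) M : measurable_fun setT f -> (forall t, 0 <= f t) ->
  (forall t, f t <= M) -> H f.
Proof.
move=> mf f0 fM.
pose fE : T -> \bar R := EFin \o f.
have mfE : measurable_fun setT fE by exact/measurable_EFinP.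
pose u := nnsfun_approx measurableT mfE.
apply: (@Hlim (fun n => u n : T -> R) f M) => [n|n t|t].
- have -> : (u n : T -> R) = (fun t => \sum_(y <- fset_set (range (u n)))
      y * \1_(u n @^-1` [set y]) t).
    by apply/funext => t; rewrite fimfunE fsbig_finite.
  apply: (@Hsum _ _ (fun y t => y * \1_(u n @^-1` [set y]) t)) => y.
  by apply/HZ/Hindic; exact: measurable_sfunP.
- rewrite ger0_norm//; apply: le_trans (fM t).
  rewrite -lee_fin /u nnsfun_approxE.
  by apply: (@le_approx _ _ _ _ fE) => // x _; rewrite lee_fin.
- have := @cvg_nnsfun_approx _ _ _ _ measurableT _ mfE (fun x _ => f0 x) t I.
  by move=> /fine_cvg; exact.
Qed.

(** The functional form of the pi-lambda theorem. Adding the constant [M] reduces to nonnegative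
    [f], for which simple functions approximate from below and are bounded by the same constant as
    [f]. *)
Lemma functional_monotone_class (f : T -> R) M : measurable_fun setT f ->
  (forall t, `|f t| <= M) -> H f.
Proof.
move=> mf fM; have -> : f = (fun t => (f t + M) + (- M) * cst 1 t).
  by apply/funext => t /=; rewrite mulr1 addrK.
apply: HD; last exact: HZ.
apply: (@Hge0 _ (M *+ 2)) => [|t|t].
- exact: measurable_funD.
- by have := fM t; rewrite ler_norml => /andP[]; lra.
- by have := fM t; rewrite ler_norml => /andP[]; lra.
Qed.

End functional_monotone_class.

Section complex_integral.
Context d (T : measurableType d) (R : realType).
Variables (mu : {measure set T -> \bar R}) (D : set T).
Hypothesis mD : measurable D.
Implicit Types (f g : T -> R) (F G : T -> R[i]).

Definition cmeasurable F := measurable_fun D (fun t => complex.Re (F t)) /\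
  measurable_fun D (fun t => complex.Im (F t)).

Definition cintegrable F :=
  mu.-integrable D (fun t => (complex.Re (F t))%:E) /\
  mu.-integrable D (fun t => (complex.Im (F t))%:E).

Definition cintegral F : R[i] :=
  (\int[mu]_(t in D) complex.Re (F t)) +i* (\int[mu]_(t in D) complex.Im (F t)).

Definition cbounded F (M : R) := forall t, D t -> normc (F t) <= M.

Lemma real_integrableD f g : mu.-integrable D (EFin \o f) ->
  mu.-integrable D (EFin \o g) -> mu.-integrable D (fun t => (f t + g t)%:E).
Proof. by move=> fi gi; apply: eq_integrable (integrableD mD fi gi). Qed.

Lemma real_integrableN f : mu.-integrable D (EFin \o f) ->
  mu.-integrable D (fun t => (- f t)%:E).
Proof. by move=> fi; apply: eq_integrable (integrableN fi). Qed.

Lemma real_integrableZ (a : R) f : mu.-integrable D (EFin \o f) ->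
  mu.-integrable D (fun t => (a * f t)%:E).
Proof. by move=> fi; apply: eq_integrable (integrableZl mD a fi). Qed.

Lemma real_integrable_le f g : measurable_fun D f ->
  mu.-integrable D (EFin \o g) -> (forall t, D t -> `|f t| <= g t) ->
  mu.-integrable D (EFin \o f).
Proof.
move=> mf gi fg; apply: (le_integrable mD _ _ gi); first exact/measurable_EFinP.
move=> t Dt /=; rewrite lee_fin; apply: le_trans (fg _ Dt) _; exact: ler_norm.
Qed.

Lemma real_integrable_measurable f : mu.-integrable D (EFin \o f) ->
  measurable_fun D f.
Proof. by move=> /integrableP[/measurable_EFinP]. Qed.

Lemma real_integrable_norm f : mu.-integrable D (EFin \o f) ->
  mu.-integrable D (fun t => `|f t|%:E).
Proof. by move=> /integrable_abse. Qed.

Lemma real_integrableM_bounded f g (M : R) : mu.-integrable D (EFin \o f) ->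
  measurable_fun D g -> (forall t, D t -> `|g t| <= M) ->
  mu.-integrable D (fun t => (f t * g t)%:E).
Proof.
move=> fi mg gM; apply: (@real_integrable_le _ (fun t => M * `|f t|)).
- by apply: measurable_funM => //; exact: real_integrable_measurable.
- exact/real_integrableZ/real_integrable_norm.
- by move=> t Dt; rewrite normrM mulrC ler_wpM2r// gM.
Qed.

Lemma cvg_Rintegral (u : nat -> T -> R) f g :
  (forall n, measurable_fun D (u n)) ->
  (forall t, D t -> u n t @[n --> \oo] --> f t) ->
  mu.-integrable D (EFin \o g) ->
  (forall n t, D t -> `|u n t| <= g t) ->
  mu.-integrable D (EFin \o f) /\
  \int[mu]_(t in D) u n t @[n --> \oo] --> \int[mu]_(t in D) f t.
Proof.
move=> mu_ uf gi ug.
have muE n : measurable_fun D (EFin \o u n) by exact/measurable_EFinP.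
have ufE t : D t -> (EFin \o u n) t @[n --> \oo] --> (EFin \o f) t.
  by move=> Dt; apply: cvg_EFin; [exact: nearW|exact: uf].
have mf : measurable_fun D (EFin \o f).
  by apply: (emeasurable_fun_cvg (fun n => EFin \o u n)).
have [fi _ lim] := @dominated_convergence _ _ _ mu D mD (fun n => EFin \o u n)
  (EFin \o f) (EFin \o g) muE mf (aeW _ ufE) gi (aeW _ (fun t n Dt => ug n t Dt)).
split => //; apply: fine_cvg; rewrite fineK//; exact: integrable_fin_num.
Qed.

Lemma cmeasurableD F G : cmeasurable F -> cmeasurable G ->
  cmeasurable (fun t => F t + G t).
Proof.
move=> [Fr Fi] [Gr Gi]; split.
  by under eq_fun do rewrite cReD; exact: measurable_funD.
by under eq_fun do rewrite cImD; exact: measurable_funD.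
Qed.

Lemma cmeasurableM F G : cmeasurable F -> cmeasurable G ->
  cmeasurable (fun t => F t * G t).
Proof.
move=> [Fr Fi] [Gr Gi]; split.
  by under eq_fun do rewrite cReM; apply: measurable_funB; exact: measurable_funM.
by under eq_fun do rewrite cImM; apply: measurable_funD; exact: measurable_funM.
Qed.

Lemma cmeasurable_cst (a : R[i]) : cmeasurable (fun=> a).
Proof. by split; exact: measurable_cst. Qed.

Lemma cmeasurable_real f : measurable_fun D f -> cmeasurable (fun t => (f t)%:C).
Proof. by move=> mf; split => //; exact: measurable_cst. Qed.

Lemma cmeasurable_conj F : cmeasurable F -> cmeasurable (fun t => (F t)^*).
Proof.
move=> [Fr Fi]; split; first by under eq_fun do rewrite cRe_conj.
by under eq_fun do rewrite cIm_conj; exact: measurableT_comp.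
Qed.

Lemma measurable_normcsq F : cmeasurable F ->
  measurable_fun D (fun t => normc (F t) ^+ 2).
Proof.
move=> [Fr Fi]; under eq_fun do rewrite normcsqE.
by apply: measurable_funD; exact: measurable_funX.
Qed.

Lemma cintegrable_measurable F : cintegrable F -> cmeasurable F.
Proof. by move=> [/real_integrable_measurable ? /real_integrable_measurable]. Qed.

Lemma cintegrableD F G : cintegrable F -> cintegrable G ->
  cintegrable (fun t => F t + G t).
Proof.
move=> [Fr Fi] [Gr Gi]; split.
  by under eq_fun do rewrite cReD; exact: real_integrableD.
by under eq_fun do rewrite cImD; exact: real_integrableD.
Qed.

Lemma cintegrableM_bounded F G M : cintegrable F -> cmeasurable G ->
  cbounded G M -> cintegrable (fun t => F t * G t).
Proof.
move=> [Fr Fi] [Gr Gi] GM.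
have GrM t : D t -> `|complex.Re (G t)| <= M.
  by move=> /GM; apply: le_trans; exact: le_Re_normc.
have GiM t : D t -> `|complex.Im (G t)| <= M.
  by move=> /GM; apply: le_trans; exact: le_Im_normc.
split; [under eq_fun do rewrite cReM|under eq_fun do rewrite cImM];
  apply: real_integrableD; try apply: real_integrableN;
  exact: (real_integrableM_bounded _ _ (M := M)).
Qed.

Lemma cintegrableZ (a : R[i]) F : cintegrable F -> cintegrable (fun t => a * F t).
Proof.
move=> Fi; under eq_fun do rewrite mulrC.
apply: (cintegrableM_bounded Fi (M := normc a)) => //; exact: cmeasurable_cst.
Qed.

Lemma cintegrable0 : cintegrable (fun=> 0).
Proof. by split; exact: integrable0. Qed.

Lemma cintegrable_sum I (s : seq I) (F : I -> T -> R[i]) :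
  (forall i, cintegrable (F i)) -> cintegrable (fun t => \sum_(i <- s) F i t).
Proof.
move=> Fi; elim: s => [|i s IHs].
  by under eq_fun do rewrite big_nil; exact: cintegrable0.
by under eq_fun do rewrite big_cons; exact: cintegrableD.
Qed.

Lemma eq_cintegrable F G : (forall t, D t -> F t = G t) ->
  cintegrable F -> cintegrable G.
Proof.
move=> FG [Fr Fi]; split.
  by apply: eq_integrable Fr => // t /set_mem /FG ->.
by apply: eq_integrable Fi => // t /set_mem /FG ->.
Qed.

Lemma eq_cintegral F G : (forall t, D t -> F t = G t) -> cintegral F = cintegral G.
Proof.
by move=> FG; congr Complex; apply: eq_Rintegral => t /set_mem /FG ->.
Qed.

Lemma cintegralD F G : cintegrable F -> cintegrable G ->
  cintegral (fun t => F t + G t) = cintegral F + cintegral G.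
Proof.
move=> [Fr Fi] [Gr Gi]; apply: complex_ext => /=; rewrite -RintegralD//;
  by apply: eq_Rintegral => t _; rewrite ?cReD ?cImD.
Qed.

Lemma cintegralZ (a : R[i]) F : cintegrable F ->
  cintegral (fun t => a * F t) = a * cintegral F.
Proof.
move=> [Fr Fi]; apply: complex_ext; rewrite ?cReM ?cImM /=;
  rewrite -!RintegralZl//.
- rewrite -RintegralB//; try exact: real_integrableZ.
  by apply: eq_Rintegral => t _; rewrite cReM.
- rewrite -RintegralD//; try exact: real_integrableZ.
  by apply: eq_Rintegral => t _; rewrite cImM.
Qed.

Lemma cintegral0 : cintegral (fun=> 0) = 0.
Proof.
apply: complex_ext; rewrite /= Rintegral_cst ?mul0r//.
Qed.

Lemma cintegral_sum I (s : seq I) (F : I -> T -> R[i]) :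
  (forall i, cintegrable (F i)) ->
  cintegral (fun t => \sum_(i <- s) F i t) = \sum_(i <- s) cintegral (F i).
Proof.
move=> Fi; elim: s => [|i s IHs].
  by under eq_cintegral => t Dt do rewrite big_nil; rewrite big_nil cintegral0.
rewrite big_cons -IHs -cintegralD//; last exact: cintegrable_sum.
by apply: eq_cintegral => t _; rewrite big_cons.
Qed.

Lemma cintegral_conj F : cintegrable F ->
  cintegral (fun t => (F t)^*) = (cintegral F)^*.
Proof.
move=> [Fr Fi]; apply: complex_ext; rewrite ?cRe_conj ?cIm_conj /=.
  by apply: eq_Rintegral => t _; rewrite cRe_conj.
rewrite -mulN1r -RintegralZl//; apply: eq_Rintegral => t _.
by rewrite cIm_conj mulN1r.
Qed.

Lemma cintegral_real f : cintegral (fun t => (f t)%:C) = (\int[mu]_(t in D) f t)%:C.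
Proof. by apply: complex_ext => //=; rewrite Rintegral_cst ?mul0r. Qed.

Lemma cvg_cintegral (u : nat -> T -> R[i]) F g :
  (forall n, cmeasurable (u n)) ->
  (forall t, D t -> u n t @[n --> \oo] --> F t) ->
  mu.-integrable D (EFin \o g) ->
  (forall n t, D t -> normc (u n t) <= g t) ->
  cintegrable F /\ cintegral (u n) @[n --> \oo] --> cintegral F.
Proof.
move=> mun uF gi ug.
have [] := @cvg_Rintegral (fun n t => complex.Re (u n t)) (fun t => complex.Re (F t)) g.
- by move=> n; case: (mun n).
- by move=> t Dt; move: (uF t Dt) => /cvg_complexP[].
- by [].
- by move=> n t Dt; apply: le_trans (ug n t Dt); exact: le_Re_normc.
move=> Fr lr.
have [] := @cvg_Rintegral (fun n t => complex.Im (u n t)) (fun t => complex.Im (F t)) g.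
- by move=> n; case: (mun n).
- by move=> t Dt; move: (uF t Dt) => /cvg_complexP[].
- by [].
- by move=> n t Dt; apply: le_trans (ug n t Dt); exact: le_Im_normc.
by move=> Fi li; split => //; apply/cvg_complexP.
Qed.

Lemma cintegrable_bound F : cintegrable F ->
  mu.-integrable D (fun t => (`|complex.Re (F t)| + `|complex.Im (F t)|)%:E).
Proof.
by move=> [Fr Fi]; apply: real_integrableD; exact: real_integrable_norm.
Qed.

End complex_integral.

(** * Plane waves and their orthogonality *)

Section waves.
Context (R : realType) (q : nat) (X : homogeneous_tree q) (o : X).
Implicit Types (x y p : X) (w : boundary o) (s t : R).

Lemma q_gt0 : 0 < q%:R :> R.
Proof. by rewrite ltr0n (leq_trans _ (two_le_q X)). Qed.

Lemma q_gt1 : 1 < q%:R :> R.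
Proof. by rewrite ltr1n (two_le_q X). Qed.

Lemma lnq_gt0 : 0 < ln q%:R :> R.
Proof. by rewrite ln_gt0// q_gt1. Qed.

Lemma qpowD (a b : R[i]) : qpow q (a + b) = qpow q a * qpow q b.
Proof.
rewrite /qpow cReD cImD powRD; last first.
  by apply/implyP => _; rewrite gt_eqF ?q_gt0.
rewrite mulrDl cosD sinD; apply: complex_ext => /=; rewrite ?cReM ?cImM /=; ring.
Qed.

Lemma qpow0 : qpow q 0 = 1 :> R[i].
Proof. by rewrite /qpow /= powRr0 mul0r cos0 sin0 mulr1 mulr0. Qed.

Lemma qpow_nat (a : R[i]) n : qpow q (a * n%:R) = qpow q a ^+ n.
Proof.
elim: n => [|n IHn]; first by rewrite mulr0 qpow0.
by rewrite -natr1 mulrDr mulr1 qpowD IHn exprSr.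
Qed.

Lemma qpow_neq0 (a : R[i]) : qpow q a != 0.
Proof.
apply/eqP => a0; have := qpowD a (- a).
by rewrite a0 mul0r subrr qpow0 => /eqP; rewrite oner_eq0.
Qed.

Lemma qpowN (a : R[i]) : qpow q (- a) = (qpow q a)^-1.
Proof.
apply: (mulIf (qpow_neq0 a)); rewrite mulVf ?qpow_neq0//.
by rewrite -qpowD addNr qpow0.
Qed.

Lemma qpow_conj (a : R[i]) : (qpow q a)^* = qpow q a^*.
Proof.
apply: complex_ext; rewrite ?cRe_conj ?cIm_conj /qpow /= !cRe_conj !cIm_conj.
  by rewrite mulNr cosN.
by rewrite mulNr sinN mulrN.
Qed.

Definition angle s := s * ln q%:R.

Definition cis t : R[i] := cos t +i* sin t.

(** The factor gained by a plane wave when the height grows by one; its modulus is [root_q]. *)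
Definition zeta s : R[i] := qpow q (2^-1 -i* s).

Definition wave w s x : R[i] := qpow q ((2^-1 -i* s) * (height R w x)%:C).

Definition root_q : R := Num.sqrt q%:R.

Lemma root_q_gt0 : 0 < root_q.
Proof. by rewrite sqrtr_gt0 q_gt0. Qed.

Lemma sqr_root_q : root_q ^+ 2 = q%:R.
Proof. by rewrite sqr_sqrtr ?ltW ?q_gt0. Qed.

Lemma root_q_ge1 : 1 <= root_q.
Proof. by rewrite -[leLHS]sqrtr1 ler_sqrt ?q_gt0// ltW ?q_gt1. Qed.

Lemma cisD a b : cis (a + b) = cis a * cis b.
Proof.
rewrite /cis cosD sinD; apply: complex_ext; rewrite ?cReM ?cImM /=; ring.
Qed.

Lemma cis0 : cis 0 = 1.
Proof. by rewrite /cis cos0 sin0. Qed.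

Lemma cis_conj t : (cis t)^* = cis (- t).
Proof.
by rewrite /cis cosN sinN; apply: complex_ext; rewrite ?cRe_conj ?cIm_conj.
Qed.

Lemma cisX t n : cis t ^+ n = cis (n%:R * t).
Proof.
elim: n => [|n IHn]; first by rewrite mul0r cis0.
by rewrite exprSr IHn -cisD -natr1 mulrDl mul1r.
Qed.

Lemma cis_neq0 t : cis t != 0.
Proof.
apply/eqP => t0; have := cisD t (- t).
by rewrite t0 mul0r subrr cis0 => /eqP; rewrite oner_eq0.
Qed.

Lemma zetaE s : zeta s = root_q%:C * cis (- angle s).
Proof.
rewrite /zeta /qpow /= powR12_sqrt ?ltW ?q_gt0// /cis /angle mulNr.
by apply: complex_ext; rewrite ?cReM ?cImM /= mul0r ?subr0 ?addr0.
Qed.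

Lemma conj_zetaE s : (zeta s)^* = root_q%:C * cis (angle s).
Proof. by rewrite zetaE conjM cis_conj opprK; congr (_ * _); exact: conjc_real. Qed.

Lemma zeta_neq0 s : zeta s != 0.
Proof. exact: qpow_neq0. Qed.

Lemma zetaM_conj s : zeta s * (zeta s)^* = q%:R%:C.
Proof.
rewrite conj_zetaE zetaE mulrACA -rmorphM -expr2 sqr_root_q -cisD addNr cis0.
by rewrite mulr1.
Qed.

Lemma conj_zeta s : (zeta s)^* = q%:R%:C / zeta s.
Proof. by rewrite -(zetaM_conj s) mulrC mulKf// zeta_neq0. Qed.

Lemma normc_zeta s : normc (zeta s) = root_q.
Proof.
apply/eqP; rewrite -(@eqrXn2 _ 2)//; [|exact: normc_ge0|exact/ltW/root_q_gt0].
by apply/eqP/complexI; rewrite -mulc_conj zetaM_conj sqr_root_q.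
Qed.

Lemma wave_conj w s x : (wave w s x)^* = qpow q ((2^-1 +i* s) * (height R w x)%:C).
Proof.
have hE : ((height R w x)%:C)^* = (height R w x)%:C by exact: conjc_real.
have zE : (2^-1 -i* s)^* = 2^-1 +i* s.
  by apply: complex_ext; rewrite ?cRe_conj ?cIm_conj /= ?opprK.
by rewrite /wave qpow_conj conjM hE zE.
Qed.

Lemma wave_o w s : wave w s o = 1.
Proof. by rewrite /wave height_o mulr0 qpow0. Qed.

Lemma wave_shift w s x p : height R w x = height R w p + 1 ->
  wave w s x = zeta s * wave w s p.
Proof. by move=> xp; rewrite /wave xp rmorphD mulrDr mulr1 qpowD mulrC. Qed.

Lemma wave_shiftV w s x p : height R w x = height R w p - 1 ->
  wave w s x = (zeta s)^-1 * wave w s p.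
Proof.
by move=> xp; rewrite /wave xp rmorphB mulrDr mulrN mulr1 qpowD qpowN mulrC.
Qed.

Definition through x w : R := \1_(passing x) w.

Lemma throughE x w : through x w = if `[< passing x w >] then 1 else 0.
Proof.
rewrite /through indicE; case: asboolP => xw; first by rewrite mem_set.
by rewrite memNset.
Qed.

(** The indicator merges the two cases of [height_child] into one formula. It shows that the wave
    depends on the ray only through indicators of the sets E(x), which drives measurability, the
    recursion for spherical functions and the recovery of these indicators from waves. *)
Lemma wave_child w s x p : adj x p -> dist o x = (dist o p).+1 ->
  wave w s x = (zeta s)^-1 * wave w s p +
    (through x w)%:C * ((zeta s - (zeta s)^-1) * wave w s p).
Proof.
move=> xp xo; have := height_child R w xp xo; rewrite throughE.
case: asboolP => _ h; rewrite ?(wave_shift s h) ?(wave_shiftV s h); ring.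
Qed.

(** On the rays through [x] such a wave depends on [s] alone, so it can be taken out of integrals
    over E(x). *)
Lemma wave_passing w s x y : passing x w -> (dist o y <= dist o x)%N ->
  wave w s y = zeta s ^+ dist o x / zeta s ^+ dist y x.
Proof.
move=> xw yx; rewrite /wave (height_passing R xw yx) rmorphB !rmorph_nat.
by rewrite mulrDr mulrN qpowD qpowN !qpow_nat.
Qed.

Lemma normc_wave_le w s x : normc (wave w s x) <= root_q ^+ dist o x.
Proof.
have r1 := root_q_ge1.
have [n] := ubnP (dist o x); elim: n x => // n IHn x; rewrite ltnS => xn.
have [->|xo] := eqVneq x o; first by rewrite wave_o normc1 distxx.
have [p [xp e]] := parent_ex xo.
have pn : normc (wave w s p) <= root_q ^+ dist o p by apply: IHn; rewrite -e.
have [h|h] := dist_adj_height R w xp; rewrite ?(wave_shift s h) ?(wave_shiftV s h).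
  by rewrite normcM normc_zeta e exprS ler_wpM2l// ltW ?root_q_gt0.
have r0 := root_q_gt0; rewrite normcM normcV normc_zeta e exprS.
apply: ler_pM pn; [by rewrite invr_ge0 ltW|exact: normc_ge0|].
by apply: le_trans (r1); rewrite invf_le1.
Qed.

Lemma fourierE (f : X -> R[i]) (l : seq X) w s : uniq l ->
  (forall y, y \notin l -> f y = 0) ->
  fourier f w s = \sum_(y <- l) f y * (wave w s y)^*.
Proof.
move=> ul f0; rewrite /fourier -(fsbig_widen [set` l] setT)//; last first.
  by move=> y /= [_ /negP /f0 ->]; rewrite mul0r.
by rewrite -fsbig_seq//; apply: eq_bigr => y _; rewrite wave_conj.
Qed.

Lemma fourier_delta b w s : fourier (delta R b) w s = (wave w s b)^*.
Proof.
rewrite (@fourierE _ [:: b])// ?big_seq1 ?deltaE ?eqxx ?mul1r//.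
by move=> y; rewrite inE deltaE => /negbTE ->.
Qed.

(* The plane waves are joint eigenfunctions of the sum over neighbours, with an
   eigenvalue that is real and, up to scaling, the cosine of the angle. *)
Lemma sum_neighbors_wave w s y (l : seq X) :
  uniq l -> size l = q.+1 -> (forall z, (z \in l) = adj y z) ->
  \sum_(z <- l) wave w s z = (2 * root_q * cos (angle s))%:C * wave w s y.
Proof.
move=> ul sl lE.
pose g (h : R) := qpow q ((2^-1 -i* s) * h%:C) : R[i].
rewrite (sum_neighbors_height w g ul sl lE) {}/g.
rewrite rmorphD rmorphB mulrDr [_ * (_ - _)]mulrBr mulr1 !qpowD qpowN.
rewrite -/(wave w s y) -/(zeta s).
transitivity ((zeta s + (zeta s)^*) * wave w s y).
  rewrite conj_zeta rmorph_nat -mulr_natr; ring.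
congr (_ * _); rewrite conj_zetaE zetaE /cis cosN sinN.
by apply: complex_ext; rewrite ?cReD ?cImD ?cReM ?cImM /=; ring.
Qed.

End waves.

Section conj_facts.
Context (R : realType).
Implicit Types a b : R[i].

Lemma conjX a n : (a ^+ n)^* = a^* ^+ n.
Proof. exact: rmorphXn. Qed.

Lemma conjV a : (a^-1)^* = (a^*)^-1.
Proof. exact: fmorphV. Qed.

Lemma conjB a b : (a - b)^* = a^* - b^*.
Proof. exact: rmorphB. Qed.

Lemma conjR (r : R) : (r%:C)^* = r%:C :> R[i].
Proof. exact: conjc_real. Qed.

End conj_facts.

(** * Spherical functions *)

Section spherical.
Context (R : realType) (q : nat) (X : homogeneous_tree q) (o : X).
Context (nu : probability (boundary o) R).
Hypothesis nuP : is_boundary_measure nu.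
Implicit Types (x y p : X) (w : boundary o) (s : R).

Lemma cintegrable_bounded d (T : measurableType d)
    (mu : {measure set T -> \bar R}) (D : set T) (F : T -> R[i]) M :
  measurable D -> (mu D < +oo)%E -> cmeasurable D F -> cbounded D F M ->
  cintegrable mu D F.
Proof.
move=> mD Dfin mF FM.
have i1 : cintegrable mu D (fun=> 1 : R[i]).
  split; last exact: integrable0.
  apply/integrableP; split; first exact: measurable_cst.
  by under eq_integral do rewrite /= normr1; rewrite integral_cst// mul1e.
apply: (eq_cintegrable mD _ (cintegrableM_bounded mD i1 mF FM)) => t _.
exact: mul1r.
Qed.

Let mT : measurable [set: boundary o].
Proof. exact: measurableT. Qed.

Lemma nu_setT_fin : (nu setT < +oo)%E.
Proof. by rewrite probability_setT ltry. Qed.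

Lemma measurable_passing x : measurable (passing x : set (boundary o)).
Proof. by apply: sub_sigma_algebra; exists x. Qed.

Lemma passing_o : passing o = [set: boundary o].
Proof. by apply/seteqP; split => // w _; exists 0%N; exact: ray_start. Qed.

(** Since E(x) has positive measure, it is not empty. *)
Lemma passing_ex x : exists w : boundary o, passing x w.
Proof.
have [->|xo] := eqVneq x o; first by exists point; rewrite passing_o.
apply/not_existsP => no; have := nuP xo.
rewrite (_ : passing x = set0); last by apply/seteqP; split => // w /no.
rewrite measure0 => -[] /eqP; rewrite eq_sym gt_eqF//.
have q0 := q_gt0 R X; apply: divr_gt0 => //; apply: mulr_gt0 => //.
exact: exprn_gt0.
Qed.

Lemma cmeasurable_zeta d (T : measurableType d) (D : set T) (g : T -> R) :
  measurable_fun D g -> cmeasurable D (fun t => zeta q (g t)).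
Proof.
move=> mg; have mag : measurable_fun D (fun t => - angle q (g t)).
  by apply: measurableT_comp => //; exact: measurable_funM.
under eq_fun do rewrite (zetaE X).
apply: cmeasurableM; first exact: cmeasurable_cst.
by split=> /=; apply: measurableT_comp mag => //;
  apply: continuous_measurable_fun; [exact: continuous_cos|exact: continuous_sin].
Qed.

Lemma cmeasurable_zetaV d (T : measurableType d) (D : set T) (g : T -> R) :
  measurable_fun D g -> cmeasurable D (fun t => (zeta q (g t))^-1).
Proof.
move=> mg; have E (t : R) : (zeta q t)^-1 = q%:R^-1%:C * (zeta q t)^*.
  rewrite (conj_zeta X) mulrA -rmorphM mulVf; last exact: lt0r_neq0 (q_gt0 R X).
  by rewrite rmorph1 mul1r.
under eq_fun do rewrite E.
apply: cmeasurableM; first exact: cmeasurable_cst.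
by apply: cmeasurable_conj; exact: cmeasurable_zeta.
Qed.

Lemma cmeasurable_through d (T : measurableType d) (D : set T)
    (f : T -> boundary o) x : measurable_fun D f ->
  cmeasurable D (fun t => (through R x (f t))%:C).
Proof.
move=> mf; apply: cmeasurable_real.
apply: (measurableT_comp _ mf); apply: measurable_indic.
exact: measurable_passing.
Qed.

Lemma cmeasurable_wave d (T : measurableType d) (D : set T)
    (f : T -> boundary o) (g : T -> R) x :
  measurable_fun D f -> measurable_fun D g ->
  cmeasurable D (fun t => wave (f t) (g t) x).
Proof.
move=> mf mg; have [n] := ubnP (dist o x); elim: n x => // n IHn x; rewrite ltnS => xn.
have [->|xo] := eqVneq x o.
  by under eq_fun do rewrite wave_o; exact: cmeasurable_cst.
have [p [xp e]] := parent_ex xo.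
have mp : cmeasurable D (fun t => wave (f t) (g t) p) by apply: IHn; rewrite -e.
under eq_fun do rewrite (wave_child _ _ xp e).
apply: cmeasurableD; first by apply: cmeasurableM => //; exact: cmeasurable_zetaV.
apply: cmeasurableM; first exact: cmeasurable_through.
apply: cmeasurableM => //; apply: cmeasurableD; first exact: cmeasurable_zeta.
have -> : (fun t => - (zeta q (g t))^-1) = (fun t => (-1) * (zeta q (g t))^-1).
  by apply/funext => t; rewrite mulN1r.
apply: cmeasurableM; [exact: cmeasurable_cst|exact: cmeasurable_zetaV].
Qed.

Definition wave_pair s x y w := wave w s x * (wave w s y)^*.

Lemma cmeasurable_wave_pair s x y : cmeasurable setT (wave_pair s x y).
Proof.
apply: cmeasurableM; first exact: cmeasurable_wave.
by apply: cmeasurable_conj; exact: cmeasurable_wave.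
Qed.

Lemma cintegrable_wave_pair s x y : cintegrable nu setT (wave_pair s x y).
Proof.
apply: (@cintegrable_bounded _ _ _ _ _ (root_q R q ^+ dist o x * root_q R q ^+ dist o y)).
- exact: measurableT.
- exact: nu_setT_fin.
- exact: cmeasurable_wave_pair.
- move=> w _; rewrite /wave_pair normcM normc_conj.
  by apply: ler_pM; rewrite ?normc_ge0// normc_wave_le.
Qed.

(** The zonal spherical function: by [sphericalE] it depends on the distance of the two vertices
    only, at least where the sine of the angle is not zero. *)
Definition spherical s x y : R[i] := cintegral nu setT (wave_pair s x y).

Lemma spherical_conj s x y : spherical s y x = (spherical s x y)^*.
Proof.
rewrite -(cintegral_conj mT); last exact: cintegrable_wave_pair.
by apply: eq_cintegral => w _; rewrite /wave_pair conjM conjCK mulrC.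
Qed.

Lemma cintegral_through x (a : R[i]) : x != o ->
  cintegral nu setT (fun w => a * (through R x w)%:C) =
  a * (q%:R / (q.+1%:R * q%:R ^+ dist o x))%:C.
Proof.
move=> xo; have mx := measurable_passing x.
rewrite (cintegralZ mT); last first.
  apply: (@cintegrable_bounded _ _ _ _ _ 1) => //.
  - exact: nu_setT_fin.
  - exact: cmeasurable_through.
  - by move=> w _; rewrite normcR throughE; case: ifP; rewrite ?normr1 ?normr0.
congr (_ * _); rewrite (cintegral_real _ mT).
suff -> : \int[nu]_(w in setT) through R x w =
  q%:R / (q.+1%:R * q%:R ^+ dist o x) by [].
transitivity (fine (nu (passing x))); last by rewrite nuP.
by rewrite /Rintegral integral_indic// setIT.
Qed.

(** By [wave_child], the wave at [x] differs from the wave at [p] divided by [zeta] only on E(x).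
    There both waves are constant in the ray, by [wave_passing], so the correction is their product
    times the measure of E(x), simplified by writing q as [zeta] times its conjugate. *)
Lemma spherical_recursion s x p y : adj x p -> dist o x = (dist o p).+1 ->
  (dist o y <= dist o x)%N -> 
  spherical s x y = (zeta q s)^-1 * spherical s p y +
    (zeta q s - (zeta q s)^-1) * (zeta q s)^* / (zeta q s)^* ^+ dist y x /
    q.+1%:R%:C.
Proof.
move=> xp e yx.
have xo : x != o by rewrite eq_sym -dist_eq0 e.
have px : (dist o p <= dist o x)%N by rewrite e.
have z0 := zeta_neq0 X s.
have zc0 : (zeta q s)^* != 0 by rewrite conjC_eq0.
have q10 : q.+1%:R%:C != 0 :> R[i] by rewrite rmorph_nat pnatr_eq0.
have [w0 xw0] := passing_ex x.
have dpx : dist p x = 1%N.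
  have := dist_adj_cases x xp; rewrite distxx dist_sym; lia.
set a := (zeta q s - (zeta q s)^-1) * (zeta q s ^+ dist o x / zeta q s) *
  ((zeta q s)^* ^+ dist o x / (zeta q s)^* ^+ dist y x).
transitivity (cintegral nu setT (fun w => (zeta q s)^-1 * wave_pair s p y w +
   a * (through R x w)%:C)).
  apply: eq_cintegral => w _; rewrite /wave_pair (wave_child w s xp e).
  rewrite throughE; case: asboolP => xw; last by rewrite !mul0r !addr0 mulr0 addr0 mulrA.
  have c1 : 1%:C = 1 :> R[i] by [].
  have wp : wave w s p = zeta q s ^+ dist o x / zeta q s.
    by rewrite (wave_passing s xw px) dpx expr1.
  have wy : (wave w s y)^* = (zeta q s)^* ^+ dist o x / (zeta q s)^* ^+ dist y x.
    by rewrite (wave_passing s xw yx) conjM conjV !conjX.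
  by rewrite /a -wp -wy c1; ring.
rewrite (cintegralD mT); last 2 first.
- by apply: (cintegrableZ mT); exact: cintegrable_wave_pair.
- apply: (cintegrableZ mT).
  apply: (@cintegrable_bounded _ _ _ _ _ 1) => //.
  + exact: nu_setT_fin.
  + exact: cmeasurable_through.
  + by move=> w _; rewrite normcR throughE; case: ifP; rewrite ?normr1 ?normr0.
rewrite (cintegralZ mT (zeta q s)^-1 (cintegrable_wave_pair s p y)).
rewrite cintegral_through//; congr (_ + _).
have -> : (q%:R / (q.+1%:R * q%:R ^+ dist o x))%:C =
    q%:R%:C / (q.+1%:R%:C * q%:R%:C ^+ dist o x) :> R[i].
  by rewrite rmorphM fmorphV rmorphM rmorphXn.
rewrite -(zetaM_conj X s) exprMn /a.
have zn0 := expf_neq0 (dist o x) z0.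
have zcn0 := expf_neq0 (dist o x) zc0.
have zcd0 := expf_neq0 (dist y x) zc0.
move: (zeta q s) (zeta q s)^* (_ ^+ _) (_ ^+ _) (_ ^+ _) (q.+1%:R%:C) z0 zc0 zn0 zcn0 zcd0 q10 {a w0 xw0}.
move=> z zc zn zcn zcd q1 z0 zc0 zn0 zcn0 zcd0 q10.
by field; rewrite ?z0 ?zcd0 ?q10 ?zc0 ?zn0 ?zcn0.
Qed.

(** The integrand is the Poisson kernel q^h. One use of the recursion for the pair [x], [x] and one,
    conjugated, for [x], [p] lead back to the pair [p], [p]. *)
Lemma spherical_diag s x : spherical s x x = 1.
Proof.
have [n] := ubnP (dist o x); elim: n x => // n IHn x; rewrite ltnS => xn.
have [->|xo] := eqVneq x o.
  transitivity (cintegral nu setT (fun w => (cst 1 w : R)%:C)).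
    by apply: eq_cintegral => w _; rewrite /wave_pair wave_o conjC1 mulr1.
  rewrite (cintegral_real _ mT) Rintegral_cst// mul1r.
  by rewrite (_ : fine _ = 1)//; exact: (congr1 fine (probability_setT nu)).
have [p [xp e]] := parent_ex xo.
have pp : spherical s p p = 1 by apply: IHn; rewrite -e.
have px : (dist o p <= dist o x)%N by rewrite e.
have dpx : dist p x = 1%N.
  have := dist_adj_cases x xp; rewrite distxx dist_sym; lia.
rewrite (spherical_recursion s xp e (leqnn _)) distxx.
rewrite spherical_conj (spherical_recursion s xp e px) pp dpx mulr1.
have z0 := zeta_neq0 X s.
have zc0 : (zeta q s)^* != 0 by rewrite conjC_eq0.
have q10 : q.+1%:R%:C != 0 :> R[i] by rewrite rmorph_nat pnatr_eq0.
have q1E : q.+1%:R%:C = zeta q s * (zeta q s)^* + 1 :> R[i].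
  by rewrite (zetaM_conj X) -natr1 rmorphD.
rewrite expr0 expr1 divr1 conjD !conjM !conjV conjR conjB conjV conjCK.
move: q10; rewrite q1E; move: (zeta q s) (zeta q s)^* z0 zc0 => z zc z0 zc0 q10.
by field; rewrite ?z0 ?zc0 ?q10.
Qed.

(** Denominators are cleared because the sine vanishes at both ends of the period, and the last sine
    is that of (k-1) times the angle, written so that k = 0 is covered. The induction removes the
    edge from the vertex farther from [o] to its parent; the roles may be exchanged by conjugation
    because the right-hand side is real. *)
Lemma sphericalE s x y :
  (root_q R q ^+ dist x y * q.+1%:R * sin (angle q s))%:C * spherical s x y =
  (q%:R * sin ((dist x y).+1%:R * angle q s) -
   sin ((dist x y)%:R * angle q s - angle q s))%:C.
Proof.
have [n] := ubnP (dist x y); elim: n x y => // n IHn x y; rewrite ltnS => xyn.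
have [<-|xy] := eqVneq x y.
  rewrite distxx spherical_diag expr0 mul1r mulr1 mul0r sub0r sinN opprK mul1r.
  by rewrite -natr1; congr (_%:C); ring.
wlog yx : x y xyn xy / (dist o y <= dist o x)%N => [hw|].
  have [/hw|/ltnW yx] := leqP (dist o y) (dist o x); first exact.
  have := hw y x; rewrite dist_sym eq_sym => /(_ xyn xy yx).
  move/(congr1 Num.conj); rewrite conjM !conjR -spherical_conj.
  by rewrite dist_sym.
have xo : x != o.
  apply: contraNneq xy => xo; move: yx; rewrite xo distxx leqn0 dist_eq0 eq_sym.
  by move=> /eqP <-.
have [p [xp e]] := parent_ex xo.
have [w xw] := passing_ex x.
have d := dist_parent xw xp e yx xy.
have := IHn p y; rewrite -ltnS -d => /(_ xyn).
rewrite (spherical_recursion s xp e yx) (dist_sym y x) d.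
move: (dist p y) => k; set M := spherical s p y; set A := angle q s.
set r := root_q R q; set q1 : R := q.+1%:R => IH.
have r0 : r%:C != 0 :> R[i] by rewrite eq_complex /= eqxx andbT gt_eqF ?(root_q_gt0 R X).
have q10 : q1%:C != 0 :> R[i] by rewrite rmorph_nat pnatr_eq0.
have cA0 := cis_neq0 A.
have zV : (zeta q s)^-1 = cis A / r%:C.
  by rewrite (zetaE X) -cis_conj cis_conj invfM mulrC; congr (_ / _);
    apply: (mulIf (cis_neq0 (- A))); rewrite mulVf ?cis_neq0// -cisD subrr cis0.
have zc := conj_zetaE X s; rewrite -/r -/A in zc.
have zE : zeta q s = q%:R%:C / (r%:C * cis A).
  by rewrite -zc -(zetaM_conj X s) mulfK// zc mulf_neq0.
set B := k.+1%:R * A.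
have cAX : cis A ^+ k.+1 = cis B by rewrite cisX.
have cB0 := cis_neq0 B.
have cBV : (cis B)^-1 = cis (- B).
  by apply: (mulIf cB0); rewrite mulVf// -cisD addNr cis0.
transitivity (cis A * ((r ^+ k * q1 * sin A)%:C * M) +
    (sin A)%:C * (q%:R%:C - cis A ^+ 2) * cis (- B)).
  rewrite zV zc zE exprMn cAX -cBV !rmorphM rmorphXn /=.
  have rk0 : r%:C ^+ k != 0 by rewrite expf_neq0.
  rewrite !exprS rmorphXn; move: (r%:C) (r%:C ^+ k) (cis A) (cis B) (q1%:C)
    (q%:R%:C) r0 rk0 cA0 cB0 q10 => a b c d' e' f a0 b0 c0 d0 e0.
  by field; rewrite ?a0 ?b0 ?c0 ?d0 ?e0.
rewrite IH expr2.
have -> : k%:R * A - A = B - (A + A) by rewrite /B -natr1; ring.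
have -> : k.+2%:R * A = B + A by rewrite -[k.+2%:R]natr1 mulrDl mul1r.
rewrite !(sinD, cosD, sinN, cosN).
apply: complex_ext; rewrite /cis ?cReD ?cImD ?cReM ?cImM ?cReN ?cImN ?cReM ?cImM /=
  ?sinN ?cosN; last by ring.
apply/eqP; rewrite -subr_eq0; apply/eqP.
transitivity ((cos B * sin A - sin B * cos A) * (cos A ^+ 2 + sin A ^+ 2 - 1)).
  ring.
by rewrite cos2Dsin2 subrr mulr0.
Qed.

End spherical.

(** * The Plancherel density *)

Section density.
Context (R : realType) (q : nat) (X : homogeneous_tree q).
Implicit Types (s t : R).

Notation leb := (@lebesgue_measure R).
Notation period := (`[0, tau R q]%classic : set R).
Notation ang := (@angle R q).

(** The squared modulus of q^(1/2) e^(it) - q^(-1/2) e^(-it), the numerator of the c-function. It is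
    bounded away from zero. *)
Definition denom t : R := q%:R + q%:R^-1 - 2 * cos (2 * t).

Lemma tau_gt0 : 0 < tau R q.
Proof. by rewrite divr_gt0 ?pi_gt0// (lnq_gt0 R X). Qed.

Lemma angle_tau : ang (tau R q) = pi.
Proof. by rewrite /angle /tau divfK// gt_eqF// (lnq_gt0 R X). Qed.

Lemma angle_itv s : period s -> 0 <= ang s <= pi.
Proof.
rewrite /= in_itv/= => /andP[s0 st]; have l0 := lnq_gt0 R X.
by rewrite mulr_ge0 ?(ltW l0)//= -angle_tau ler_wpM2r// ltW.
Qed.

Lemma lebesgue_period_fin : (leb period < +oo)%E.
Proof. by rewrite lebesgue_measure_itv/=; case: ifP; rewrite ?ltry// -EFinB ltry. Qed.

Lemma denom_ge t : q%:R + q%:R^-1 - 2 <= denom t.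
Proof. by rewrite lerD2l lerN2 ler_piMr// cos_le1. Qed.

Lemma denom_lb_gt0 : 0 < q%:R + q%:R^-1 - 2 :> R.
Proof.
have q0 := q_gt0 R X; have q1 := q_gt1 R X.
have -> : q%:R + q%:R^-1 - 2 = (q%:R - 1) ^+ 2 / q%:R :> R.
  by field; rewrite gt_eqF.
by rewrite divr_gt0// exprn_gt0// subr_gt0.
Qed.

Lemma denom_gt0 t : 0 < denom t.
Proof. exact: lt_le_trans denom_lb_gt0 (denom_ge t). Qed.

Lemma continuous_angle (c : R) : continuous (fun s => c * ang s).
Proof. by move=> s; apply: cvgMr; apply: cvgMl; exact: cvg_id. Qed.

Lemma measurable_sin_angle (c : R) : measurable_fun setT (fun s => sin (c * ang s)).
Proof.
apply: continuous_measurable_fun => s.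
apply: continuous_comp; [exact: continuous_angle|exact: continuous_sin].
Qed.

Lemma measurable_cos_angle (c : R) : measurable_fun setT (fun s => cos (c * ang s)).
Proof.
apply: continuous_measurable_fun => s.
apply: continuous_comp; [exact: continuous_angle|exact: continuous_cos].
Qed.

Lemma continuous_denomV : continuous (fun s => (denom (ang s))^-1).
Proof.
move=> s; apply: cvgV; first by rewrite gt_eqF// denom_gt0.
apply: cvgB; first exact: cvg_cst.
apply: cvgMr; apply: (@continuous_comp _ _ _ (fun s => 2 * ang s) cos).
  exact: continuous_angle.
exact: continuous_cos.
Qed.

Lemma measurable_denomV : measurable_fun setT (fun s => (denom (ang s))^-1).
Proof. by apply: continuous_measurable_fun; exact: continuous_denomV. Qed.

Lemma denomV_le s : (denom (ang s))^-1 <= (q%:R + q%:R^-1 - 2)^-1.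
Proof. by rewrite lef_pV2 ?posrE ?denom_gt0 ?denom_lb_gt0// denom_ge. Qed.

Lemma integral_cos_angle (k : nat) : (0 < k)%N ->
  \int[leb]_(s in period) cos (k%:R * ang s) = 0.
Proof.
move=> k0; have l0 := lnq_gt0 R X; pose c : R := k%:R * ln q%:R.
have c0 : c != 0 by rewrite gt_eqF// mulr_gt0// ltr0n.
pose F s : R := c^-1 * sin (c * s).
have dc (s : R) : is_derive s 1 (fun s => c * s) c.
  apply: (@is_derive_eq _ _ _ (c \*: id) _ _ _ _ (is_deriveZ c (is_derive_id s 1))).
  by rewrite /GRing.scale/= mulr1.
have dF (s : R) : is_derive s 1 F (cos (c * s)).
  have -> : cos (c * s) = c^-1 *: (cos (c * s) * c).
    by rewrite /GRing.scale/=; field.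
  exact: (is_deriveZ c^-1 (is_derive1_comp (is_derive_sin (c * s)) (dc s))).
have cF s : F x @[x --> s] --> F s.
  by apply: differentiable_continuous; apply/derivable1_diffP; case: (dF s).
have t0 := tau_gt0.
have csin : continuous (fun s : R => cos (c * s)).
  move=> s; apply: (@continuous_comp _ _ _ (fun s => c * s) cos).
    by apply: cvgMr; exact: cvg_id.
  exact: continuous_cos.
have sin_pi n : sin (n%:R * pi) = 0 :> R.
  elim: n => [|n IHn]; first by rewrite mul0r sin0.
  by rewrite -natr1 mulrDl mul1r sinDpi IHn oppr0.
have -> : (fun s => cos (k%:R * ang s)) = (fun s => cos (c * s)).
  by apply/funext => s; rewrite /angle /c mulrAC mulrA.
rewrite /Rintegral (@continuous_FTC2 R _ F 0 (tau R q) t0).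
- rewrite /= /F mulr0 sin0 mulr0 subr0.
  have -> : c * tau R q = k%:R * pi by rewrite /c -angle_tau /angle; ring.
  by rewrite sin_pi mulr0.
- exact: continuous_subspaceT.
- split => [s _| |]; first by case: (dF s).
    by apply: cvg_at_right_filter; exact: cF.
  by apply: cvg_at_left_filter; exact: cF.
- by move=> s _; rewrite derive1E; case: (dF s).
Qed.

Lemma real_bounded_integrable (f : R -> R) M : measurable_fun setT f ->
  (forall s, `|f s| <= M) -> leb.-integrable period (EFin \o f).
Proof.
move=> mf fM; apply: measurable_bounded_integrable => //.
- exact: lebesgue_period_fin.
- exact: measurable_funS mf.
- by exists M; split; [exact: num_real|move=> x Mx s _; apply: le_trans (fM s) (ltW Mx)].
Qed.

Lemma integral_sin_sin_angle (m : nat) : (1 < m)%N ->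
  \int[leb]_(s in period) (sin (ang s) * sin (m%:R * ang s)) = 0.
Proof.
case: m => [//|[//|m]] _.
have ic k : leb.-integrable period (fun s => (2^-1 * cos (k%:R * ang s))%:E).
  apply: (@real_bounded_integrable _ 2^-1).
    by apply: measurable_funM => //; exact: measurable_cos_angle.
  by move=> s; rewrite normrM gtr0_norm// ler_piMr// ler_norml cos_geN1 cos_le1.
have ic' k : leb.-integrable period (EFin \o fun s => cos (k%:R * ang s)).
  apply: (@real_bounded_integrable _ 1); first exact: measurable_cos_angle.
  by move=> s; rewrite ler_norml cos_geN1 cos_le1.
transitivity (\int[leb]_(s in period)
    (2^-1 * cos (m.+1%:R * ang s) - 2^-1 * cos (m.+3%:R * ang s))).
  apply: eq_Rintegral => s _.
  have -> : m.+1%:R * ang s = m.+2%:R * ang s - ang s.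
    by rewrite -[m.+2%:R]natr1 mulrDl mul1r addrK.
  have -> : m.+3%:R * ang s = m.+2%:R * ang s + ang s.
    by rewrite -[m.+3%:R]natr1 mulrDl mul1r.
  by rewrite cosB cosD; field.
rewrite RintegralB//; [|exact: ic|exact: ic].
rewrite !RintegralZl ?integral_cos_angle ?mulr0 ?subrr//.
Qed.

Lemma qpow_imaginary s : qpow q ('i%C * s%:C) = cis (ang s).
Proof.
have -> : 'i%C * s%:C = 0 +i* s.
  by apply: complex_ext; rewrite ?cReM ?cImM /=; ring.
by rewrite /qpow /= powRr0 !mul1r.
Qed.

Lemma qpow_half : qpow q (2^-1 : R[i]) = (root_q R q)%:C.
Proof.
have -> : (2^-1 : R[i]) = (2^-1)%:C by rewrite fmorphV rmorph_nat.
rewrite /qpow /= mul0r cos0 sin0 mulr1 mulr0 powR12_sqrt//.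
Qed.

Definition density_cst : R := c_P R q * q.+1%:R ^+ 2 / q%:R * 4.

Lemma density_cst_gt0 : 0 < density_cst.
Proof.
have q0 := q_gt0 R X; have l0 := lnq_gt0 R X.
rewrite /density_cst /c_P; do ![apply: mulr_gt0 => //].
by rewrite invr_gt0 mulr_gt0 ?mulr_gt0 ?pi_gt0.
by rewrite invr_gt0.
Qed.

(** The squared modulus of q^(is) - q^(-is) is four times a squared sine. At the poles of [cfun]
    both sides are zero, the left one by the value of the inverse at zero. *)
Lemma plancherel_densityE s : plancherel_density q s =
  density_cst * (sin (ang s) ^+ 2 * (denom (ang s))^-1).
Proof.
have q0 := q_gt0 R X; have r0 := root_q_gt0 R X; have r2 := sqr_root_q R X.
rewrite /plancherel_density /cfun -/(root_q R q) mulNr -opprD !(qpowN X).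
rewrite (qpowD X) qpow_half qpow_imaginary !normcM !normcV normcR.
rewrite ger0_norm; last by rewrite divr_ge0// ltW.
have cV : (cis (ang s))^-1 = cis (- ang s).
  by apply: (mulIf (cis_neq0 (ang s))); rewrite mulVf ?cis_neq0// -cisD addNr cis0.
have rV : ((root_q R q)%:C)^-1 = (root_q R q)^-1%:C by rewrite fmorphV.
rewrite [((root_q R q)%:C * _)^-1]invfM cV rV.
have n1 : normc ((root_q R q)%:C * cis (ang s) -
    (root_q R q)^-1%:C * cis (- ang s)) ^+ 2 = denom (ang s).
  rewrite normcsqE /cis cosN sinN cReD cImD cReN cImN !cReM !cImM /= /denom -r2.
  rewrite (_ : 2 * ang s = ang s + ang s); last by ring.
  rewrite cosD; transitivity ((root_q R q ^+ 2 + (root_q R q ^+ 2)^-1) *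
      (cos (ang s) ^+ 2 + sin (ang s) ^+ 2) - 2 * (cos (ang s) ^+ 2 - sin (ang s) ^+ 2)).
    by field; rewrite gt_eqF.
  by rewrite cos2Dsin2 mulr1; ring.
have n2 : normc (cis (ang s) - cis (- ang s)) ^+ 2 = 4 * sin (ang s) ^+ 2.
  by rewrite normcsqE /cis cosN sinN cReD cImD cReN cImN /=; ring.
move: n1 n2; move: (normc _) (normc _) => M N n1 n2.
have -> : (root_q R q / q.+1%:R * (N / M)) ^+ 2 =
    root_q R q ^+ 2 / q.+1%:R ^+ 2 * (N ^+ 2 * (M ^+ 2)^-1).
  by rewrite !exprMn !exprVn.
rewrite n1 n2 r2 !invfM !invrK /density_cst; ring.
Qed.

Lemma density_ge0 s : 0 <= plancherel_density q s.
Proof.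
rewrite plancherel_densityE mulr_ge0 ?(ltW density_cst_gt0)//.
by rewrite mulr_ge0 ?sqr_ge0// invr_ge0 ltW// denom_gt0.
Qed.

Lemma density_gt0 s : 0 < s < tau R q -> 0 < plancherel_density q s.
Proof.
move=> /andP[s0 st]; have l0 := lnq_gt0 R X.
rewrite plancherel_densityE mulr_gt0 ?density_cst_gt0// mulr_gt0 ?invr_gt0 ?denom_gt0//.
rewrite exprn_gt0// sin_gt0_pi// mulr_gt0//=.
by rewrite -angle_tau ltr_pM2r.
Qed.

Definition density_bound : R := density_cst * (q%:R + q%:R^-1 - 2)^-1.

Lemma density_le s : plancherel_density q s <= density_bound.
Proof.
rewrite plancherel_densityE ler_wpM2l ?(ltW density_cst_gt0)//.
rewrite -[leRHS]mul1r; apply: ler_pM; [exact: sqr_ge0| | |exact: denomV_le].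
  by rewrite invr_ge0 ltW// denom_gt0.
by rewrite -(cos2Dsin2 (ang s)) lerDr sqr_ge0.
Qed.

Lemma measurable_density : measurable_fun setT (plancherel_density q : R -> R).
Proof.
rewrite (_ : plancherel_density q = fun s => density_cst *
  (sin (ang s) ^+ 2 * (denom (ang s))^-1)); last exact/funext/plancherel_densityE.
apply: measurable_funM => //; apply: measurable_funM; last exact: measurable_denomV.
apply: measurable_funX; have := measurable_sin_angle 1.
by under eq_fun do rewrite mul1r.
Qed.

Lemma density_integrable : leb.-integrable period (EFin \o plancherel_density q).
Proof.
apply: (@real_bounded_integrable _ density_bound); first exact: measurable_density.
by move=> s; rewrite ger0_norm ?density_ge0// density_le.
Qed.

Definition density_mass : R := \int[leb]_(s in period) plancherel_density q s.

(** If the integral were zero, the density would vanish almost everywhere, whereas it is positive on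
    the open period. Positivity allows division by the squared norm of the waves. *)
Lemma density_mass_gt0 : 0 < density_mass.
Proof.
rewrite lt_neqAle Rintegral_ge0; last by move=> s _; exact: density_ge0.
rewrite andbT eq_sym; apply/eqP => mass0.
have mE : measurable_fun period (EFin \o plancherel_density q).
  by apply/measurable_EFinP; exact: measurable_funS measurable_density.
have : (\int[leb]_(s in period) `|(EFin \o plancherel_density q) s|)%E = 0.
  transitivity (\int[leb]_(s in period) (plancherel_density q s)%:E)%E.
    by apply: eq_integral => s _; rewrite /= ger0_norm// density_ge0.
  rewrite -[LHS]fineK; first by move: mass0; rewrite /density_mass /Rintegral => ->.
  by apply: integrable_fin_num => //; exact: density_integrable.
move=> int0.
have [N [mN N0 subN]] := (ae_eq_integral_abs leb (measurable_itv _ : measurable period) mE).1 int0.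
pose J : set R := `]0, tau R q[%classic.
have JN : J `<=` N.
  move=> s; rewrite /J /= in_itv/= => /andP[s0 st]; apply: subN => /= H.
  have /H : period s by rewrite /= in_itv/= !ltW.
  by move=> [] /eqP; rewrite gt_eqF// density_gt0// s0 st.
have : (leb J <= leb N)%E by apply: le_measure; rewrite ?inE//; exact: measurable_itv.
rewrite N0 /J lebesgue_measure_itv/= lte_fin tau_gt0 -EFinB subr0 lee_fin.
by rewrite leNgt tau_gt0.
Qed.

End density.

Lemma real_complexM (R : realType) (a b : R) : (a * b)%:C = a%:C * b%:C :> R[i].
Proof. exact: rmorphM. Qed.

(** * Sine integrals *)

Section sine_integrals.
Context (R : realType) (q : nat) (X : homogeneous_tree q).

Notation leb := (@lebesgue_measure R).
Notation period := (`[0, tau R q]%classic : set R).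
Notation ang := (@angle R q).

(** One sine of the density is absorbed by [sphericalE]; what is left of density times spherical
    function at distance k is a combination of these for m = k+1 and m = k-1. *)
Definition sine_integrand (m : nat) (s : R) : R :=
  sin (ang s) * sin (m%:R * ang s) * (denom q (ang s))^-1.

Definition sine_integral (m : nat) : R :=
  \int[leb]_(s in period) sine_integrand m s.

Let bound : R := (q%:R + q%:R^-1 - 2)^-1.

Let bound_ge0 : 0 <= bound.
Proof. by rewrite invr_ge0 ltW// (denom_lb_gt0 R X). Qed.

Lemma norm_sine_integrand m s : `|sine_integrand m s| <= bound.
Proof.
have d0 := denom_gt0 X (ang s).
have dV0 : 0 <= (denom q (ang s))^-1 by rewrite invr_ge0 ltW.
rewrite normrM (ger0_norm dV0) -[leRHS]mul1r; apply: ler_pM => //.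
  rewrite normrM -[leRHS]mul1r; apply: ler_pM => //.
    by rewrite ler_norml sin_geN1 sin_le1.
  by rewrite ler_norml sin_geN1 sin_le1.
exact: (denomV_le X).
Qed.

Lemma sine_integrable m : leb.-integrable period (EFin \o sine_integrand m).
Proof.
apply: (@real_bounded_integrable _ _ _ bound).
  apply: measurable_funM; last exact: (measurable_denomV X).
  apply: measurable_funM; last exact: measurable_sin_angle.
  have := @measurable_sin_angle R q 1.
  by under eq_fun do rewrite mul1r.
exact: norm_sine_integrand.
Qed.

Lemma norm_sine_integral m : `|sine_integral m| <= bound * fine (leb period).
Proof.
apply: le_trans (le_normr_Rintegral _ (sine_integrable m)) _ => //.
rewrite -Rintegral_cst//; apply: le_Rintegral => //.
- exact: (real_integrable_norm (sine_integrable m)).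
- apply: (@real_bounded_integrable _ _ _ bound) => // s.
  by rewrite ger0_norm.
- by move=> s _; exact: norm_sine_integrand.
Qed.

(** The factor on the left is [denom] plus twice the cosine of the double angle. The first part
    cancels the denominator and leaves an integral that vanishes by [integral_sin_sin_angle]; the
    second shifts the frequency by two in both directions. *)
Lemma sine_integral_recursion m :
  (q%:R + q%:R^-1) * sine_integral m.+2 = sine_integral m.+4 + sine_integral m.
Proof.
have i k := sine_integrable k.
rewrite /sine_integral -RintegralZl// -RintegralD//.
apply/eqP; rewrite -subr_eq0 -RintegralB//; last 2 first.
- exact: real_integrableZ.
- exact: real_integrableD.
apply/eqP; rewrite -[RHS](@integral_sin_sin_angle R q X m.+2)//.
apply: eq_Rintegral => s _; rewrite /sine_integrand.
have d0 := denom_gt0 X (ang s).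
have -> : m.+4%:R * ang s = m.+2%:R * ang s + (ang s + ang s).
  by rewrite -addn2 natrD; ring.
have -> : m%:R * ang s = m.+2%:R * ang s - (ang s + ang s).
  by rewrite -addn2 natrD; ring.
have dE : q%:R + q%:R^-1 = denom q (ang s) + 2 * cos (ang s + ang s) :> R.
  by rewrite /denom (_ : ang s + ang s = 2 * ang s) ?subrK//; ring.
rewrite dE sinB sinD; field; rewrite gt_eqF//.
Qed.

(* The bounded sequence [q S_(m+2) - S_m] is multiplied by [q] whenever [m]
   grows by two, so it vanishes. *)
Lemma sine_integral_shift m : q%:R * sine_integral m.+2 = sine_integral m.
Proof.
have q1 := q_gt1 R X; have q0 := q_gt0 R X.
pose w k := q%:R * sine_integral k.+2 - sine_integral k.
have wS k : w k.+2 = q%:R * w k.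
  have := sine_integral_recursion k.
  rewrite /w mulrDl => /(canRL (addrK _)) e.
  rewrite mulrBr; apply/eqP; rewrite -subr_eq0; apply/eqP.
  have -> : sine_integral k.+4 = (q%:R + q%:R^-1) * sine_integral k.+2 - sine_integral k.
    by rewrite sine_integral_recursion addrK.
  by field; rewrite gt_eqF.
have wn n : w (m + n.*2)%N = q%:R ^+ n * w m.
  elim: n => [|n IHn]; first by rewrite addn0 mul1r.
  by rewrite doubleS !addnS wS IHn exprS mulrA.
pose C := (q%:R + 1) * (bound * fine (leb period)).
have wC k : `|w k| <= C.
  rewrite /w /C mulrDl mul1r; apply: le_trans (ler_normB _ _) _.
  apply: lerD; last exact: norm_sine_integral.
  by rewrite normrM gtr0_norm// ler_wpM2l ?(ltW q0)// norm_sine_integral.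
apply/eqP; rewrite -subr_eq0 -/(w m); apply/negP => /negP wm0.
have wm1 : 0 < `|w m| by rewrite normr_gt0.
have := wC (m + (Num.bound (C / `|w m|)).*2)%N; apply/negP; rewrite -ltNge.
rewrite wn normrM normrX gtr0_norm// -ltr_pdivrMr//.
have C0 : 0 <= C / `|w m|.
  by rewrite divr_ge0// (le_trans (normr_ge0 (w m)) (wC m)).
apply: lt_le_trans (archi_boundP C0) _.
by rewrite -natrX ler_nat ltnW// ltn_expl// (two_le_q X).
Qed.

End sine_integrals.

(** * Orthogonality of the plane waves *)

Section orthogonality.
Context (R : realType) (q : nat) (X : homogeneous_tree q) (o : X).
Context (nu : probability (boundary o) R).
Hypothesis nuP : is_boundary_measure nu.

Notation leb := (@lebesgue_measure R).
Notation period := (`[0, tau R q]%classic : set R).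
Notation phase := (boundary o * measurableTypeR R)%type.
Notation ang := (@angle R q).
Notation base := (base_measure nu).
Notation D := (@phase_space R q X o).

Let density (s : R) : R := plancherel_density q s.

Lemma integral_density_spherical x y :
  cintegral leb period (fun s => (density s)%:C * spherical nu s x y) =
  ((x == y)%:R * density_mass R q)%:C.
Proof.
have mp : measurable period by exact: measurable_itv.
have [<-|xy] := eqVneq x y.
  rewrite mul1r -(cintegral_real leb mp); apply: eq_cintegral => s _.
  by rewrite (spherical_diag nuP) mulr1.
rewrite mul0r; case d : (dist x y) => [|j].
  by move/eqP : d; rewrite dist_eq0 (negbTE xy).
have r0 : root_q R q ^+ j.+1 * q.+1%:R != 0.
  by rewrite gt_eqF// mulr_gt0// exprn_gt0// (root_q_gt0 R X).
pose K := density_cst R q / (root_q R q ^+ j.+1 * q.+1%:R).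
transitivity (cintegral leb period (fun s =>
    (K * (q%:R * sine_integrand q j.+2 s - sine_integrand q j s))%:C)).
  apply: eq_cintegral => s _; have := sphericalE nuP s x y.
  rewrite d => e; rewrite /density (plancherel_densityE X).
  have -> : density_cst R q * (sin (ang s) ^+ 2 * (denom q (ang s))^-1) =
    K * sin (ang s) * (denom q (ang s))^-1 *
    (root_q R q ^+ j.+1 * q.+1%:R * sin (ang s)).
    rewrite /K; move: (_ * q.+1%:R) r0 (lt0r_neq0 (denom_gt0 X (ang s))).
    by move: (denom _ _) => de Z Z0 de0; field; rewrite Z0 de0.
  rewrite real_complexM -mulrA e -real_complexM; apply: (congr1 (fun r => r%:C)).
  have -> : j.+1%:R * ang s - ang s = j%:R * ang s.
    by rewrite -natr1 mulrDl mul1r addrK.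
  by rewrite /sine_integrand; ring.
rewrite (cintegral_real leb mp).
have i k := sine_integrable R X k.
rewrite RintegralZl//; last first.
  apply: real_integrableD => //; first by apply: real_integrableZ => //; exact: i.
  by apply: real_integrableN => //; exact: i.
rewrite RintegralB//; last exact: real_integrableZ.
by rewrite RintegralZl// -!/(sine_integral _ _) (sine_integral_shift R X) subrr mulr0.
Qed.

Lemma measurable_phase_space : measurable (D : set phase).
Proof. by apply: measurableX; [exact: measurableT|exact: measurable_itv]. Qed.

Lemma base_phase_space_fin : (base D < +oo)%E.
Proof.
rewrite /base_measure product_measure1E; [|exact: measurableT|exact: measurable_itv].
apply: lte_mul_pinfty => //; last exact: lebesgue_period_fin.
by rewrite ge0_fin_numE//; exact: nu_setT_fin.
Qed.

Lemma real_fubini (f : phase -> R) M : measurable_fun setT f ->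
  (forall z, `|f z| <= M) ->
  \int[base]_(z in D) f z =
  \int[leb]_(s in period) \int[nu]_(w in setT) f (w, s).
Proof.
move=> mf fM; have mD := measurable_phase_space.
have fi : base.-integrable D (EFin \o f).
  apply: measurable_bounded_integrable => //.
  - exact: base_phase_space_fin.
  - exact: measurable_funS mf.
  - by exists M; split; [exact: num_real|move=> x Mx s _; apply: le_trans (fM s) (ltW Mx)].
have fDi := (integrable_mkcond _ mD).1 fi.
rewrite /Rintegral; congr fine.
(* Extension by zero turns both sides into integrals over whole spaces, where Fubini's theorem
   applies; outside the period the inner integral is then zero. *)
rewrite integral_mkcond /base_measure -integral21_prod_meas1//.
rewrite [RHS]integral_mkcond; apply: eq_integral => s _.
rewrite /fubini_G patchE; case: ifPn => sp.
  have fsi : nu.-integrable setT (fun w => (f (w, s))%:E).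
    apply: measurable_bounded_integrable.
    - exact: measurableT.
    - exact: nu_setT_fin.
    - by apply: (measurableT_comp mf); exact: measurable_pair2.
    - by exists M; split; [exact: num_real|move=> x Mx w _; apply: le_trans (fM _) (ltW Mx)].
  rewrite fineK; last by apply: integrable_fin_num.
  apply: eq_integral => w _; rewrite patchE mem_set//.
  by split => //; exact: set_mem.
rewrite integral0_eq// => w _; rewrite patchE memNset//.
by move=> [_ /= sP]; move/negP : sp; apply; exact: mem_set.
Qed.

Lemma complex_fubini (F : phase -> R[i]) M : cmeasurable setT F ->
  cbounded setT F M ->
  cintegral base D F =
  cintegral leb period (fun s => cintegral nu setT (fun w => F (w, s))).
Proof.
move=> [Fr Fi] FM; apply: complex_ext => /=.
  apply: (@real_fubini _ M) => // z.
  by apply: le_trans (FM z I); exact: le_Re_normc.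
apply: (@real_fubini _ M) => // z.
by apply: le_trans (FM z I); exact: le_Im_normc.
Qed.

Lemma wave_orthogonality x y :
  cintegral base D (fun z : phase =>
    (density z.2)%:C * (wave z.1 z.2 x * (wave z.1 z.2 y)^*)) =
  ((x == y)%:R * density_mass R q)%:C.
Proof.
rewrite (@complex_fubini _ (density_bound R q *
    (root_q R q ^+ dist o x * root_q R q ^+ dist o y))).
- rewrite -integral_density_spherical; apply: eq_cintegral => s _.
  by rewrite -(cintegralZ _ _ (cintegrable_wave_pair nu s x y)).
- apply: cmeasurableM.
    apply: cmeasurable_real; apply: measurableT_comp (measurable_density X) _.
    exact: measurable_snd.
  apply: cmeasurableM; first by apply: cmeasurable_wave; [exact: measurable_fst|exact: measurable_snd].
  by apply: cmeasurable_conj; apply: cmeasurable_wave; [exact: measurable_fst|exact: measurable_snd].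
- move=> z _; rewrite !normcM normcR normc_conj.
  rewrite ger0_norm; last exact: (density_ge0 X).
  apply: ler_pM; [exact: (density_ge0 X)|by rewrite mulr_ge0 ?normc_ge0|
    exact: (density_le X)|].
  by apply: ler_pM; rewrite ?normc_ge0 ?normc_wave_le.
Qed.

End orthogonality.

(** * Completeness of the plane waves *)

Section step_approximation.
Context (R : realType).
Implicit Types (a t y : R).

Lemma bernoulli_ineq y n : -1 <= y -> 1 + n%:R * y <= (1 + y) ^+ n.
Proof.
move=> y1; elim: n => [|n IHn]; first by rewrite mul0r addr0.
rewrite exprS -natr1; apply: (@le_trans _ _ ((1 + y) * (1 + n%:R * y))).
  have n0 : 0 <= n%:R :> R by []; have := sqr_ge0 y; nra.
by rewrite ler_wpM2l//; lra.
Qed.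

(** By Bernoulli the product is at most (1 - y^2)^n. It serves as the bound 1/(1 + n y) for (1 -
    y)^n. *)
Lemma onem_expr_le y n : 0 <= y <= 1 -> (1 - y) ^+ n * (1 + n%:R * y) <= 1.
Proof.
move=> /andP[y0 y1]; have n0 : 0 <= n%:R :> R by [].
apply: (@le_trans _ _ ((1 - y) ^+ n * (1 + y) ^+ n)).
  by rewrite ler_wpM2l ?exprn_ge0 ?subr_ge0// bernoulli_ineq//; lra.
by rewrite -exprMn exprn_ile1//; nra.
Qed.

(** An affine map that takes the value 1/2 slightly to the left of [a], at distance 1/(m+1).
    Dividing by 8 keeps it within [0, 1], because the numerator lies between -2 and 3. *)
Definition step_arg a (m : nat) t : R := 2^-1 + (t - a + m.+1%:R^-1) / 8.

(* On either side of the threshold [1/2], [(1 - x ^ n) ^ (2 ^ n)] tends to [1] or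
   to [0]; the threshold is approached from below slowly enough to get the limit
   [0] at [t = a] as well. *)
Definition step_poly a (m : nat) t : R :=
  (1 - step_arg a m t ^+ (m.+1 ^ 2)) ^+ (2 ^ (m.+1 ^ 2)).

Let inv_itv (m : nat) : 0 < (m.+1%:R^-1 : R) <= 1.
Proof. by rewrite invr_gt0 ltr0n/= invf_le1 ?ltr0n// ler1n. Qed.

Lemma step_arg_itv a m t : -1 <= a <= 1 -> -1 <= t <= 1 -> 0 <= step_arg a m t <= 1.
Proof. by have := inv_itv m; rewrite /step_arg; move: (m.+1%:R^-1) => i; lra. Qed.

Lemma step_poly_itv a m t : -1 <= a <= 1 -> -1 <= t <= 1 -> 0 <= step_poly a m t <= 1.
Proof.
move=> a1 t1; have /andP[x0 x1] := step_arg_itv m a1 t1.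
have y1 : 0 <= 1 - step_arg a m t ^+ (m.+1 ^ 2) <= 1.
  rewrite subr_ge0 exprn_ile1//= gerBl exprn_ge0//.
case/andP: y1 => y0 y1.
by rewrite exprn_ge0//= exprn_ile1.
Qed.

(** Here twice the argument exceeds 1 by at least 1/(4(m+1)), and the exponent (m+1)^2 makes its
    power at least 1 + (m+1)/4. The bound follows from [onem_expr_le] with 2^n in place of n. *)
Lemma step_poly_ge a m t : -1 <= a <= 1 -> -1 <= t <= 1 -> a <= t ->
  step_poly a m t <= 4 / m.+1%:R.
Proof.
move=> a1 t1 at_; have /andP[x0 x1] := step_arg_itv m a1 t1.
have /andP[i0 i1] := inv_itv m.
set n := (m.+1 ^ 2)%N; set x := step_arg a m t.
have xn : 0 <= x ^+ n <= 1 by rewrite exprn_ge0//= exprn_ile1.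
have := onem_expr_le (2 ^ n) xn; rewrite natrX -exprMn -/(step_poly a m t) => h.
have x2 : 1 + m.+1%:R^-1 / 4 <= 2 * x.
  by rewrite /x /step_arg; move: (m.+1%:R^-1) i0 i1 => i i0 i1; lra.
have g : 1 + m.+1%:R / 4 <= (2 * x) ^+ n.
  apply: (@le_trans _ _ ((1 + m.+1%:R^-1 / 4) ^+ n)).
    have -> : m.+1%:R / 4 = n%:R * (m.+1%:R^-1 / 4) :> R.
      have : m.+1%:R != 0 :> R by rewrite pnatr_eq0.
      by rewrite /n natrX; move: (m.+1%:R) => k k0; field.
    by apply: bernoulli_ineq; move: (m.+1%:R^-1) i0 => i i0; lra.
  rewrite lerXn2r// ?nnegrE; move: (m.+1%:R^-1) i0 x2 => i i0 x2; lra.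
have m0 : 0 < m.+1%:R :> R by rewrite ltr0n.
rewrite ler_pdivlMr//; have /andP[p0 _] := step_poly_itv m a1 t1.
move: h; rewrite /step_poly -/n -/x in p0 *; nra.
Qed.

(** By Bernoulli the left-hand side is at most (2x)^n. The assumption on [m] keeps 2x below 1 - e
    with e = (a - t)/8, and (1 - e)^n is at most 1/(1 + n e) with n = (m+1)^2. *)
Lemma step_poly_lt a m t : -1 <= a <= 1 -> -1 <= t <= 1 ->
  m.+1%:R^-1 <= (a - t) / 2 ->
  1 - step_poly a m t <= 8 / (a - t) / m.+1%:R.
Proof.
move=> a1 t1 mat_; have /andP[x0 x1] := step_arg_itv m a1 t1.
have /andP[i0 i1] := inv_itv m.
set n := (m.+1 ^ 2)%N; set x := step_arg a m t.
have e0 : 0 < (a - t) / 8 <= 1.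
  by move: (m.+1%:R^-1) i0 mat_ => i i0 mat_; lra.
have [e eE] : exists e, e = (a - t) / 8 by exists ((a - t) / 8).
rewrite -eE in e0.
have /andP[xn0 xn1] : 0 <= x ^+ n <= 1 by rewrite exprn_ge0//= exprn_ile1.
have h1 : 1 - (2 * x) ^+ n <= step_poly a m t.
  have := @bernoulli_ineq (- x ^+ n) (2 ^ n).
  by rewrite natrX mulrN -exprMn; apply; lra.
have x2 : 2 * x <= 1 - e.
  by rewrite /x /step_arg eE; move: (m.+1%:R^-1) mat_ => i mat_; lra.
have h2 : (2 * x) ^+ n <= (1 - e) ^+ n.
  by apply: lerXn2r; rewrite ?nnegrE ?mulr_ge0 ?subr_ge0//; case/andP: e0.
have e01 : 0 <= e <= 1 by case/andP: e0 => /ltW -> ->.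
have h3 := onem_expr_le n e01.
have m1 : 1 <= m.+1%:R :> R by rewrite ler1n.
have nm : n%:R = m.+1%:R ^+ 2 :> R by rewrite /n natrX.
have -> : 8 / (a - t) = e^-1 by rewrite eE invfM invrK mulrC.
have e00 : 0 < e by case/andP: e0.
rewrite ler_pdivlMr ?(lt_le_trans ltr01)// -[leRHS]mul1r ler_pdivlMr//.
have p0 : 0 <= (1 - e) ^+ n by rewrite exprn_ge0//; lra.
rewrite nm in h3; move: ((1 - e) ^+ n) h2 h3 p0 => P h2 h3 p0.
have h4 : 1 - step_poly a m t <= P by lra.
have h5 : P * (m.+1%:R * e) <= 1.
  apply: le_trans h3; rewrite ler_wpM2l//.
  move: (m.+1%:R) m1 => M m1.
  have : 0 <= M * (M - 1) * e 
    by apply: mulr_ge0 (ltW e00); apply: mulr_ge0; rewrite ?subr_ge0// (le_trans ler01).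
  by rewrite expr2; lra.
have me0 : 0 <= m.+1%:R * e by rewrite mulr_ge0 ?ltW.
nra.
Qed.

Lemma step_poly_cvg a t : -1 <= a <= 1 -> -1 <= t <= 1 ->
  step_poly a m t @[m --> \oo] --> ((t < a)%R%:R : R).
Proof.
move=> a1 t1; have harm : (m.+1%:R^-1 : R) @[m --> \oo] --> (0 : R) by exact: cvg_harmonic.
have [ta|at_] := ltP t a.
  apply/cvgrPdist_le => e e0.
  (* The first entry meets the assumption of [step_poly_lt], the second brings its bound below
     [e]. *)
  pose d := Num.min ((a - t) / 2) (e * (a - t) / 8).
  have d0 : 0 < d by rewrite lt_min !divr_gt0 ?mulr_gt0 ?subr_gt0.
  move/cvgrPdist_le : harm => /(_ _ d0); apply: filterS => m.
  rewrite sub0r normrN ger0_norm ?invr_ge0// le_min => /andP[h1 h2].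
  have /andP[p0 p1] := step_poly_itv m a1 t1.
  rewrite ger0_norm ?subr_ge0//; apply: le_trans (step_poly_lt a1 t1 h1) _.
  have at0 : 0 < a - t by rewrite subr_gt0.
  rewrite mulrAC ler_pdivrMr//; move: (m.+1%:R^-1) h2 => i h2; lra.
apply/cvgrPdist_le => e e0; have d0 : 0 < e / 4 by rewrite divr_gt0.
move/cvgrPdist_le : harm => /(_ _ d0); apply: filterS => m.
rewrite sub0r normrN ger0_norm ?invr_ge0// => h.
have /andP[p0 p1] := step_poly_itv m a1 t1.
rewrite sub0r normrN ger0_norm//; apply: le_trans (step_poly_ge m a1 t1 at_) _.
move: (m.+1%:R^-1) h => i h; lra.
Qed.

End step_approximation.

(** * Closure under bounded limits and its multipliers *)

Section bounded_closure.
Context (R : realType) (T : Type) (D : set T) (V : set (T -> R[i])).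
Implicit Types (g h phi : T -> R[i]) (M : R).

Definition bounded_on g := exists M, forall t, D t -> normc (g t) <= M.

Hypothesis V_bounded : forall g, V g -> bounded_on g.
Hypothesis VD : forall g h, V g -> V h -> V (fun t => g t + h t).
Hypothesis VZ : forall (a : R[i]) g, V g -> V (fun t => a * g t).

(** Limits of limits need not be limits of members of [V], so the closure is an inductive predicate
    rather than a set of sequential limits. *)
Inductive bclosure : (T -> R[i]) -> Prop :=
| bclosure_in g : V g -> bclosure g
| bclosure_lim (u : nat -> T -> R[i]) g M : (forall n, bclosure (u n)) ->
    (forall n t, D t -> normc (u n t) <= M) ->
    (forall t, D t -> u n t @[n --> \oo] --> g t) -> bclosure g.

Lemma cvg_normc (u : nat -> R[i]) l : u n @[n --> \oo] --> l ->
  normc (u n) @[n --> \oo] --> normc l.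
Proof. by move=> /cvg_norm /cvg_complexP[]. Qed.

Lemma bclosure_bounded g : bclosure g -> bounded_on g.
Proof.
case=> [h /V_bounded//|u h M _ uM uh]; exists M => t Dt.
by apply: (cvgr_to_le (cvg_normc (uh t Dt))); apply: nearW => n; exact: uM.
Qed.

(** Convergence is asked on [D] only, so a constant sequence changes the values off [D] at will. *)
Lemma bclosure_ext g h : (forall t, D t -> g t = h t) -> bclosure g -> bclosure h.
Proof.
move=> gh gc; have [M gM] := bclosure_bounded gc.
apply: (@bclosure_lim (fun=> g) h M) => // t Dt.
by rewrite -gh//; exact: cvg_cst.
Qed.

Lemma bclosureD g h : bclosure g -> bclosure h -> bclosure (fun t => g t + h t).
Proof.
(* Induction on one summand with the other fixed. It is used twice: for an arbitrary fixed [g], and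
   then, with the roles exchanged, for a fixed member of [V]. *)
have step v k : bounded_on v -> (forall w, V w -> bclosure (fun t => v t + w t)) ->
    bclosure k -> bclosure (fun t => v t + k t).
  move=> [B vB] Vv; elim=> [w /Vv//|u w M _ IH uM uw].
  apply: (@bclosure_lim (fun n t => v t + u n t) (fun t => v t + w t) (B + M)).
  - exact: IH.
  - move=> n t Dt.
    by apply: le_trans (le_normcD _ _) _; rewrite lerD ?vB ?uM.
  - by move=> t Dt; apply: cvgD; [exact: cvg_cst|exact: uw].
move=> gc hc; apply: (step _ _ (bclosure_bounded gc)) => // w Vw.
apply: (bclosure_ext (g := fun t => w t + g t)) => [t _|]; first exact: addrC.
apply: (step _ _ (V_bounded Vw)) => // v Vv.
by apply: bclosure_in; exact: VD.
Qed.

(** [V] need not be stable under products, while multipliers compose; they take the place of the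
    algebra required by monotone class arguments. *)
Definition multiplier phi := forall g, bclosure g -> bclosure (fun t => phi t * g t).

Lemma bclosureM phi : bounded_on phi ->
  (forall g, V g -> bclosure (fun t => phi t * g t)) -> multiplier phi.
Proof.
move=> [B phiB] Vphi g; elim=> [h /Vphi//|u h M _ IH uM uh].
apply: (@bclosure_lim (fun n t => phi t * u n t) (fun t => phi t * h t) (B * M)).
- exact: IH.
- move=> n t Dt; rewrite normcM.
  by apply: ler_pM; [exact: normc_ge0|exact: normc_ge0|exact: phiB|exact: uM].
- by move=> t Dt; apply: cvgMr; exact: uh.
Qed.

Lemma multiplier_cst (a : R[i]) : multiplier (fun=> a).
Proof.
apply: bclosureM; first by exists (normc a).
by move=> g Vg; apply: bclosure_in; exact: VZ.
Qed.

Lemma multiplierD phi psi : multiplier phi -> multiplier psi ->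
  multiplier (fun t => phi t + psi t).
Proof.
move=> mphi mpsi g gc; have := bclosureD (mphi _ gc) (mpsi _ gc).
by apply: bclosure_ext => t _; rewrite mulrDl.
Qed.

Lemma multiplierM phi psi : multiplier phi -> multiplier psi ->
  multiplier (fun t => phi t * psi t).
Proof.
move=> mphi mpsi g gc; have := mphi _ (mpsi _ gc).
by apply: bclosure_ext => t _; rewrite mulrA.
Qed.

Lemma multiplierX phi n : multiplier phi -> multiplier (fun t => phi t ^+ n).
Proof.
move=> mphi; elim: n => [|n IHn]; first exact: multiplier_cst.
by under eq_fun do rewrite exprS; exact: multiplierM.
Qed.

Lemma multiplier_ext phi psi : (forall t, D t -> phi t = psi t) ->
  multiplier phi -> multiplier psi.
Proof.
move=> e mphi g gc; have := mphi _ gc.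
by apply: bclosure_ext => t Dt; rewrite e.
Qed.

Lemma multiplier_lim (u : nat -> T -> R[i]) phi M : (forall n, multiplier (u n)) ->
  (forall n t, D t -> normc (u n t) <= M) ->
  (forall t, D t -> u n t @[n --> \oo] --> phi t) -> multiplier phi.
Proof.
move=> um uM uphi g gc; have [B gB] := bclosure_bounded gc.
apply: (@bclosure_lim (fun n t => u n t * g t) (fun t => phi t * g t) (M * B)).
- by move=> n; exact: um.
- move=> n t Dt; rewrite normcM.
  by apply: ler_pM; [exact: normc_ge0|exact: normc_ge0|exact: uM|exact: gB].
- by move=> t Dt; apply: cvgMl; exact: uphi.
Qed.

(* [phi \o f] is a multiplier for all bounded measurable [phi] as soon as it is
   one for the indicators of a generating pi-system. *)
Lemma multiplier_measurable d (S : measurableType d) (f : T -> S) (G : set (set S)) :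
  setI_closed G -> d.-measurable = <<s G >> ->
  (forall A, G A -> multiplier (fun t => (\1_A (f t) : R)%:C)) ->
  forall (phi : S -> R) M, measurable_fun setT phi -> (forall s, `|phi s| <= M) ->
  multiplier (fun t => (phi (f t))%:C).
Proof.
move=> GI GE HG phi M mphi phiM.
apply: (@functional_monotone_class _ _ _ G
  [set phi : S -> R | multiplier (fun t => (phi (f t))%:C)] GI GE _ _ _ _ _ _ M) => //=.
- exact: multiplier_cst.
- move=> k l mk ml; apply: multiplier_ext (multiplierD mk ml) => t _.
  by rewrite rmorphD.
- move=> a k mk; apply: multiplier_ext (multiplierM (multiplier_cst a%:C) mk) => t _.
  by rewrite rmorphM.
- move=> u k B um uB uk; apply: (@multiplier_lim (fun n t => (u n (f t))%:C) _ B) => //.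
    by move=> n t _; rewrite normcR.
  move=> t _; apply/cvg_complexP; split => /=; [exact: uk|exact: cvg_cst].
Qed.

End bounded_closure.

(** * Bounded measurable functions as iterated limits of wave combinations *)

Section wave_closure.
Context (R : realType) (q : nat) (X : homogeneous_tree q) (o : X).
Context (nu : probability (boundary o) R).
Hypothesis nuP : is_boundary_measure nu.
Implicit Types (x y p : X).

Notation phase := (boundary o * measurableTypeR R)%type.
Notation D := (@phase_space R q X o).
Notation period := (`[0, tau R q]%classic : set R).
Notation ang := (@angle R q).

(** The waves are conjugated because the coefficients of a function are its integrals against
    conjugate waves. Distinct vertices make [plancherel_finite] applicable; sums therefore merge
    coefficients in [wave_span_add1]. *)
Definition wave_span (g : phase -> R[i]) : Prop :=
  exists (l : seq X) (c : X -> R[i]),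
    uniq l /\ g = fun z => \sum_(y <- l) c y * (wave z.1 z.2 y)^*.

Let cwave y (z : phase) : R[i] := (wave z.1 z.2 y)^*.

Lemma wave_span0 : wave_span (fun=> 0).
Proof.
exists [::], (fun=> 0); split => //.
by apply/funext => z; rewrite big_nil.
Qed.

Lemma wave_span_add1 (a : R[i]) y g : wave_span g ->
  wave_span (fun z => a * cwave y z + g z).
Proof.
move=> [l [c [ul ->]]]; have [yl|yl] := boolP (y \in l).
  exists l, (fun x => if x == y then a + c x else c x); split => //.
  apply/funext => z; rewrite (bigD1_seq y)//= [RHS](bigD1_seq y)//= eqxx.
  rewrite mulrDl addrA; congr (_ + _).
  by apply: eq_bigr => x /negbTE ->.
exists (y :: l), (fun x => if x == y then a else c x); split; first by rewrite /= yl.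
apply/funext => z; rewrite big_cons eqxx; congr (_ + _).
apply: eq_big_seq => x xl; rewrite ifN_eq//.
by apply: contraNneq yl => <-.
Qed.

Lemma wave_span_sum (l : seq X) (c : X -> R[i]) :
  wave_span (fun z => \sum_(y <- l) c y * cwave y z).
Proof.
elim: l => [|y l IHl].
  by under eq_fun do rewrite big_nil; exact: wave_span0.
by under eq_fun do rewrite big_cons; exact: wave_span_add1.
Qed.

Lemma wave_spanD g h : wave_span g -> wave_span h -> wave_span (fun z => g z + h z).
Proof.
move=> [l [c [_ ->]]] sh; elim: l => [|y l IHl].
  by under eq_fun do rewrite big_nil add0r.
by under eq_fun do rewrite big_cons -addrA; exact: wave_span_add1.
Qed.

Lemma wave_spanZ (a : R[i]) g : wave_span g -> wave_span (fun z => a * g z).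
Proof.
move=> [l [c [ul ->]]]; exists l, (fun y => a * c y); split => //.
by apply/funext => z; rewrite mulr_sumr; apply: eq_bigr => y _; rewrite mulrA.
Qed.

Lemma wave_span_cwave y : wave_span (cwave y).
Proof.
have := wave_span_add1 1 y wave_span0.
by congr wave_span; apply/funext => z; rewrite addr0 mul1r.
Qed.

Lemma wave_span_bounded g : wave_span g -> bounded_on D g.
Proof.
move=> [l [c [_ ->]]]; elim: l => [|y l [M IHl]].
  by exists 0 => z _; rewrite big_nil normc0.
exists (normc (c y) * root_q R q ^+ dist o y + M) => z Dz; rewrite big_cons.
apply: le_trans (le_normcD _ _) _; apply: lerD; last exact: IHl.
by rewrite normcM normc_conj ler_wpM2l ?normc_ge0// normc_wave_le.
Qed.

Notation bcl := (bclosure D wave_span).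
Notation mult := (multiplier D wave_span).

Let bclD := bclosureD wave_span_bounded wave_spanD.
Let multD := multiplierD wave_span_bounded wave_spanD.
Let multM := @multiplierM _ _ _ _ wave_span_bounded.
Let mult_cst := @multiplier_cst _ _ D _ wave_spanZ.
Let mult_ext := @multiplier_ext _ _ _ _ wave_span_bounded.
Let mult_lim := @multiplier_lim _ _ _ _ wave_span_bounded.
Let multX := @multiplierX _ _ _ _ wave_span_bounded wave_spanZ.

(** Solving the eigenvalue relation [sum_neighbors_wave] for the cosine shows that multiplication by
    it maps the span to itself. *)
Lemma mult_cos : mult (fun z => (cos (ang z.2))%:C).
Proof.
have r0 := root_q_gt0 R X.
apply: bclosureM; first by exists 1 => z _; rewrite normcR ler_norml cos_geN1 cos_le1.
move=> g [l [c [ul ->]]]; apply: bclosure_in.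
have main y : wave_span (fun z => (cos (ang z.2))%:C * cwave y z).
  have [s us [ss sE]] := adj_degree y.
  have := wave_span_sum s (fun=> (2 * root_q R q)^-1%:C).
  congr wave_span; apply/funext => z; rewrite -mulr_sumr /cwave -conj_sum.
  rewrite (sum_neighbors_wave _ _ us ss sE) conjM conjR mulrA -real_complexM.
  by congr (_%:C * _); field; rewrite gt_eqF.
elim: l {ul} => [|y l IHl].
  by under eq_fun do rewrite big_nil mulr0; exact: wave_span0.
under eq_fun do rewrite big_cons mulrDr; apply: wave_spanD => //.
by under eq_fun do rewrite mulrCA; apply: wave_spanZ; exact: main.
Qed.

Let rmult (phi : phase -> R) := mult (fun z => (phi z)%:C).

Let rmultD phi psi : rmult phi -> rmult psi -> rmult (fun z => phi z + psi z).
Proof.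
by move=> m1 m2; apply: mult_ext (multD m1 m2) => z _; rewrite rmorphD.
Qed.

Let rmultM phi psi : rmult phi -> rmult psi -> rmult (fun z => phi z * psi z).
Proof.
by move=> m1 m2; apply: mult_ext (multM m1 m2) => z _; rewrite rmorphM.
Qed.

Let rmultX phi n : rmult phi -> rmult (fun z => phi z ^+ n).
Proof. by move=> m1; apply: mult_ext (multX n m1) => z _; rewrite rmorphXn. Qed.

Let rmult_cst (r : R) : rmult (fun=> r).
Proof. exact: mult_cst. Qed.

Lemma mult_step_poly a m : rmult (fun z => step_poly a m (cos (ang z.2))).
Proof.
apply: rmultX.
have -> : (fun z : phase => 1 - step_arg a m (cos (ang z.2)) ^+ (m.+1 ^ 2)) =
    (fun z => 1 + -1 * step_arg a m (cos (ang z.2)) ^+ (m.+1 ^ 2)).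
  by apply/funext => z; rewrite mulN1r.
apply: rmultD; first exact: rmult_cst.
apply: rmultM; first exact: rmult_cst.
apply: rmultX; apply: rmultD; first exact: rmult_cst.
apply: rmultM; last exact: rmult_cst.
apply: rmultD; last exact: rmult_cst.
by apply: rmultD; [exact: mult_cos|exact: rmult_cst].
Qed.

Lemma mult_cos_lt a : -1 <= a <= 1 -> rmult (fun z => (cos (ang z.2) < a)%R%:R).
Proof.
move=> a1; have c1 (z : phase) : -1 <= cos (ang z.2) <= 1 by rewrite cos_geN1 cos_le1.
apply: (@mult_lim (fun m z => (step_poly a m (cos (ang z.2)))%:C) _ 1).
- by move=> m; exact: mult_step_poly.
- move=> m z _; rewrite normcR; have /andP[p0 p1] := step_poly_itv m a1 (c1 z).
  by rewrite ger0_norm.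
- move=> z _; apply/cvg_complexP; split; last exact: cvg_cst.
  exact: step_poly_cvg.
Qed.

(** On the period the angle runs through [0, pi], where the cosine decreases, so [c < s] is a
    sublevel set of the cosine. For [c] outside the period the indicator is constant on the phase
    space. *)
Lemma mult_ray (c : R) : rmult (fun z => \1_(`]c, +oo[%classic : set R) z.2).
Proof.
have l0 := lnq_gt0 R X.
have [c0|c0] := ltP c 0.
  apply: mult_ext (rmult_cst 1) => z [_ /=]; rewrite in_itv/= => /andP[z0 _].
  by rewrite indicE mem_set// /= in_itv/= (lt_le_trans c0).
have [ct|ct] := leP c (tau R q); last first.
  apply: mult_ext (rmult_cst 0) => z [_ /=]; rewrite in_itv/= => /andP[_ zt].
  by rewrite indicE memNset// /= in_itv/= andbT => /(lt_trans ct); rewrite ltNge zt.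
have ca : -1 <= cos (ang c) <= 1 by rewrite cos_geN1 cos_le1.
apply: mult_ext (mult_cos_lt ca) => z [_ zp].
have cp : period c by rewrite /= in_itv/= c0.
rewrite ltr_cos; last 2 first.
- by rewrite in_itv/=; exact: (angle_itv X cp).
- by rewrite in_itv/=; exact: (angle_itv X zp).
rewrite /angle ltr_pM2r// indicE.
have -> : (z.2 \in (`]c, +oo[%classic : set R)) = (c < z.2) => //.
apply/idP/idP => [/set_mem|h]; first by rewrite /= in_itv/= andbT.
by apply/mem_set; rewrite /= in_itv/= andbT.
Qed.

Lemma mult_snd (phi : measurableTypeR R -> R) M : measurable_fun setT phi ->
  (forall s, `|phi s| <= M) -> rmult (fun z => phi z.2).
Proof.
apply: (multiplier_measurable wave_span_bounded wave_spanD wave_spanZ (f := snd)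
  (G := @RGenOInfty.G R)).
- move=> _ _ [a ->] [b ->]; exists (Num.max a b).
  apply/seteqP; split => s /=; rewrite !in_itv/= !andbT gt_max.
    by move=> [-> ->].
  by move=> /andP[].
- exact: RGenOInfty.measurableE.
- by move=> _ [a ->]; exact: mult_ray.
Qed.

Lemma mult_snd_complex (psi : measurableTypeR R -> R[i]) M :
  cmeasurable setT psi -> cbounded setT psi M -> mult (fun z => psi z.2).
Proof.
move=> [mr mi] psiM; have mre : rmult (fun z => complex.Re (psi z.2)).
  apply: (@mult_snd (fun s => complex.Re (psi s)) M) => // s.
  exact: le_trans (le_Re_normc _) (psiM s I).
have mim : rmult (fun z => complex.Im (psi z.2)).
  apply: (@mult_snd (fun s => complex.Im (psi s)) M) => // s.
  exact: le_trans (le_Im_normc _) (psiM s I).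
apply: mult_ext (multD mre (multM (mult_cst 'i%C) mim)) => z _.
by rewrite [RHS]complexE.
Qed.

Lemma mult_zeta : mult (fun z => zeta q z.2).
Proof.
apply: (@mult_snd_complex (zeta q) (root_q R q)); first exact: (cmeasurable_zeta X).
by move=> s _; rewrite (normc_zeta X).
Qed.

Lemma mult_zetaV : mult (fun z => (zeta q z.2)^-1).
Proof.
apply: (@mult_snd_complex (fun s => (zeta q s)^-1) (root_q R q)^-1).
  exact: (cmeasurable_zetaV X).
by move=> s _; rewrite normcV (normc_zeta X).
Qed.

Lemma mult_conj_zetaV : mult (fun z => ((zeta q z.2)^*)^-1).
Proof.
apply: (@mult_snd_complex (fun s => ((zeta q s)^*)^-1) (root_q R q)^-1).
  under eq_fun do rewrite -conjV.
  by apply: cmeasurable_conj; exact: (cmeasurable_zetaV X).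
by move=> s _; rewrite normcV normc_conj (normc_zeta X).
Qed.

Lemma mult_denomV : rmult (fun z => (denom q (ang z.2))^-1).
Proof.
apply: (@mult_snd (fun s => (denom q (ang s))^-1) (q%:R + q%:R^-1 - 2)^-1).
  exact: (measurable_denomV X).
move=> s; rewrite ger0_norm; last by rewrite invr_ge0 ltW// (denom_gt0 X).
exact: (denomV_le X).
Qed.

(** It supplies a bounded inverse, in terms of [denom], for the factor in front of the indicator in
    [wave_child]. *)
Lemma zeta_subV_norm (s : R) : (zeta q s - (zeta q s)^-1) *
  (zeta q s - (zeta q s)^-1)^* = (denom q (ang s))%:C.
Proof.
have q0 : q%:R%:C != 0 :> R[i] by rewrite rmorph_nat pnatr_eq0 -lt0n (leq_trans _ (two_le_q X)).
have z0 := zeta_neq0 X s.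
rewrite conjB conjV (conj_zeta X) /denom.
have sq : zeta q s ^+ 2 + (q%:R%:C / zeta q s) ^+ 2 =
    q%:R%:C * (2 * cos (2 * ang s))%:C.
  rewrite -(conj_zeta X) (conj_zetaE X) (zetaE X) !exprMn !cisX.
  rewrite -rmorphXn /= (sqr_root_q R X) -mulrDr; congr (_ * _).
  by rewrite /cis mulrN cosN sinN; apply: complex_ext; rewrite ?cReD ?cImD /=; ring.
have -> : (q%:R + q%:R^-1 - 2 * cos (2 * ang s))%:C =
    q%:R%:C + q%:R%:C^-1 - (2 * cos (2 * ang s))%:C :> R[i].
  by rewrite rmorphB rmorphD fmorphV.
have -> : (2 * cos (2 * ang s))%:C =
    (zeta q s ^+ 2 + (q%:R%:C / zeta q s) ^+ 2) / q%:R%:C.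
  by rewrite sq mulrAC divff ?mul1r.
move: (zeta q s) (q%:R%:C) z0 q0 => z k z0 k0.
by field; rewrite ?z0 ?k0.
Qed.

Let thr y (z : phase) : R := through R y z.1.

(** In the conjugate of [wave_child], subtracting the parent's term leaves the indicator times the
    conjugates of zeta - 1/zeta and of the wave at [p]. On E(x) both are functions of [s] with
    bounded inverses, and [psi] is the product of these inverses. *)
Lemma bcl_through x : bcl (fun z => (thr x z)%:C).
Proof.
have [->|xo] := eqVneq x o.
  apply: bclosure_in; have := wave_span_cwave o; congr wave_span.
  apply/funext => z; rewrite /cwave wave_o conjC1 /thr throughE.
  by rewrite asboolT// passing_o.
have [p [xp e]] := parent_ex xo.
have bx := bclosure_in D (wave_span_cwave x).
have bp := bclosure_in D (wave_span_cwave p).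
pose psi (z : phase) := ((zeta q z.2 - (zeta q z.2)^-1) *
   ((denom q (ang z.2))^-1)%:C) * ((zeta q z.2)^*)^-1 ^+ dist o p.
have mpsi : mult psi.
  apply: multM; last exact: multX mult_conj_zetaV.
  apply: multM; last exact: mult_denomV.
  apply: mult_ext (multD mult_zeta (multM (mult_cst (-1)) mult_zetaV)) => z _.
  by rewrite mulN1r.
have bdiff := bclD bx (mult_cst (-1) (mult_conj_zetaV bp)).
have := mpsi _ bdiff; apply: (bclosure_ext wave_span_bounded) => z _.
rewrite /psi /cwave (wave_child z.1 z.2 xp e) conjD !conjM conjR conjV /thr throughE.
have z0 : (zeta q z.2)^* != 0 by rewrite conjC_eq0 (zeta_neq0 X).
case: asboolP => xz; last by rewrite mul0r addr0 mulN1r subrr mulr0.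
have px : (dist o p <= dist o x)%N by rewrite e.
have dpx : dist p x = 1%N.
  have := dist_adj_cases x xp; rewrite distxx dist_sym; lia.
have -> : (wave z.1 z.2 p)^* = (zeta q z.2)^* ^+ dist o p.
  by rewrite (wave_passing z.2 xz px) dpx expr1 e exprS mulrAC divff ?mul1r ?conjX// (zeta_neq0 X).
have d0 : (denom q (ang z.2))%:C != 0 :> R[i].
  by rewrite eq_complex /= eqxx andbT gt_eqF// (denom_gt0 X).
have dV : ((denom q (ang z.2))^-1)%:C = (denom q (ang z.2))%:C^-1 :> R[i].
  by rewrite fmorphV.
have nE := zeta_subV_norm z.2; rewrite dV -nE; rewrite -nE in d0.
have zn0 := expf_neq0 (dist o p) z0.
rewrite exprVn; move: d0; rewrite mulf_eq0 negb_or => /andP[d1 d2].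
have c1 : 1%:C = 1 :> R[i] by [].
rewrite c1; move: (zeta q z.2 - _) d1 d2 => d d1 d2.
move: (_ ^+ dist o p) zn0 => zn zn0; move: ((zeta q z.2)^*) z0 => zc z0.
by field; rewrite ?zn0 ?d1 ?d2 ?z0.
Qed.

Lemma throughI x y : (dist o x <= dist o y)%N ->
  (forall z, thr x z * thr y z = thr y z) \/ (forall z, thr x z * thr y z = 0).
Proof.
move=> /passingI[xy|xy]; [left|right] => z; rewrite /thr !throughE;
  case: asboolP => xz; case: asboolP => yz; rewrite ?mul1r ?mul0r//.
- by move: yz; rewrite -xy => -[].
- by have : (passing x `&` passing y) z.1 by []; rewrite xy.
Qed.

Lemma bcl_throughM x y : bcl (fun z => (thr x z * thr y z)%:C).
Proof.
wlog xy : x y / (dist o x <= dist o y)%N => [hw|].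
  have [/hw//|/ltnW/hw] := leqP (dist o x) (dist o y).
  by under eq_fun do rewrite mulrC.
have [e|e] := throughI xy.
  by under eq_fun do rewrite e; exact: bcl_through.
by under eq_fun do rewrite e; apply: bclosure_in; exact: wave_span0.
Qed.

(** Along the parents of [x], [wave_child] writes the wave through indicators with coefficients
    depending on [s]. Multiplying by one more indicator produces only products as in
    [bcl_throughM]. *)
Lemma bcl_through_wave y x : bcl (fun z => (thr y z)%:C * cwave x z).
Proof.
have [n] := ubnP (dist o x); elim: n x => // n IHn x; rewrite ltnS => xn.
have [->|xo] := eqVneq x o.
  have := bcl_through y; apply: (bclosure_ext wave_span_bounded) => z _.
  by rewrite /cwave wave_o conjC1 mulr1.
have [p [xp e]] := parent_ex xo.
have bp : bcl (fun z => (thr y z)%:C * cwave p z) by apply: IHn; rewrite -e.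
pose psi (s : measurableTypeR R) := (zeta q s - (zeta q s)^-1)^* * (zeta q s)^* ^+ dist o p.
have mpsi : mult (fun z => psi z.2).
  apply: (@mult_snd_complex psi ((root_q R q + (root_q R q)^-1) * root_q R q ^+ dist o p)).
    have mz : cmeasurable setT (fun s : measurableTypeR R => (zeta q s)^*).
      by apply: cmeasurable_conj; exact: (cmeasurable_zeta X).
    apply: cmeasurableM.
      apply: cmeasurable_conj; apply: cmeasurableD; first exact: (cmeasurable_zeta X).
      have -> : (fun s : measurableTypeR R => - (zeta q s)^-1) =
          (fun s => (-1) * (zeta q s)^-1) by apply/funext => s; rewrite mulN1r.
      by apply: cmeasurableM; [exact: cmeasurable_cst|exact: (cmeasurable_zetaV X)].
    elim: (dist o p) => [|k IHk]; first by under eq_fun do rewrite expr0; exact: cmeasurable_cst.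
    by under eq_fun do rewrite exprS; exact: cmeasurableM.
  move=> s _; rewrite normcM normc_conj; apply: ler_pM; rewrite ?normc_ge0//.
    by apply: le_trans (le_normcD _ _) _; rewrite normcN normcV (normc_zeta X).
  elim: (dist o p) => [|k IHk]; first by rewrite !expr0 normc1.
  by rewrite !exprS normcM normc_conj (normc_zeta X) ler_wpM2l// ltW// (root_q_gt0 R X).
have := bclD (mult_conj_zetaV bp) (mpsi _ (bcl_throughM y x)).
apply: (bclosure_ext wave_span_bounded) => z _.
rewrite /psi /cwave (wave_child z.1 z.2 xp e) [(_ * _ + _ * _)^*]conjD !conjM conjR.
rewrite conjV real_complexM.
rewrite /thr; have [xz|xz] := pselect (passing x z.1); last first.
  have -> : through R x z.1 = 0 by rewrite throughE asboolF.
  by rewrite !mulr0 !mul0r !addr0; ring.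
have px : (dist o p <= dist o x)%N by rewrite e.
have dpx : dist p x = 1%N.
  have := dist_adj_cases x xp; rewrite distxx dist_sym; lia.
have -> : (wave z.1 z.2 p)^* = (zeta q z.2)^* ^+ dist o p.
  by rewrite (wave_passing z.2 xz px) dpx expr1 e exprS mulrAC divff ?mul1r ?conjX// (zeta_neq0 X).
ring.
Qed.

Lemma mult_through y : rmult (thr y).
Proof.
apply: bclosureM.
  by exists 1 => z _; rewrite normcR /thr throughE; case: ifP; rewrite ?normr1 ?normr0.
move=> g [l [c [_ ->]]]; elim: l => [|x l IHl].
  under eq_fun do rewrite big_nil mulr0.
  by apply: bclosure_in; exact: wave_span0.
under eq_fun do rewrite big_cons mulrDr; apply: bclD => //.
under eq_fun do rewrite mulrCA.
by apply: (mult_cst (c x)); exact: bcl_through_wave.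
Qed.

Lemma mult_fst (phi : boundary o -> R) M : measurable_fun setT phi ->
  (forall w, `|phi w| <= M) -> rmult (fun z => phi z.1).
Proof.
(* The empty set is the intersection of two disjoint sets E(x) and makes this a pi-system. *)
pose G : set (set (boundary o)) := range (@passing _ _ o) `|` [set set0].
apply: (multiplier_measurable wave_span_bounded wave_spanD wave_spanZ (f := fst)
  (G := G)).
- move=> _ _ [[x _ <-]|->] [[y _ <-]|->]; rewrite ?setI0 ?set0I; try by right.
  wlog xy : x y / (dist o x <= dist o y)%N => [hw|].
    have [/hw//|/ltnW/hw] := leqP (dist o x) (dist o y); by rewrite setIC.
  by have [->|->] := passingI xy; [left; exists y|right].
- apply/seteqP; split.
    apply: smallest_sub; first exact: smallest_sigma_algebra.
    by move=> _ [x _ <-]; apply: sub_sigma_algebra; left; exists x.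
  apply: smallest_sub; first exact: sigma_algebra_measurable.
  by move=> _ [[x _ <-]|->]; [exact: measurable_passing|exact: measurable0].
- move=> _ [[x _ <-]|->]; first exact: mult_through.
  by apply: mult_ext (rmult_cst 0) => z _; rewrite indic0.
Qed.

Lemma bclosure_measurable (f : phase -> R) M : measurable_fun setT f ->
  (forall z, `|f z| <= M) -> bcl (fun z => (f z)%:C).
Proof.
move=> mf fM; pose G : set (set phase) :=
  [set A `*` B | A in measurable & B in measurable].
(* The wave at the root is the constant 1, so a multiplier applied to it lies in the closure. *)
suff m : rmult f.
  have := m _ (bclosure_in D (wave_span_cwave o)).
  by apply: (bclosure_ext wave_span_bounded) => z _; rewrite /cwave wave_o conjC1 mulr1.
move: mf fM; apply: (multiplier_measurable wave_span_bounded wave_spanD wave_spanZ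
  (f := id) (G := G)).
- move=> _ _ [A mA [B mB <-]] [A' mA' [B' mB' <-]].
  exists (A `&` A'); first exact: measurableI.
  by exists (B `&` B'); [exact: measurableI|rewrite setXI].
- exact: measurable_prod_measurableType.
- move=> _ [A mA [B mB <-]].
  have mA1 : rmult (fun z => \1_A z.1).
    apply: (@mult_fst \1_A 1); first exact: measurable_indic.
    by move=> w; rewrite indicE ger0_norm// lern1 leq_b1.
  have mB1 : rmult (fun z => \1_B z.2).
    apply: (@mult_snd \1_B 1); first exact: measurable_indic.
    by move=> w; rewrite indicE ger0_norm// lern1 leq_b1.
  apply: mult_ext (rmultM mA1 mB1) => z _.
  by rewrite !indicE in_setX -natrM mulnb.
Qed.

End wave_closure.

Lemma le_normc_sum (R : realType) I (l : seq I) (F : I -> R[i]) :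
  normc (\sum_(i <- l) F i) <= \sum_(i <- l) normc (F i).
Proof.
elim: l => [|i l IHl]; first by rewrite !big_nil normc0.
by rewrite !big_cons; apply: le_trans (le_normcD _ _) _; rewrite lerD2l.
Qed.

Lemma cmeasurable_sum d (T : measurableType d) (R : realType) (D : set T) I
    (l : seq I) (F : I -> T -> R[i]) :
  (forall i, cmeasurable D (F i)) -> cmeasurable D (fun t => \sum_(i <- l) F i t).
Proof.
move=> mF; elim: l => [|i l IHl].
  by under eq_fun do rewrite big_nil; exact: cmeasurable_cst.
by under eq_fun do rewrite big_cons; exact: cmeasurableD.
Qed.

(** * The integral estimate *)

Section l1_estimate.
Context (R : realType) (q : nat) (X : homogeneous_tree q) (o : X).
Context (nu : probability (boundary o) R).
Hypothesis nuP : is_boundary_measure nu.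

Notation phase := (boundary o * measurableTypeR R)%type.
Notation D := (@phase_space R q X o).
Notation base := (base_measure nu).
Notation kappa := (density_mass R q).

Let mD : measurable (D : set phase).
Proof. exact: measurable_phase_space. Qed.

Let rho (z : phase) : R := plancherel_density q z.2.
Let cwave y (z : phase) : R[i] := (wave z.1 z.2 y)^*.

Let rho_ge0 z : 0 <= rho z.
Proof. exact: (density_ge0 X). Qed.

Let rho_le z : rho z <= density_bound R q.
Proof. exact: (density_le X). Qed.

Lemma measurable_rho (E : set phase) : measurable_fun E rho.
Proof.
apply: measurable_funTS; apply: measurableT_comp (measurable_density X) _.
exact: measurable_snd.
Qed.

Lemma cmeasurable_cwave (E : set phase) y : cmeasurable E (cwave y).
Proof.
by apply: cmeasurable_conj; apply: cmeasurable_wave; apply: measurable_funTS;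
  [exact: measurable_fst|exact: measurable_snd].
Qed.

Lemma cwave_bounded y : cbounded D (cwave y) (root_q R q ^+ dist o y).
Proof. by move=> z _; rewrite normc_conj normc_wave_le. Qed.

Lemma rho_normcsq_integrable (g : phase -> R[i]) M : cmeasurable D g ->
  cbounded D g M -> base.-integrable D (fun z => (rho z * normc (g z) ^+ 2)%:E).
Proof.
move=> mg gM; apply: measurable_bounded_integrable => //.
- exact: base_phase_space_fin.
- by apply: measurable_funM; [exact: measurable_rho|exact: measurable_normcsq].
- exists (density_bound R q * M ^+ 2); split; first exact: num_real.
  move=> B MB z Dz; apply: le_trans (ltW MB).
  rewrite ger0_norm; last by rewrite mulr_ge0 ?sqr_ge0.
  apply: ler_pM; rewrite ?sqr_ge0//.
  by rewrite lerXn2r ?nnegrE ?normc_ge0 ?(le_trans (normc_ge0 _) (gM _ Dz))// gM.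
Qed.

Lemma cintegrable_rho_pair x y :
  cintegrable base D (fun z => (rho z)%:C * (cwave x z * (cwave y z)^*)).
Proof.
apply: (@cintegrable_bounded _ _ _ _ _ _ (density_bound R q *
    (root_q R q ^+ dist o x * root_q R q ^+ dist o y))) => //.
- exact: base_phase_space_fin.
- apply: cmeasurableM; first by apply: cmeasurable_real; exact: measurable_rho.
  by apply: cmeasurableM; [|apply: cmeasurable_conj]; exact: cmeasurable_cwave.
- move=> z Dz; rewrite !normcM normcR normc_conj ger0_norm//.
  apply: ler_pM => //; first by rewrite mulr_ge0 ?normc_ge0.
  by apply: ler_pM; rewrite ?normc_ge0 ?cwave_bounded.
Qed.

Lemma plancherel_finite (l : seq X) (c : X -> R[i]) : uniq l ->
  \int[base]_(z in D) (rho z * normc (\sum_(y <- l) c y * cwave y z) ^+ 2) =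
  kappa * \sum_(y <- l) normc (c y) ^+ 2.
Proof.
move=> ul; apply: complexI; rewrite -(cintegral_real _ mD).
transitivity (cintegral base D (fun z => \sum_(x <- l) \sum_(y <- l)
    c x * (c y)^* * ((rho z)%:C * (cwave x z * (cwave y z)^*)))).
  apply: eq_cintegral => z _; rewrite real_complexM -mulc_conj conj_sum.
  rewrite mulr_suml mulr_sumr; apply: eq_bigr => x _.
  rewrite mulr_sumr mulr_sumr; apply: eq_bigr => y _.
  by rewrite conjM; ring.
have i x y : cintegrable base D (fun z =>
    c x * (c y)^* * ((rho z)%:C * (cwave x z * (cwave y z)^*))).
  by apply: cintegrableZ => //; exact: cintegrable_rho_pair.
rewrite cintegral_sum//; last by move=> x; exact: cintegrable_sum.
rewrite mulr_sumr rmorph_sum; apply: eq_big_seq => x xl.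
rewrite cintegral_sum//.
have e y : cintegral base D (fun z =>
    c x * (c y)^* * ((rho z)%:C * (cwave x z * (cwave y z)^*))) =
    c x * (c y)^* * ((y == x)%:R * kappa)%:C.
  rewrite (cintegralZ mD _ (cintegrable_rho_pair x y)); congr (_ * _).
  rewrite -(wave_orthogonality nuP); apply: eq_cintegral => z _.
  by rewrite /cwave conjCK [in LHS](mulrC _^*).
under eq_bigr do rewrite e.
rewrite (bigD1_seq x)//= eqxx mul1r big1 ?addr0.
  by rewrite mulc_conj -real_complexM mulrC.
by move=> y yx; rewrite (negbTE yx) mul0r mulr0.
Qed.

Section estimate.
Context (F : phase -> R[i]) (M2 : R).
Hypothesis Fi : cintegrable base D F.

Definition wave_coef (y : X) : R[i] := cintegral base D (fun z => F z * cwave y z).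

Hypothesis coef_le : forall l : seq X, uniq l ->
  \sum_(y <- l) normc (wave_coef y) ^+ 2 <= M2.

Let kappa0 : 0 < kappa := density_mass_gt0 R X.

(** Cauchy-Schwarz in arithmetic-geometric form. By [plancherel_finite] the last factor is the sum
    of the squared coefficients when [g] is a combination of waves; written as an integral it makes
    sense for the limits too. *)
Let bound g := forall t, 0 < t ->
  normc (cintegral base D (fun z => F z * g z)) *+ 2 <=
  t * M2 + t^-1 * (kappa^-1 * \int[base]_(z in D) (rho z * normc (g z) ^+ 2)).

Lemma cintegrable_coef y : cintegrable base D (fun z => F z * cwave y z).
Proof.
by apply: cintegrableM_bounded => //; [exact: cmeasurable_cwave|exact: cwave_bounded].
Qed.

Lemma bound_wave_span g : wave_span g -> bound g.
Proof.
move=> [l [c [ul ->]]] t t0; rewrite plancherel_finite// mulKf ?gt_eqF//.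
have -> : cintegral base D (fun z => F z * (\sum_(y <- l) c y * cwave y z)) =
    \sum_(y <- l) c y * wave_coef y.
  transitivity (cintegral base D (fun z => \sum_(y <- l) c y * (F z * cwave y z))).
    apply: eq_cintegral => z _; rewrite mulr_sumr; apply: eq_bigr => y _.
    by rewrite mulrCA.
  rewrite cintegral_sum//; last by move=> y; apply: cintegrableZ => //; exact: cintegrable_coef.
  by apply: eq_bigr => y _; rewrite (cintegralZ mD _ (cintegrable_coef y)).
have young y : normc (c y * wave_coef y) *+ 2 <=
    t * normc (wave_coef y) ^+ 2 + t^-1 * normc (c y) ^+ 2.
  rewrite normcM; have := sqr_ge0 (t * normc (wave_coef y) - normc (c y)).
  move: (normc (wave_coef y)) (normc (c y)) => b a h.
  rewrite -subr_ge0 -(pmulr_rge0 _ t0).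
  rewrite (_ : t * (_ - _) = (t * b - a) ^+ 2)//.
  by rewrite -mulr_natr; field; rewrite gt_eqF.
apply: (@le_trans _ _ (\sum_(y <- l) normc (c y * wave_coef y) *+ 2)).
  by rewrite sumrMnl lerMn2r/= le_normc_sum.
apply: (le_trans (ler_sum _ (fun y _ => young y))).
rewrite big_split/= -!mulr_sumr lerD2r ler_wpM2l ?(ltW t0)//.
exact: coef_le.
Qed.

(** Both sides pass to bounded pointwise limits by dominated convergence: the left one because [F]
    is integrable, the right one because the density is bounded and the phase space has finite
    measure. Measurability is carried along since [bclosure] does not contain it. *)
Lemma bound_bclosure g : bclosure D (@wave_span R q X o) g -> cmeasurable D g /\ bound g.
Proof.
have mspan h : wave_span h -> cmeasurable D h.
  move=> [l [c [_ ->]]]; apply: cmeasurable_sum => y.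
  by apply: cmeasurableM; [exact: cmeasurable_cst|exact: cmeasurable_cwave].
elim=> [h sh|u h M uc IH uM uh]; first by split; [exact: mspan|exact: bound_wave_span].
have mun n : cmeasurable D (u n) by case: (IH n).
have [hi _] : cintegrable base D h /\
    cintegral base D (u n) @[n --> \oo] --> cintegral base D h.
  apply: (@cvg_cintegral _ _ _ _ _ mD u h (cst M)) => //.
  have : cintegrable base D (fun=> M%:C).
    apply: (@cintegrable_bounded _ _ _ _ _ _ `|M|) => //.
    - exact: base_phase_space_fin.
    - by move=> z _; rewrite normcR.
  by case.
have mh : cmeasurable D h := cintegrable_measurable hi.
split=> // t t0.
have Fb : base.-integrable D (fun z => (M * (`|complex.Re (F z)| + `|complex.Im (F z)|))%:E).
  by apply: real_integrableZ => //; exact: cintegrable_bound.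
have [_ limF] : cintegrable base D (fun z => F z * h z) /\
    cintegral base D (fun z => F z * u n z) @[n --> \oo] -->
    cintegral base D (fun z => F z * h z).
  apply: (@cvg_cintegral _ _ _ _ _ mD (fun n z => F z * u n z)
      (fun z => F z * h z)
      (fun z => M * (`|complex.Re (F z)| + `|complex.Im (F z)|))).
  - by move=> n; apply: cmeasurableM (mun n); exact: cintegrable_measurable Fi.
  - by move=> z Dz; apply: cvgMr; exact: uh.
  - exact: Fb.
  - move=> n z Dz; rewrite normcM mulrC; apply: ler_pM; rewrite ?normc_ge0 ?uM//.
    exact: normc_le_ReIm.
have [_ limu] : base.-integrable D (EFin \o (fun z => rho z * normc (h z) ^+ 2)) /\
   \int[base]_(z in D) (rho z * normc (u n z) ^+ 2) @[n --> \oo] -->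
   \int[base]_(z in D) (rho z * normc (h z) ^+ 2).
  apply: (@cvg_Rintegral _ _ _ _ _ mD (fun n z => rho z * normc (u n z) ^+ 2)
    (fun z => rho z * normc (h z) ^+ 2) (fun z => rho z * normc M%:C ^+ 2)).
  - move=> n; apply: measurable_funM; first exact: measurable_rho.
    exact: measurable_normcsq (mun n).
  - move=> z Dz; apply: cvgMr; have cn := cvg_normc (uh z Dz).
    by under eq_fun do rewrite expr2; rewrite expr2; exact: cvgM.
  - apply: (@rho_normcsq_integrable (fun=> M%:C) `|M|); first exact: cmeasurable_cst.
    by move=> z _; rewrite normcR.
  - move=> n z Dz; rewrite ger0_norm; last by rewrite mulr_ge0 ?sqr_ge0.
    rewrite ler_wpM2l// lerXn2r ?nnegrE ?normc_ge0// normcR.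
    exact: le_trans (uM n z Dz) (ler_norm M).
have limL : normc (cintegral base D (fun z => F z * u n z)) *+ 2 @[n --> \oo] -->
    normc (cintegral base D (fun z => F z * h z)) *+ 2.
  have c := cvg_normc limF.
  by under eq_fun do rewrite mulr2n; rewrite mulr2n; exact: cvgD.
have limR : t * M2 + t^-1 * (kappa^-1 * \int[base]_(z in D) (rho z * normc (u n z) ^+ 2))
    @[n --> \oo] -->
    t * M2 + t^-1 * (kappa^-1 * \int[base]_(z in D) (rho z * normc (h z) ^+ 2)).
  apply: cvgD; first exact: cvg_cst.
  by apply: cvgMr; apply: cvgMr; exact: limu.
by apply: (ler_cvg_to limL limR); apply: nearW => n; have [_] := IH n; exact.
Qed.

Lemma integral_rho : \int[base]_(z in D) rho z = kappa.
Proof.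
have := @plancherel_finite [:: o] (fun=> 1) isT.
rewrite big_seq1 normc1 expr1n mulr1 => <-; apply: eq_Rintegral => z _.
by rewrite big_seq1 mul1r /cwave wave_o conjC1 normc1 expr1n mulr1.
Qed.

(** It takes the values 1 and -1 and never 0, so its squared modulus is 1 and the integral in
    [bound] is exactly that of the density. *)
Let sign (A : set phase) (z : phase) : R := 2 * \1_A z - 1.

Let bound_sign (A : set phase) t : measurable A -> 0 < t ->
  normc (cintegral base D (fun z => F z * (sign A z)%:C)) *+ 2 <= t * M2 + t^-1.
Proof.
move=> mA t0; have sgn1 z : `|sign A z| = 1.
  rewrite /sign indicE; case: (_ \in _) => /=.
    by rewrite mulr1 (_ : 2 - 1 = 1) ?normr1//; ring.
  by rewrite mulr0 sub0r normrN normr1.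
have /bound_bclosure[_] : bclosure D (@wave_span R q X o) (fun z => (sign A z)%:C).
  apply: (@bclosure_measurable _ _ _ _ _ 1); last by move=> z; rewrite sgn1.
  apply: measurable_funB; last exact: measurable_cst.
  by apply: measurable_funM; [exact: measurable_cst|exact: measurable_indic].
move=> /(_ _ t0) /le_trans; apply; rewrite lerD2l -[leRHS]mulr1 ler_wpM2l//.
  by rewrite invr_ge0 ltW.
under eq_Rintegral do rewrite normcR sgn1 expr1n mulr1.
by rewrite integral_rho mulVf ?gt_eqF.
Qed.

Let nonneg_set (f : phase -> R) : set phase := D `&` f @^-1` `[0, +oo[%classic.

Let sign_norm (f : phase -> R) z : D z -> f z * sign (nonneg_set f) z = `|f z|.
Proof.
move=> Dz; rewrite /sign indicE; have [f0|f0] := leP 0 (f z).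
  rewrite mem_set; last by split => //=; rewrite in_itv/= f0.
  by rewrite ger0_norm// mulr1n; ring.
rewrite memNset; last by move=> [_ /=]; rewrite in_itv/= andbT leNgt f0.
by rewrite ltr0_norm// mulr0n; ring.
Qed.

Lemma l1_estimate t : 0 < t ->
  (\int[base]_(z in D) `|complex.Re (F z)|) *+ 2 <= t * M2 + t^-1 /\
  (\int[base]_(z in D) `|complex.Im (F z)|) *+ 2 <= t * M2 + t^-1.
Proof.
move=> t0; have [mr mi] := cintegrable_measurable Fi.
have mA (f : phase -> R) : measurable_fun D f -> measurable (nonneg_set f).
  by move=> mf; apply: mf => //; exact: measurable_itv.
split.
  apply: le_trans (bound_sign (mA _ mr) t0); rewrite lerMn2r; apply/orP; right.
  apply: (le_trans _ (le_Re_normc _)); apply: (le_trans _ (ler_norm _)).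
  rewrite le_eqVlt; apply/orP; left; apply/eqP; apply: eq_Rintegral => z /set_mem Dz.
  by rewrite cReM /= mulr0 subr0 (sign_norm (fun z => complex.Re (F z))).
apply: le_trans (bound_sign (mA _ mi) t0); rewrite lerMn2r; apply/orP; right.
apply: (le_trans _ (le_Im_normc _)); apply: (le_trans _ (ler_norm _)).
rewrite le_eqVlt; apply/orP; left; apply/eqP; apply: eq_Rintegral => z /set_mem Dz.
by rewrite cImM /= mulr0 add0r (sign_norm (fun z => complex.Im (F z))).
Qed.

End estimate.
End l1_estimate.

(** * Matrix entries and symbols *)

Section cintegral_series.
Context d (T : measurableType d) (R : realType).
Variables (mu : {measure set T -> \bar R}) (D : set T).
Hypothesis mD : measurable D.

Lemma ae_eq_cintegral (F G : T -> R[i]) :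
  cmeasurable D F -> cmeasurable D G -> {ae mu, forall t, D t -> F t = G t} ->
  cintegral mu D F = cintegral mu D G.
Proof.
move=> [Fr Fi] [Gr Gi] FG; rewrite /cintegral; congr Complex;
  rewrite /Rintegral; congr fine; apply: ae_eq_integral => //;
  try exact/measurable_EFinP.
- by apply: filterS FG => t e Dt; rewrite /= e.
- by apply: filterS FG => t e Dt; rewrite /= e.
Qed.

Lemma ae_eq0_cintegral (F : T -> R[i]) : cintegrable mu D F ->
  \int[mu]_(t in D) `|complex.Re (F t)| = 0 ->
  \int[mu]_(t in D) `|complex.Im (F t)| = 0 ->
  {ae mu, forall t, D t -> F t = 0}.
Proof.
move=> [Fr Fi]; have ae0 (f : T -> R) : mu.-integrable D (EFin \o f) ->
    \int[mu]_(t in D) `|f t| = 0 -> {ae mu, forall t, D t -> f t = 0}.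
  move=> fi f0; have mf := measurable_int mu fi.
  have /(ae_eq_integral_abs mu mD mf) : (\int[mu]_(t in D) `|(EFin \o f) t| = 0)%E.
    have : (\int[mu]_(t in D) `|f t|%:E)%E \is a fin_num.
      by apply: integrable_fin_num => //; exact: real_integrable_norm.
    by move=> /fineK <-; rewrite [fine _]f0.
  by apply: filterS => t e /e [].
move=> /(ae0 _ Fr) Fr0 /(ae0 _ Fi) Fi0; apply: filterS2 Fr0 Fi0 => t r i Dt.
by apply: complex_ext; rewrite ?r ?i.
Qed.

(* The limit is cut off outside the set where the dominating series is finite. *)
Lemma cintegral_series (u : nat -> T -> R[i]) (g : nat -> T -> R) (C : R) :
  (forall k, cmeasurable D (u k)) ->
  (forall k, mu.-integrable D (EFin \o g k)) ->
  (forall k t, D t -> normc (u k t) <= g k t) ->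
  (forall n, \sum_(0 <= k < n) \int[mu]_(t in D) g k t <= C) ->
  exists G : T -> R[i], [/\ cintegrable mu D G,
    {ae mu, forall t, D t -> has_sum (fun k => u k t) (G t)} &
    forall h M, cmeasurable D h -> cbounded D h M ->
      \sum_(0 <= k < n) cintegral mu D (fun t => u k t * h t) @[n --> \oo] -->
      cintegral mu D (fun t => G t * h t)].
Proof.
move=> mu_ gi ug gC.
have g0 k t : D t -> 0 <= g k t.
  by move=> Dt; apply: le_trans (ug k t Dt); exact: normc_ge0.
have mg k : measurable_fun D (EFin \o g k) by case/integrableP: (gi k).
pose s t := (\sum_(0 <= k <oo) (g k t)%:E)%E.
have s0 t : D t -> (0 <= s t)%E.
  by move=> Dt; apply: nneseries_ge0 => n _ _; rewrite lee_fin g0.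
have ms : measurable_fun D s.
  by apply: ge0_emeasurable_sum => [k t Dt _|k _]; [rewrite lee_fin g0|exact: mg].
have intg k : (\int[mu]_(t in D) (g k t)%:E = (\int[mu]_(t in D) g k t)%:E)%E.
  by rewrite /Rintegral fineK//; apply: integrable_fin_num mD _ (gi k).
have si : mu.-integrable D s.
  apply/integrableP; split=> //; apply: le_lt_trans (ltry C).
  rewrite (eq_integral s); last by move=> t /set_mem Dt; rewrite gee0_abs// s0.
  rewrite /s.
  rewrite (@integral_nneseries _ _ _ mu _ mD (fun k t => (g k t)%:E)); last 2 first.
  - by [].
  - by move=> k t Dt; rewrite lee_fin g0.
  apply: lime_le.
    by apply: is_cvg_nneseries => n _ _; apply: integral_ge0 => t Dt; rewrite lee_fin g0.
  apply: nearW => n; under eq_bigr do rewrite intg.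
  by rewrite sumEFin lee_fin.
pose E := D `&` [set t | (s t < +oo)%E].
have mE : measurable E by exact: emeasurable_fun_infty_o.
have aeE : {ae mu, forall t, D t -> E t}.
  apply: filterS (integrable_ae mD si) => t h Dt; split => //=.
  by rewrite -ge0_fin_numE ?s0// h.
have sumE t : E t -> forall n, \sum_(0 <= k < n) normc (u k t) <= fine (s t).
  move=> [Dt st] n; rewrite -lee_fin fineK ?ge0_fin_numE ?s0//.
  apply: le_trans (nneseries_lim_ge n _); last by move=> k _ _; rewrite lee_fin g0.
  by rewrite sumEFin lee_fin; apply: ler_sum => k _; exact: ug.
have idb : bijective (@id nat) by exists id.
have ex t : exists v, E t -> has_sum (fun k => u k t) v.
  have [Et|nE] := pselect (E t); last by exists 0.
  have [|v hv] := @ex_has_sum _ nat (fun k => u k t) (fine (s t)).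
    apply: (le_sum_enum idb) => // [k|n]; first exact: normc_ge0.
    exact: sumE.
  by exists v.
have [v vP] := choice ex.
pose G t : R[i] := (\1_E t)%:C * v t.
pose U n t : R[i] := (\1_E t)%:C * \sum_(0 <= k < n) u k t.
have mU n : cmeasurable D (U n).
  apply: cmeasurableM; last exact: cmeasurable_sum.
  by apply: cmeasurable_real; exact: measurable_indic.
have UG t : U n t @[n --> \oo] --> G t.
  rewrite /U /G indicE; case: (boolP (t \in E)) => [/set_mem Et|_].
    apply: cvgMr.
    exact: (has_sum_series idb (vP t Et)).
  by under eq_fun do rewrite mul0r; rewrite mul0r; exact: cvg_cst.
have lim h M : cmeasurable D h -> cbounded D h M ->
    cintegrable mu D (fun t => G t * h t) /\
    cintegral mu D (fun t => U n t * h t) @[n --> \oo] -->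
    cintegral mu D (fun t => G t * h t).
  move=> mh hM.
  apply: (@cvg_cintegral _ _ _ _ _ mD (fun n t => U n t * h t)
    (fun t => G t * h t) (fun t => M * fine (s t))).
  - by move=> n; exact: cmeasurableM.
  - by move=> t Dt; apply: cvgMl; exact: UG.
  - apply: real_integrableZ => //; apply: (le_integrable mD _ _ si).
      by apply/measurable_EFinP; apply: measurableT_comp ms; exact: fine_measurable.
    move=> t Dt /=; have := s0 t Dt; case: (s t) => [r _|_|//] /=; first by rewrite lexx.
    by rewrite normr0 leey.
  - move=> n t Dt; rewrite normcM mulrC; apply: ler_pM; rewrite ?normc_ge0 ?hM//.
    rewrite /U indicE; case: (boolP (t \in E)) => [/set_mem Et|_].
      by rewrite mul1r; apply: le_trans (le_normc_sum _ _) (sumE t Et n).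
    by rewrite mul0r normc0 fine_ge0// s0.
exists G; split.
- have [|i1 _] := lim (fun=> 1) 1 (cmeasurable_cst _ _).
    by move=> t _; rewrite normc1.
  by apply: eq_cintegrable i1 => // t _; rewrite mulr1.
- by apply: filterS aeE => t h /h Et; rewrite /G indicE mem_set// mul1r; exact: vP.
move=> h M mh hM; have [_] := lim h M mh hM.
have ui k : cintegrable mu D (fun t => u k t * h t).
  apply: (@cintegrableM_bounded _ _ _ _ _ mD _ _ M) => //.
  have [mr mi] := mu_ k; split; apply: (real_integrable_le mD _ (gi k)) => // t Dt.
    by apply: le_trans (le_Re_normc _) (ug k t Dt).
  by apply: le_trans (le_Im_normc _) (ug k t Dt).
rewrite (_ : (fun n => cintegral mu D (fun t => U n t * h t)) =
  fun n => \sum_(0 <= k < n) cintegral mu D (fun t => u k t * h t))//.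
apply/funext => n; rewrite -(cintegral_sum mD)//.
apply: ae_eq_cintegral; first exact: cmeasurableM.
  by apply: cmeasurable_sum => k; exact: cmeasurableM.
apply: filterS aeE => t h' /h' Et.
by rewrite /U indicE mem_set// mul1r mulr_suml.
Qed.

End cintegral_series.

Lemma has_sum_bij (R : realType) (I J : choiceType) (e : I -> J) (u : J -> R[i]) v :
  bijective e -> has_sum (fun i => u (e i)) v -> has_sum u v.
Proof.
move=> [e' eK e'K]; pose A (B : {fset J}) : {fset I} := [fset e' x | x in B]%fset.
rewrite /has_sum (_ : summability.partial_sum u =
    fun B => summability.partial_sum (fun i => u (e i)) (A B)); last first.
  apply/funext => B; rewrite !partial_sumE big_imfset/=; last by move=> x y _ _ /(can_inj e'K).
  by apply: eq_bigr => x _; rewrite e'K.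
apply: (@cvg_comp _ _ _ A (summability.partial_sum (fun i => u (e i)))).
move=> P [C _ CP]; exists [fset e i | i in C]%fset => //= B /fsubsetP CB.
apply: CP => /=; apply/fsubsetP => i iC; apply/imfsetP; exists (e i) => //=.
by apply: CB; apply/imfsetP; exists i.
Qed.

Section symbols.
Context (R : realType) (q : nat) (X : homogeneous_tree q) (o : X).
Context (nu : probability (boundary o) R).
Hypothesis nuP : is_boundary_measure nu.

Notation phase := (boundary o * measurableTypeR R)%type.
Notation D := (@phase_space R q X o).
Notation base := (base_measure nu).

Let mD : measurable (D : set phase).
Proof. exact: measurable_phase_space. Qed.

(** A ray has pairwise distinct vertices, so the countable set of vertices is infinite. *)
Lemma vertex_enum : exists e : nat -> X, bijective e.
Proof.
have : ([set: X] #= [set: nat])%card.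
  rewrite card_eq_le; apply/andP; split; first exact: countable_vertices.
  have [w _] := ray_ex o; apply: (@card_le_trans _ _ _ (range w)); last exact: subset_card_le.
  have wi : {in [set: nat] &, injective (w : nat -> X)}.
    by move=> m n _ _ e; rewrite -(dist_ray w m) e dist_ray.
  by have := inj_card_eq wi; rewrite card_eq_le => /andP[].
move=> /card_set_bijP[f]; rewrite setTT_bijective => -[e eK e'K].
by exists e; exists f.
Qed.

Let densityC (z : phase) : R[i] := (plancherel_density q z.2)%:C.

Lemma dnumu_integralE (F : boundary o -> R -> R[i]) :
  dnumu_integral nu F = cintegral base D (fun z => densityC z * F z.1 z.2).
Proof.
by apply: complex_ext => /=; apply: eq_Rintegral => z _;
  rewrite ?cReM ?cImM /= mul0r ?subr0 ?addr0.
Qed.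

Lemma dnumu_integrableE (F : boundary o -> R -> R[i]) : dnumu_integrable nu F ->
  cintegrable base D (fun z => densityC z * F z.1 z.2).
Proof.
move=> [Fr Fi]; split; [apply: eq_integrable Fr|apply: eq_integrable Fi] => // z _;
  by rewrite ?cReM ?cImM /= mul0r ?subr0 ?addr0.
Qed.

(** The exceptional set is contained in the two ends of the period, which form a null set. *)
Lemma ae_density_gt0 : {ae base, forall z, D z -> 0 < plancherel_density q z.2}.
Proof.
pose N : set phase := setT `*` [set 0; tau R q].
have mN : measurable N.
  by apply: measurableX; [exact: measurableT|apply: measurableU; exact: measurable_set1].
exists N; split => //.
  rewrite [LHS](@product_measure1E _ _ _ _ _ nu lebesgue_measure)//.
    rewrite [X in (_ * X)%E]countable_lebesgue_measure0 ?mule0//.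
    by apply: finite_set_countable; rewrite finite_setU.
  by apply: measurableU; exact: measurable_set1.
move=> [w s] /= h; split => //=; apply: contrapT => n; apply: h => -[_ /=].
rewrite in_itv/= => /andP[s0 st]; apply: (density_gt0 X).
by rewrite !lt_neqAle s0 st !andbT; apply/andP; split; apply/eqP => e; apply: n;
  [left|right].
Qed.

Section operator.
Context (sigma : symbol R o) (T Tstar : {linear l2 R X -> l2 R X}).
Hypothesis sT : is_pdo nu sigma T.
Hypothesis adjT : is_adjoint T Tstar.

Definition weighted_symbol x (z : phase) : R[i] :=
  densityC z * (wave z.1 z.2 x * sigma x z.1 z.2).

Notation a := weighted_symbol.
Notation K x b := (T (delta R b) x).

Let kernel x b : cintegrable base D (fun z => a x z * (wave z.1 z.2 b)^*) /\
  K x b = cintegral base D (fun z => a x z * (wave z.1 z.2 b)^*).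
Proof.
have aE z : densityC z * pdo_integrand sigma (delta R b) x z.1 z.2 =
    a x z * (wave z.1 z.2 b)^*.
  by rewrite /pdo_integrand fourier_delta /a !mulrA.
have [|i e] := sT.2 (delta R b) _ x.
  apply: (sub_finite_set _ (finite_set1 b)) => y /=.
  by case: (eqVneq y b) => /= [->|_]; rewrite ?eqxx.
split; first by apply: eq_cintegrable (dnumu_integrableE i) => // z _; exact: aE.
by rewrite e dnumu_integralE; apply: eq_cintegral => z _; exact: aE.
Qed.

(** The wave at the root is 1, so this is the integrability in [is_pdo] for the delta function at
    [o]. *)
Lemma weighted_symbol_integrable x : cintegrable base D (a x).
Proof.
apply: eq_cintegrable (kernel x o).1 => // z _.
by rewrite wave_o conjC1 mulr1.
Qed.

Lemma wave_coef_symbol x b : wave_coef nu (a x) b = K x b.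
Proof. by rewrite (kernel x b).2. Qed.

Lemma inverse_fourier_symbol x b :
  inverse_fourier nu (twisted_conj sigma x) b = (K x b)^*.
Proof.
rewrite (kernel x b).2 -(cintegral_conj mD (kernel x b).1) /inverse_fourier.
rewrite dnumu_integralE; apply: eq_cintegral => z _.
rewrite /twisted_conj -(wave_conj _ _ x) /a !conjM conjCK /densityC conjR /wave; ring.
Qed.

(* The rows of the kernel are the wave coefficients of the weighted symbol, so
   the row norms control the L^1 norms. *)
Lemma weighted_symbol_l1 x k : 0 <= k ->
  \int[base]_(z in D) (k * (`|complex.Re (a x z)| + `|complex.Im (a x z)|)) <=
  l2_norm (Tstar (delta R x)) ^+ 2 + k ^+ 2.
Proof.
have ai := weighted_symbol_integrable x; have [ar ai'] := ai.
rewrite le_eqVlt => /predU1P[<-|k0].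
  under eq_Rintegral do rewrite mul0r.
  by rewrite Rintegral_cst// mul0r expr0n addr0 sqr_ge0.
rewrite RintegralZl//; last exact: cintegrable_bound.
rewrite RintegralD//; try exact: real_integrable_norm.
have [] := @l1_estimate _ _ _ _ _ nuP (a x) (l2_norm (Tstar (delta R x)) ^+ 2) ai _ k^-1.
- move=> l ul; apply: le_trans (le_l2_sqnorm (Tstar (delta R x)) ul).
  apply: ler_sum => y _.
  by rewrite wave_coef_symbol (adjoint_entry _ _ adjT) normc_conj.
- by rewrite invr_gt0.
rewrite invrK; move: (\int[_]_(_ in _) _) (\int[_]_(_ in _) _) => I J.
move: (l2_norm _ ^+ 2) => M h1 h2.
have {h1 h2} h : I + J <= k^-1 * M + k.
  by rewrite -(@ler_pMn2r _ 2)// mulrnDl [leRHS]mulr2n lerD.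
have := ler_wpM2l (ltW k0) h; rewrite (addrC I) (_ : k * (k^-1 * M + k) = M + k ^+ 2)//.
by field; rewrite gt_eqF.
Qed.

Variable C : R.
Hypothesis rowC : forall s : seq X, uniq s ->
  \sum_(x <- s) l2_norm (Tstar (delta R x)) ^+ 2 <= C.

(** In L^1 norm the term of index x is at most the squared norm of [Tstar (delta R x)] plus the
    squared modulus of K(x, b), by [weighted_symbol_l1]. The first parts sum to at most [C], the
    second to at most the squared norm of [T (delta R b)]. Termwise integration against conjugate
    waves turns the coefficients into the sums defining the inner products. *)
Lemma symbol_series b : exists G : phase -> R[i], [/\ cintegrable base D G,
  forall y, wave_coef nu G y = l2_inner (T (delta R y)) (T (delta R b)) &
  {ae base, forall z, D z -> exists2 v, G z = densityC z * v &
    has_sum (fun x => wave z.1 z.2 x * sigma x z.1 z.2 *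
      inverse_fourier nu (twisted_conj sigma x) b) v}].
Proof.
have [e eb] := vertex_enum; have ei := bij_inj eb.
pose u k z := (K (e k) b)^* * a (e k) z.
pose g k z := normc (K (e k) b) *
  (`|complex.Re (a (e k) z)| + `|complex.Im (a (e k) z)|).
have ui k : cintegrable base D (u k).
  by apply: cintegrableZ => //; exact: weighted_symbol_integrable.
have [||||G [Gi Gsum Gcoef]] := @cintegral_series _ _ _ base D mD u g
  (C + l2_norm (T (delta R b)) ^+ 2).
- by move=> k; exact: cintegrable_measurable (ui k).
- move=> k; apply: real_integrableZ => //; apply: cintegrable_bound => //.
  exact: weighted_symbol_integrable.
- move=> k z _; rewrite /u /g normcM normc_conj ler_wpM2l ?normc_ge0//.
  exact: normc_le_ReIm.
- move=> n; apply: (@le_trans _ _ (\sum_(0 <= k < n)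
    (l2_norm (Tstar (delta R (e k))) ^+ 2 + normc (K (e k) b) ^+ 2))).
    by apply: ler_sum => k _; apply: weighted_symbol_l1; exact: normc_ge0.
  have us : uniq [seq e k | k <- index_iota 0 n] by rewrite map_inj_uniq ?iota_uniq.
  rewrite big_split/=; apply: lerD.
    by have := rowC us; rewrite big_map.
  by have := le_l2_sqnorm (T (delta R b)) us; rewrite big_map.
exists G; split => // [y|].
  have := Gcoef (fun z => (wave z.1 z.2 y)^*) _ (cmeasurable_cwave _ _)
    (@cwave_bounded _ _ _ _ _).
  rewrite (_ : (fun n => _) = fun n => \sum_(0 <= k < n)
      (K (e k) y * (K (e k) b)^*)); last first.
    apply/funext => n; apply: eq_bigr => k _; rewrite mulrC (kernel (e k) y).2.
    rewrite -(cintegralZ mD _ (kernel (e k) y).1); apply: eq_cintegral => z _.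
    by rewrite /u mulrA.
  have d := has_sum_series eb (@has_sum_l2_inner _ _ (T (delta R y)) (T (delta R b))).
  by move=> c; exact: (cvg_unique _ c d).
apply: filterS2 Gsum ae_density_gt0 => z Gz rz Dz.
have {}rz : densityC z != 0 by apply/eqP => -[e0]; move: (rz Dz); rewrite e0 ltxx.
exists ((densityC z)^-1 * G z); first by rewrite mulVKf.
apply: (has_sum_bij eb); have := @has_sumZ _ _ _ _ (densityC z)^-1 (Gz Dz).
congr has_sum; apply/funext => k; rewrite /u inverse_fourier_symbol /a.
by rewrite mulrCA mulKf// mulrC.
Qed.

End operator.
End symbols.

(** Both sides are the double sum of the squared moduli of the matrix entries, by rows and by
    columns. The exchange is made on finite rectangles: for finitely many [x], one finite set of [y]
    captures all row norms up to an error. *)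
Lemma adjoint_hilbert_schmidt (R : realType) (I : choiceType)
    (T Tstar : {linear l2 R I -> l2 R I}) C : is_adjoint T Tstar ->
  (forall s, uniq s -> \sum_(y <- s) l2_norm (T (delta R y)) ^+ 2 <= C) ->
  forall s, uniq s -> \sum_(x <- s) l2_norm (Tstar (delta R x)) ^+ 2 <= C.
Proof.
move=> adjT TC s us; pose K y x := normc (T (delta R y) x) ^+ 2.
have fin (l : seq I) : uniq l ->
    \sum_(x <- s) \sum_(y <- l) normc (Tstar (delta R x) y) ^+ 2 <= C.
  move=> ul; rewrite exchange_big/=; apply: le_trans (TC l ul).
  apply: ler_sum => y _; apply: le_trans (le_l2_sqnorm _ us).
  by apply: ler_sum => x _; rewrite (adjoint_entry _ _ adjT) normc_conj.
pose p (x : I) l := \sum_(y <- l) normc (Tstar (delta R x) y) ^+ 2.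
suff approx (e : R) : 0 < e -> forall t : seq I, exists2 l, uniq l &
    forall x, x \in t -> l2_norm (Tstar (delta R x)) ^+ 2 <= p x l + e.
  apply/ler_addgt0Pr => e e0.
  (* The error [e] is shared among the rows; the successor keeps the denominator positive for empty
     [s]. *)
  pose d := e / (size s).+1%:R; have d0 : 0 < d by rewrite divr_gt0.
  have [l ul lP] := approx d d0 s.
  apply: (@le_trans _ _ (\sum_(x <- s) (p x l + d))).
    by rewrite big_seq [leRHS]big_seq; apply: ler_sum => x xs; exact: lP.
  rewrite big_split/=; apply: lerD; first exact: fin.
  rewrite big_const_seq count_predT iter_addr_0 -mulr_natr /d mulrAC ler_pdivrMr//.
  by rewrite ler_wpM2l ?(ltW e0)// ler_nat.
move=> e0; elim=> [|x t [l ul lP]]; first by exists nil.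
have [l' ul' l'P] : exists2 l', uniq l' & l2_norm (Tstar (delta R x)) ^+ 2 <= p x l' + e.
  apply: contrapT => no; suff : l2_norm (Tstar (delta R x)) ^+ 2 <=
      l2_norm (Tstar (delta R x)) ^+ 2 - e by rewrite lerDl oppr_ge0 leNgt e0.
  apply: l2_sqnorm_le => l' ul'; rewrite lerBrDr leNgt; apply/negP => /ltW.
  by move=> h; apply: no; exists l'.
exists (undup (l ++ l')); first exact: undup_uniq.
have mono y m : uniq m -> {subset m <= l ++ l'} -> p y m <= p y (undup (l ++ l')).
  move=> um sm; apply: big_uniq_sub => //; first exact: undup_uniq.
    by move=> z /sm; rewrite mem_undup.
  by move=> z; exact: sqr_ge0.
move=> y; rewrite inE => /predU1P[->|yt].
  by apply: le_trans l'P _; rewrite lerD2r mono// => z zl; rewrite mem_cat zl orbT.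
by apply: le_trans (lP y yt) _; rewrite lerD2r mono// => z zl; rewrite mem_cat zl.
Qed.

Lemma wave_coef_eq0 (R : realType) (q : nat) (X : homogeneous_tree q) (o : X)
    (nu : probability (boundary o) R)
    (F : (boundary o * measurableTypeR R)%type -> R[i]) :
  is_boundary_measure nu -> cintegrable (base_measure nu) (@phase_space R q X o) F ->
  (forall y, wave_coef nu F y = 0) ->
  {ae base_measure nu, forall z, phase_space z -> F z = 0}.
Proof.
move=> nuP Fi F0; have est := l1_estimate nuP (M2 := 0) Fi.
have {}est t : 0 < t ->
    (\int[base_measure nu]_(z in @phase_space R q X o) `|complex.Re (F z)|) *+ 2 <= t /\
    (\int[base_measure nu]_(z in @phase_space R q X o) `|complex.Im (F z)|) *+ 2 <= t.
  move=> t0; have := est _ t^-1; rewrite mulr0 add0r invrK; apply; last by rewrite invr_gt0.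
  by move=> l _; rewrite big1// => y _; rewrite F0 normc0 expr0n.
have small (r : R) : 0 <= r -> (forall t, 0 < t -> r *+ 2 <= t) -> r = 0.
  rewrite le_eqVlt => /predU1P[//|r0] /(_ _ r0).
  by rewrite mulr2n gerDl leNgt r0.
apply: ae_eq0_cintegral => //; first exact: measurable_phase_space.
  by apply: small => [|t /est[]//]; apply: Rintegral_ge0.
by apply: small => [|t /est[]//]; apply: Rintegral_ge0.
Qed.

Local Open Scope complex_scope.

Theorem corollary5p5 (R : realType) (q : nat) (X : homogeneous_tree q) (o : X)
    (nu : probability (boundary o) R) (nuP : is_boundary_measure nu)
    (sigma sigmastar : symbol R o)
    (T Tstar : {linear l2 R X -> l2 R X}) :
  is_pdo nu sigma T -> nuclear T ->
  is_adjoint T Tstar -> is_pdo nu sigmastar Tstar ->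
  ((forall f : l2 R X, T (Tstar f) = Tstar (T f)) <->
   forall b : X, {ae base_measure nu, forall ws, phase_space ws ->
     let w := ws.1 in let s := ws.2 in
     exists v : R[i],
       has_sum (fun x : X => qpow q ((2^-1 -i* s) * (height R w x)%:C) *
         sigma x w s * inverse_fourier nu (twisted_conj sigma x) b) v /\
       has_sum (fun x : X => qpow q ((2^-1 -i* s) * (height R w x)%:C) *
         sigmastar x w s * inverse_fourier nu (twisted_conj sigmastar x) b) v}).
Proof.
move=> sT nucT adjT sTs; have adjTs := adjoint_sym adjT.
have [C TC] := nuclear_hilbert_schmidt nucT.
have TsC := adjoint_hilbert_schmidt adjT TC.
have mD : measurable (@phase_space R q X o : set (boundary o * measurableTypeR R)%type).
  exact: measurable_phase_space.
have aeF : Filter (almost_everywhere (base_measure nu)) by exact: ae_filter_ringOfSetsType.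
(* [G] and [G'] have the two Gram matrices as coefficients. The rows of one kernel are, up to
   conjugation, the columns of the other, so each series takes the Hilbert-Schmidt bound of the
   opposite operator. *)
rewrite (normal_iff_gram adjT); split=> [gram b|H y b];
  have [G [Gi Gcoef Gsum]] := symbol_series nuP sT adjT TsC b;
  have [G' [Gi' Gcoef' Gsum']] := symbol_series nuP sTs adjTs TC b.
  have : {ae base_measure nu, forall z, @phase_space R q X o z -> G z + -1 * G' z = 0}.
    apply: (wave_coef_eq0 nuP) => [|y].
      by apply: cintegrableD => //; exact: cintegrableZ.
    rewrite /wave_coef.
    transitivity (cintegral (base_measure nu) (@phase_space R q X o)
      (fun z => G z * (wave z.1 z.2 y)^* + -1 * (G' z * (wave z.1 z.2 y)^*))).
      by apply: eq_cintegral => z _; ring.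
    have i := cintegrable_coef Gi y; have i' := cintegrable_coef Gi' y.
    rewrite cintegralD//; last exact: cintegrableZ.
    rewrite cintegralZ// -[cintegral _ _ _]/(wave_coef nu G y) Gcoef gram -Gcoef'.
    by rewrite mulN1r subrr.
  move=> GG'; apply: filterS2 (filterI Gsum Gsum') (filterI GG' (ae_density_gt0 nu)).
  move=> z [h h'] [e rho0] Dz /=.
  have [v Gv hv] := h Dz; have [v' Gv' hv'] := h' Dz.
  exists v; split; first exact: hv; suff -> : v = v' by exact: hv'.
  (* [G] and [G'] are the density times the two sums, so their equality gives that of the sums where
     the density is not zero. *)
  have r0 : (plancherel_density q z.2)%:C != 0 :> R[i].
    by apply/eqP => -[r0]; move: (rho0 Dz); rewrite r0 ltxx.
  apply: (mulfI r0); rewrite -Gv -Gv'; move: (e Dz).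
  by rewrite mulN1r => /eqP; rewrite subr_eq0 => /eqP.
(* Conversely, uniqueness of unordered sums identifies [G] and [G'] almost everywhere, hence their
   coefficients. *)
rewrite -Gcoef -Gcoef'; apply: ae_eq_cintegral => //.
- exact: cintegrable_measurable (cintegrable_coef Gi y).
- exact: cintegrable_measurable (cintegrable_coef Gi' y).
apply: filterS2 (filterI Gsum Gsum') (H b) => z [h h'] e Dz.
have [v Gv hv] := h Dz; have [v' Gv' hv'] := h' Dz; have [w [/= hw hw']] := e Dz.
by rewrite Gv Gv' (has_sum_unique hv hw) (has_sum_unique hv' hw').
Qed.
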